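(* Let $\widehat\omega_M$ be a sequence of random point processes on $\mathbb{R}$. Suppose that as $M\to\infty$: (i) $\widehat\omega_M$ converges in distribution to the standard Poisson process; (ii) for all $\varepsilon>0$ $$\lim_{W\to\infty}\limsup_{M\to\infty}\mathbb{P}\left(\left|\sum_{v\in\widehat\omega_M}\frac{\mathbf{1}[|v|>W]}{v}\right|\ge\varepsilon\right)=0$$ and $$\lim_{W\to\infty}\limsup_{M\to\infty}\mathbb{P}\left(\sum_{v\in\widehat\omega_M}\frac{\mathbf{1}[|v|>W]}{v^2}\ge\varepsilon\right)=0 .$$ Then the random functions $$\widehat S_{M,\widehat\omega}(z):=\sum_{v\in\widehat\omega_M}\frac1{v-z},\qquad z\in\mathbb{C}^+,$$ converge in distribution to the Stieltjes-Poisson random function $S_\omega$.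
   Context: The standard Poisson process is the Poisson point process on $\mathbb{R}$ with unit intensity; $\omega$ denotes its (random) configuration. The Stieltjes-Poisson random function is $S_\omega(\zeta)=\lim_{n\to\infty}\sum_{v\in\omega\cap[-n,n]}\frac1{v-\zeta}$, where the limit exists almost surely simultaneously for all $\zeta\in\mathbb{C}^+$; it is known that almost surely $\lim_{\eta\to\infty}S_\omega(i\eta)=i\pi$. Convergence in distribution of point processes is with respect to the vague topology. A Herglotz-Pick function is an analytic function on the upper half plane $\mathbb{C}^+$ with values in $\mathbb{C}^+$. The space of such functions carries the (metrizable, separable) topology of pointwise convergence on $\mathbb{C}^+$, equivalently of uniform convergence on compact subsets of $\mathbb{C}^+$, and convergence in distribution of random Herglotz-Pick functions is weak convergence of their laws on this space. The sums over $\widehat\omega_M$ in the statement are assumed to be well defined (this is automatic for finite configurations; for infinite ones sums of $1/v$ and $1/(v-z)$ are read as limits, assumed to exist, of sums over $\widehat\omega_M\cap[-n,n]$ as $n\to\infty$). *)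

(* Defs.v *)
From HB Require Import structures.
From mathcomp Require Import all_boot all_order all_algebra.
From mathcomp Require Import complex.
From mathcomp Require Import all_classical all_reals all_analysis.
Import Order.TTheory GRing.Theory Num.Theory.
Import numFieldNormedType.Exports.

Set Implicit Arguments.
Unset Strict Implicit.
Unset Printing Implicit Defensive.

Local Open Scope classical_set_scope.
Local Open Scope ring_scope.
Local Open Scope complex_scope.

(* [R[i]] with the norm topology of its modulus; [derivable f z 1] then means
   complex differentiability of [f : R[i] -> R[i]] at [z]. *)
HB.instance Definition _ (R : realType) := NormedModule.copy R[i] R[i]^o.

(* Measurability for the Borel sigma-algebra of [E]. *)
Definition random_element d (T : measurableType d) (E : ptopologicalType)
    (X : T -> E) : Prop :=
  measurable_fun [set: T] (X : T -> g_sigma_algebraType (@open E)).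

(* Weak convergence of the laws; the [X n] need not live on a common
   probability space. *)
Definition cvg_in_distribution (R : realType) (E : ptopologicalType)
    (d : nat -> measure_display) (T : forall n, measurableType (d n))
    (P : forall n, probability (T n) R) (X : forall n, T n -> E)
    (d0 : measure_display) (T0 : measurableType d0) (P0 : probability T0 R)
    (X0 : T0 -> E) : Prop :=
  [/\ (forall n, random_element (X n)), random_element X0 &
      forall F : E -> R, continuous F -> (exists K, forall x, `|F x| <= K) ->
        expectation (P n) (F \o X n) @[n --> \oo]
          --> expectation P0 (F \o X0)].

(* A locally finite configuration, points being counted with multiplicity:
   [c v] is the number of points at [v]. *)
Record configuration (R : realType) := Configuration {
  multiplicity :> R -> nat;
  _ : forall r : R, finite_set [set v | `|v| <= r /\ (0 < multiplicity v)%N] }.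

Record test_function (R : realType) := TestFunction {
  test_fun :> R -> R;
  _ : continuous test_fun;
  _ : compact (closure [set x | test_fun x != 0]) }.

HB.instance Definition _ (R : realType) := gen_eqMixin (test_function R).
HB.instance Definition _ (R : realType) := gen_choiceMixin (test_function R).

Section configurations.
Variable R : realType.
Implicit Types (c : configuration R) (B : set R) (W : R) (z : R[i]).

Program Definition empty_configuration : configuration R :=
  @Configuration R (fun _ => 0%N) _.
Next Obligation.
by move=> r; apply: (@sub_finite_set _ _ set0) => // v [].
Qed.

HB.instance Definition _ := gen_eqMixin (configuration R).
HB.instance Definition _ := gen_choiceMixin (configuration R).
HB.instance Definition _ := isPointed.Build (configuration R) empty_configuration.

(* The vague topology is the coarsest one making all the integrals
   [c |-> \sum_v c v * f v], [f] continuous with compact support,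
   continuous. *)
Definition vague_eval c : {ptws test_function R -> R} :=
  fun f => \sum_(v \in [set: R]) (c v)%:R * f v.

HB.instance Definition _ :=
  Topological.copy (configuration R) (initial_topology vague_eval).

Definition count_points B c : nat := \big[addn/0%N]_(v \in B) c v.

(* Sums over an infinite configuration are limits of the sums over its points
   in [-n, n]. *)
Definition stieltjes_partial_sum c z (n : nat) : R[i] :=
  \sum_(v \in [set v : R | `|v| <= n%:R]) (c v)%:R * (v%:C - z)^-1.

Definition tail_partial_sum c W (n : nat) : R :=
  \sum_(v \in [set v : R | W < `|v| <= n%:R]) (c v)%:R / v.

Definition tail_sum c W : R := limn (tail_partial_sum c W).

Definition square_tail_sum c W : \bar R :=
  \esum_(v in [set v : R | W < `|v|]) ((c v)%:R / v ^+ 2)%:E.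

Definition sums_well_defined c : Prop :=
  (forall W, 0 < W -> cvgn (tail_partial_sum c W)) /\
  (forall z, 0 < complex.Im z -> cvgn (stieltjes_partial_sum c z)).
End configurations.

(* Herglotz-Pick functions, extended by [0] off the upper half plane, so that
   two of them are equal as soon as they agree on the upper half plane. *)
Record herglotz_pick (R : realType) := HerglotzPick {
  herglotz_fun :> R[i] -> R[i];
  _ : forall z, 0 < complex.Im z -> derivable herglotz_fun z 1;
  _ : forall z, 0 < complex.Im z -> 0 < complex.Im (herglotz_fun z);
  _ : forall z, complex.Im z <= 0 -> herglotz_fun z = 0 }.

Section herglotz_pick.
Variable R : realType.

Program Definition herglotz_i : herglotz_pick R :=
  @HerglotzPick R (fun z => if 0 < complex.Im z then 'i else 0) _ _ _.
Next Obligation.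
move=> z z0; apply: (@near_eq_derivable _ _ _ (cst 'i)); last exact: derivable_cst.
have Im_pos : \forall w \near z, 0 < complex.Im w.
  exists (complex.Im z)%:C => /=; first by rewrite ltcR.
  move=> w /=; have := normc_ge_Re ((z - w) * 'i).
  rewrite ReiNIm normrN normrM [`|'i|](_ : _ = 1) ?mulr1; last first.
    by rewrite normc_def /= expr0n expr1n add0r sqrtr1.
  move=> /le_lt_trans /[apply]; rewrite ltcR raddfB/=.
  by move=> /(le_lt_trans (ler_norm _)); rewrite ltrBlDr ltrDl.
by near=> w; rewrite ifT //; near: w.
Unshelve. all: by end_near.
Qed.
Next Obligation. by move=> z z0 /=; rewrite z0. Qed.
Next Obligation. by move=> z /le_gtF z0 /=; rewrite z0. Qed.

HB.instance Definition _ := gen_eqMixin (herglotz_pick R).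
HB.instance Definition _ := gen_choiceMixin (herglotz_pick R).
HB.instance Definition _ := isPointed.Build (herglotz_pick R) herglotz_i.

Definition herglotz_eval (h : herglotz_pick R) : {ptws R[i] -> R[i]} := h.

(* Pointwise convergence; the points off the upper half plane play no role, as
   all the functions vanish there. *)
HB.instance Definition _ :=
  Topological.copy (herglotz_pick R) (initial_topology herglotz_eval).

(* [z |-> \sum_(v in c) 1 / (v - z)]. The default value [herglotz_i] is only
   taken when the sums do not converge to a Herglotz-Pick function; if they do
   converge, this means that [c] is empty, the sum being then [0]. *)
Definition stieltjes (c : configuration R) : herglotz_pick R :=
  xget herglotz_i [set h : herglotz_pick R | forall z, 0 < complex.Im z ->
    stieltjes_partial_sum c z n @[n --> \oo] --> h z].
End herglotz_pick.

(* The argument [0%N] is not used by [poisson_prob], whose value for rate [0]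
   is the Dirac mass at [0]. *)
Definition standard_poisson (R : realType) (d : measure_display)
    (T : measurableType d) (P : probability T R) (omega : T -> configuration R) :=
  [/\ random_element omega,
      (forall (B : set R), measurable B -> bounded_set B -> forall k,
        P [set t | count_points B (omega t) = k] =
          poisson_prob (fine (lebesgue_measure B)) 0%N [set k]) &
      (forall (n : nat) (B : 'I_n -> set R) (k : 'I_n -> nat),
        (forall i, measurable (B i)) -> (forall i, bounded_set (B i)) ->
        trivIset [set: 'I_n] B ->
        P [set t | forall i, count_points (B i) (omega t) = k i] =
          (\prod_(i < n) P [set t | count_points (B i) (omega t) = k i])%E)].

(* Main.v *)
(** The transform [S_c(z)] of a configuration [c] is approximated by that of a
    continuously cut off configuration, [G_n(c)(z) = sum_v chi_n(v) / (v - z) + i / (n + 1)],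
    which is a continuous function of [c] for the vague topology and always a
    Herglotz-Pick function. If [c] has no point where [0 < chi_n < 1], then
    [|S_c(z) - G_n(c)(z)|] is at most the tail sum of [1 / v] plus [2 |z|] times
    the tail sum of [1 / v ^ 2] plus [1 / (n + 1)]; the exceptional event is
    dominated by a continuous functional of [c], whose mean under the Poisson
    process tends to [0]. Hence [F(S)] and [F(G_n)] have close means when [F] is
    Lipschitz in the values at finitely many points. A bounded continuous [F] is
    bounded below by such functions, which converge to it along Stieltjes
    transforms, because these satisfy a Schwarz-Pick inequality; applying this to
    [F] and to [- F] gives the convergence of the means.

    For the Poisson process, the sums [S] converge almost surely: up to an
    absolutely convergent series, [Re S(i)] is [sum_j (N_j - N'_j) j / (j ^ 2 + 1)],
    where the numbers of points [N_j], [N'_j] in disjoint unit intervals are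
    uncorrelated, and convergence at one point implies convergence everywhere. *)

Require Import Defs.
From mathcomp Require Import all_boot all_order all_algebra.
From mathcomp Require Import complex ring lra zify.
From mathcomp Require Import all_classical all_reals all_analysis.
From mathcomp Require Import measurable_realfun.
Import Order.TTheory GRing.Theory Num.Theory.
Import numFieldNormedType.Exports.

Set Implicit Arguments.
Unset Strict Implicit.
Unset Printing Implicit Defensive.

Local Open Scope classical_set_scope.
Local Open Scope ring_scope.
Local Open Scope complex_scope.

Local Notation Re := (@complex.Re _).
Local Notation Im := (@complex.Im _).
Local Notation normc := (@Normc.normc _).

(** The vague topology tests configurations only against continuous functions with compact support,
    so neither the transform nor a sharp window depends continuously on [c]. Hence a continuous
    cutoff, and a separate functional [bad] for the configurations on which it differs from a
    window. The constant [i / (n + 1)] keeps the imaginary part positive when the cutoff sees no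
    point. The transition zone has width [(n + 1) ^- 2], so that the mean numbers of Poisson points
    in it are summable in [n].

    Pointwise neighbourhoods involve arbitrary points of the upper half plane, the estimates only
    finitely many. The Schwarz-Pick inequality bridges the two: it bounds the oscillation of a
    function near [z] by its imaginary part, so that a countable dense set of points decides, both
    for Borel sets and for the approximation of [F]. Since lower bounds for [F] and [- F] suffice,
    the approximation is refined only under the law of the limit process, and no tightness is
    required.

    For the Poisson series, only second moments enter: grouping the terms between consecutive cubes
    makes them summable without a maximal inequality. *)

Section complex_facts.
Variable R : realType.
Implicit Types (z w : R[i]) (v : R).

Lemma normr_normc z : `|z| = (normc z)%:C.
Proof. by case: z. Qed.

Lemma normc_ge0 z : 0 <= normc z.
Proof. by case: z => a b /=; rewrite sqrtr_ge0. Qed.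

Lemma sqr_normcE z : normc z ^+ 2 = Re z ^+ 2 + Im z ^+ 2.
Proof. by case: z => a b /=; rewrite sqr_sqrtr// addr_ge0 ?sqr_ge0. Qed.

Lemma Re_le_normc z : `|Re z| <= normc z.
Proof. by rewrite -lecR -normr_normc normc_ge_Re. Qed.

Lemma Im_le_normc z : `|Im z| <= normc z.
Proof.
by case: z => a b /=; rewrite -sqrtr_sqr ler_wsqrtr// lerDr sqr_ge0.
Qed.

Lemma normc_le_ReIm z : normc z <= `|Re z| + `|Im z|.
Proof.
rewrite -(@ler_pXn2r _ 2) ?nnegrE ?normc_ge0 ?addr_ge0//.
rewrite sqr_normcE sqrrD !real_normK ?num_real//.
by rewrite -addrA lerD2l lerDr mulrn_wge0// mulr_ge0.
Qed.

Lemma normcD z w : normc (z + w) <= normc z + normc w.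
Proof. exact: le_normcD. Qed.

Lemma normcN z : normc (- z) = normc z.
Proof. exact: complex.normcN. Qed.

Lemma normcB z w : normc (z - w) = normc (w - z).
Proof. by rewrite -normcN opprB. Qed.

Lemma normc_sum (I : Type) (s : seq I) (P : pred I) (f : I -> R[i]) :
  normc (\sum_(i <- s | P i) f i) <= \sum_(i <- s | P i) normc (f i).
Proof.
elim/big_ind2 : _ => //; first by rewrite Normc.normc0.
by move=> x a y b xa yb; rewrite (le_trans (normcD _ _))// lerD.
Qed.

Lemma Re_addc z w : Re (z + w) = Re z + Re w. Proof. by case: z; case: w. Qed.
Lemma Im_addc z w : Im (z + w) = Im z + Im w. Proof. by case: z; case: w. Qed.
Lemma Re_oppc z : Re (- z) = - Re z. Proof. by case: z. Qed.
Lemma Im_oppc z : Im (- z) = - Im z. Proof. by case: z. Qed.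
Lemma Re_mulc z w : Re (z * w) = Re z * Re w - Im z * Im w.
Proof. by case: z; case: w. Qed.
Lemma Im_mulc z w : Im (z * w) = Re z * Im w + Im z * Re w.
Proof. by case: z; case: w. Qed.

Lemma Re_sum (I : Type) (s : seq I) (f : I -> R[i]) :
  Re (\sum_(i <- s) f i) = \sum_(i <- s) Re (f i).
Proof. by apply: (big_morph _ Re_addc). Qed.

Lemma Im_sum (I : Type) (s : seq I) (f : I -> R[i]) :
  Im (\sum_(i <- s) f i) = \sum_(i <- s) Im (f i).
Proof. by apply: (big_morph _ Im_addc). Qed.

(** The order of [R[i]] compares only numbers with equal imaginary parts, so a positive radius for
    its norm is a real one. *)
Lemma gt0_complex z : 0 < z -> exists2 e : R, 0 < e & z = e%:C.
Proof. by case: z => a b; rewrite ltcE /= => /andP[/eqP -> a0]; exists a. Qed.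

Lemma cvg_complexP (T : Type) (F : set_system T) (FF : Filter F)
    (f : T -> R[i]) (l : R[i]) :
  f @ F --> l <-> (Re \o f @ F --> Re l) /\ (Im \o f @ F --> Im l).
Proof.
split.
  move=> /cvgrPdist_lt fl; split; apply/cvgrPdist_lt => e e0;
    have := fl e%:C; rewrite ltcR => /(_ e0); apply: filterS => t /=;
    rewrite normr_normc ltcR; apply: le_lt_trans; rewrite -?Re_oppc -?Im_oppc -?Re_addc -?Im_addc.
  - exact: Re_le_normc.
  - exact: Im_le_normc.
move=> [/cvgrPdist_lt fr /cvgrPdist_lt fi]; apply/cvgrPdist_lt => _ /gt0_complex[e e0 ->].
have e2 : 0 < e / 2 by rewrite divr_gt0.
move: (fr _ e2) (fi _ e2); apply: filterS2 => t /= h1 h2; rewrite normr_normc ltcR.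
rewrite (le_lt_trans (normc_le_ReIm _))// Re_addc Im_addc Re_oppc Im_oppc.
by rewrite (splitr e) ltrD.
Qed.

Lemma cvg_complexB (T : Type) (F : set_system T) (FF : Filter F)
    (f g : T -> R[i]) (l m : R[i]) :
  f @ F --> l -> g @ F --> m -> (fun t => f t - g t) @ F --> l - m.
Proof.
move=> /cvg_complexP[fr fi] /cvg_complexP[gr gi]; apply/cvg_complexP.
split; rewrite ?Re_addc ?Im_addc ?Re_oppc ?Im_oppc.
- rewrite [X in X @ _ --> _](_ : _ = (fun t => Re (f t) - Re (g t))).
    exact: (cvgB fr gr).
  by apply/funext => t /=; rewrite Re_addc Re_oppc.
- rewrite [X in X @ _ --> _](_ : _ = (fun t => Im (f t) - Im (g t))).
    exact: (cvgB fi gi).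
  by apply/funext => t /=; rewrite Im_addc Im_oppc.
Qed.

Lemma cvg_complexM (T : Type) (F : set_system T) (FF : Filter F)
    (f g : T -> R[i]) (l m : R[i]) :
  f @ F --> l -> g @ F --> m -> (fun t => f t * g t) @ F --> l * m.
Proof.
move=> /cvg_complexP[fr fi] /cvg_complexP[gr gi]; apply/cvg_complexP.
split; rewrite ?Re_mulc ?Im_mulc.
- rewrite [X in X @ _ --> _](_ : _ =
      (fun t => Re (f t) * Re (g t) - Im (f t) * Im (g t))).
    exact: (cvgB (cvgM fr gr) (cvgM fi gi)).
  by apply/funext => t /=; rewrite Re_mulc.
- rewrite [X in X @ _ --> _](_ : _ =
      (fun t => Re (f t) * Im (g t) + Im (f t) * Re (g t))).
    exact: (cvgD (cvgM fr gi) (cvgM fi gr)).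
  by apply/funext => t /=; rewrite Im_mulc.
Qed.

Lemma continuous_complexP (T : topologicalType) (f : T -> R[i]) :
  continuous f <-> continuous (Re \o f) /\ continuous (Im \o f).
Proof.
split=> [fc|[fr fi] t]; last by apply/cvg_complexP; split; [exact: fr|exact: fi].
by split=> t; have /cvg_complexP[] := fc t.
Qed.

Lemma cvg_normc (T : Type) (F : set_system T) (FF : Filter F)
    (f : T -> R[i]) (l : R[i]) :
  f @ F --> l -> normc \o f @ F --> normc l.
Proof.
move=> /cvgrPdist_lt fl; apply/cvgrPdist_lt => e e0.
have := fl e%:C; rewrite ltcR => /(_ e0); apply: filterS => t /=.
rewrite normr_normc ltcR; apply: le_lt_trans.
have h1 := normcD (l - f t) (f t); have h2 := normcD (f t - l) l.
have h3 := normcB (f t) l.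
move: h1 h2; rewrite !subrK h3 => h1 h2.
by rewrite ler_norml; apply/andP; split; lra.
Qed.

Lemma normc_real v : normc v%:C = `|v|.
Proof. by rewrite /= expr0n/= addr0 sqrtr_sqr. Qed.

End complex_facts.

(** * Bounds on the Cauchy kernel [1 / (v - z)] *)

Section kernels.
Variable R : realType.
Implicit Types (z w : R[i]) (v : R).

(* Weaker than the Schwarz-Pick lemma, whose general proof needs the maximum
   principle; for Stieltjes transforms it is an instance of
   [2 |a b| <= |a|^2 + |b|^2]. *)
Definition schwarz_pick (f : R[i] -> R[i]) := forall z w, 0 < Im z -> 0 < Im w ->
  normc (f z - f w) <= normc (z - w) * (Im (f z) / Im z + Im (f w) / Im w).

Lemma ler_normc_Im v z : 0 < Im z -> Im z <= normc (v%:C - z).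
Proof.
move=> z0; apply: le_trans (Im_le_normc _); rewrite Im_addc Im_oppc /= add0r normrN.
by rewrite ler_norm.
Qed.

Lemma normc_sub_gt0 v z : 0 < Im z -> 0 < normc (v%:C - z).
Proof. by move=> z0; exact: lt_le_trans z0 (ler_normc_Im _ z0). Qed.

Lemma sub_real_neq0 v z : 0 < Im z -> v%:C - z != 0.
Proof.
move=> z0; apply/eqP => vz; have := normc_sub_gt0 v z0.
by rewrite vz Normc.normc0 ltxx.
Qed.

(** Up to the factor [Im z / pi], the Poisson kernel of the half plane. Its sums are read off the
    imaginary part of a transform, and it dominates every other kernel below. *)
Definition sqker z v : R := normc (v%:C - z) ^- 2.

Lemma sqker_ge0 z v : 0 <= sqker z v.
Proof. by rewrite /sqker invr_ge0 exprn_ge0// normc_ge0. Qed.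

Lemma sqker_gt0 z v : 0 < Im z -> 0 < sqker z v.
Proof. by move=> z0; rewrite /sqker invr_gt0 exprn_gt0// normc_sub_gt0. Qed.

Lemma sqkerE z v : sqker z v = ((v - Re z) ^+ 2 + Im z ^+ 2)^-1.
Proof. by rewrite /sqker sqr_normcE Re_addc Im_addc Re_oppc Im_oppc /= add0r sqrrN. Qed.

Lemma Im_inv_sub z v : Im ((v%:C - z)^-1) = Im z * sqker z v.
Proof. by rewrite sqkerE; case: z => a b /=; rewrite sub0r sqrrN mulNr opprK. Qed.

Lemma Re_inv_sub z v : Re ((v%:C - z)^-1) = (v - Re z) * sqker z v.
Proof. by rewrite sqkerE; case: z => a b /=; rewrite sub0r sqrrN. Qed.

(** A Harnack-type comparison: [|v - w| <= |v - z| + |z - w|], and [|v - z| >= Im z] makes the last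
    term a multiple of [|v - z|], uniformly in [v]. *)
Lemma sqker_le z w v : 0 < Im z -> 0 < Im w ->
  sqker z v <= (1 + normc (z - w) / Im z) ^+ 2 * sqker w v.
Proof.
move=> z0 w0; have nz := normc_sub_gt0 v z0; have nw := normc_sub_gt0 v w0.
rewrite /sqker -exprVn -exprVn -exprMn; apply: lerXn2r.
- by rewrite nnegrE invr_ge0 ltW.
- by rewrite nnegrE mulr_ge0 ?invr_ge0 ?addr_ge0 ?divr_ge0 ?normc_ge0 // ltW.
rewrite ler_pdivlMr// mulrC ler_pdivrMr//.
have : normc (v%:C - w) <= normc (v%:C - z) + normc (z - w).
  by rewrite (le_trans _ (normcD _ _))// addrA subrK.
move=> /le_trans; apply; rewrite mulrDl mul1r lerD2l.
rewrite mulrAC ler_pdivlMr// ler_wpM2l ?normc_ge0//; exact: ler_normc_Im.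
Qed.

Lemma normc_inv_mul z w v : 0 < Im z -> 0 < Im w ->
  normc ((v%:C - z)^-1 * (v%:C - w)^-1) <= sqker z v + sqker w v.
Proof.
move=> z0 w0; rewrite Normc.normcM !Normc.normcV /sqker -!exprVn.
set a := _^-1; set b := _^-1.
have : 0 <= (a - b) ^+ 2 by exact: sqr_ge0.
have := sqr_ge0 a; have := sqr_ge0 b.
rewrite !expr2; nra.
Qed.

Lemma derivable_quadratic (f : R[i] -> R[i]) z L (C r : R) : 0 < r ->
  (forall w, normc (w - z) < r ->
    normc (f w - f z - (w - z) * L) <= C * normc (w - z) ^+ 2) ->
  derivable f z 1.
Proof.
move=> r0 fq; apply/cvg_ex; exists L; apply/cvgrPdist_lt => _ /gt0_complex[e e0 ->].
(* [|C| + 1] rather than [C]: the constant [C] may be zero or negative. *)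
pose d := Num.min r (e / (`|C| + 1)).
have d0 : 0 < d by rewrite lt_min r0 divr_gt0// ltr_wpDl.
have hd : \forall h \near (0 : R[i])^', normc h < d /\ h != 0.
  near=> h; split; last by near: h; exact: nbhs_dnbhs_neq.
  suff : `|h| < d%:C by rewrite normr_normc ltcR.
  by near: h; apply: (@dnbhs0_lt R[i] R[i]); rewrite ltcR.
apply: filterS hd => h [hd hn0] /=; rewrite normr_normc ltcR.
have := fq (h + z); rewrite addrK => /(_ (lt_le_trans hd _)).
rewrite ge_min lexx => /(_ isT) hq.
have nh : 0 < normc h.
  rewrite lt_neqAle normc_ge0 andbT eq_sym; apply: contraNneq hn0.
  by move=> /Normc.eq0_normc ->.
have -> : L - h^-1 *: (f (h *: 1 + z) - f z) =
   - (h^-1 * (f (h + z) - f z - h * L)).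
  rewrite -[h^-1 *: _]/(h^-1 * _) -[h *: 1]/(h * 1) mulr1.
  by rewrite (mulrBr h^-1 (f (h + z) - f z)) mulKf// opprB.
rewrite normcN Normc.normcM Normc.normcV mulrC ltr_pdivrMr//.
apply: le_lt_trans hq _; rewrite expr2 mulrA ltr_pM2r//.
move: hd; rewrite lt_min => /andP[_]; rewrite ltr_pdivlMr ?ltr_wpDl// => he.
have := ler_norm C; have := normr_ge0 C; nra.
Unshelve. all: by end_near.
Qed.
End kernels.

(** * Stieltjes transforms *)

Section weighted_sums.
Variables (R : realType) (s : nat -> seq R) (q : R -> R).
Implicit Types (z w : R[i]) (v : R) (n : nat).
Hypothesis q_ge0 : forall v, 0 <= q v.
Hypothesis s_mono : forall g : R -> R, (forall v, 0 <= g v) ->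
  {homo (fun n => \sum_(v <- s n) q v * g v) : n m / (n <= m)%N >-> n <= m}.

Let wsum (g : R -> R) n := \sum_(v <- s n) q v * g v.

Lemma wsum_ge0 (g : R -> R) n : (forall v, 0 <= g v) -> 0 <= wsum g n.
Proof. by move=> g0; apply: sumr_ge0 => v _; rewrite mulr_ge0. Qed.

(** [g = (g + C h) - C h] is a difference of nonnegative functions, whose weighted sums increase and
    stay below [2 C B] and [C B]. *)
Lemma is_cvg_wsum (g h : R -> R) (C B : R) : 0 <= C ->
  (forall v, `|g v| <= C * h v) -> (forall v, 0 <= h v) ->
  (forall n, wsum h n <= B) -> cvgn (wsum g).
Proof.
move=> C0 gh h0 hB.
have -> : wsum g = (fun n => wsum (fun v => g v + C * h v) n - C * wsum h n).
  apply/funext => n; rewrite /wsum mulr_sumr -sumrB; apply: eq_bigr => v _.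
  by rewrite mulrDr mulrCA addrK.
have hb u : (forall v, 0 <= u v) -> (exists B', forall n, wsum u n <= B') ->
    cvgn (wsum u).
  move=> u0 [B' uB]; apply: nondecreasing_is_cvgn; first exact: s_mono.
  by exists B' => _ [n _ <-].
apply: is_cvgB.
  apply: hb.
    by move=> v; have := gh v; rewrite ler_norml => /andP[]; rewrite -subr_ge0 opprK.
  exists (2 * C * B) => n.
  apply: (@le_trans _ _ (2 * C * wsum h n)); last first.
    by rewrite ler_wpM2l// mulr_ge0.
  rewrite /wsum mulr_sumr ler_sum// => v _; rewrite mulrCA ler_wpM2l//.
  rewrite -mulrA mulr_natl mulr2n lerD2r.
  exact: le_trans (ler_norm _) (gh v).
apply: is_cvgM; first exact: is_cvg_cst.
by apply: hb => //; exists B.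
Qed.

Lemma is_cvg_complex_wsum (g : R -> R[i]) (h : R -> R) (C B : R) : 0 <= C ->
  (forall v, normc (g v) <= C * h v) -> (forall v, 0 <= h v) ->
  (forall n, wsum h n <= B) -> cvgn (fun n => \sum_(v <- s n) (q v)%:C * g v).
Proof.
move=> C0 gh h0 hB.
have hR : cvgn (wsum (Re \o g)).
  by apply: (is_cvg_wsum C0 _ h0 hB) => v; apply: le_trans (gh v); exact: Re_le_normc.
have hI : cvgn (wsum (Im \o g)).
  by apply: (is_cvg_wsum C0 _ h0 hB) => v; apply: le_trans (gh v); exact: Im_le_normc.
apply/cvg_ex; exists (limn (wsum (Re \o g)) +i* limn (wsum (Im \o g))).
apply/cvg_complexP; split.
  rewrite [X in X @ _ --> _](_ : _ = wsum (Re \o g))//.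
  apply/funext => n /=; rewrite Re_sum; apply: eq_bigr => v _.
  by rewrite Re_mulc /= mul0r subr0.
rewrite [X in X @ _ --> _](_ : _ = wsum (Im \o g))//.
apply/funext => n /=; rewrite Im_sum; apply: eq_bigr => v _.
by rewrite Im_mulc /= mul0r addr0.
Qed.

Variable k : R.
Hypothesis k_ge0 : 0 <= k.

(** Used twice: with unit weights and [k = 0] for the sums over growing windows, and with the cutoff
    as weight, lists constant in [n] and [k > 0] for the truncated transform. *)
Definition wstieltjes n z : R[i] :=
  \sum_(v <- s n) (q v)%:C * (v%:C - z)^-1 + k *i.

Lemma Im_wstieltjes n z : Im (wstieltjes n z) = Im z * wsum (sqker z) n + k.
Proof.
rewrite Im_addc /= Im_sum mulr_sumr; congr (_ + _); apply: eq_bigr => v _.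
by rewrite Im_mulc Im_inv_sub /= mul0r addr0 mulrCA.
Qed.

Lemma wsum_sqker_le n z : 0 < Im z ->
  wsum (sqker z) n <= Im (wstieltjes n z) / Im z.
Proof.
by move=> z0; rewrite Im_wstieltjes ler_pdivlMr// mulrC lerDl.
Qed.

Lemma inv_sub_sub v z w : 0 < Im z -> 0 < Im w ->
  (v%:C - z)^-1 - (v%:C - w)^-1 = (z - w) * ((v%:C - z)^-1 * (v%:C - w)^-1).
Proof.
move=> z0 w0; have := sub_real_neq0 v z0; have := sub_real_neq0 v w0.
move=> h1 h2; field; rewrite h1 h2//.
Qed.

(** The resolvent identity, the constants [k] cancelling. A conditionally convergent sum of terms of
    order [1 / v] is thereby compared, at two points, through an absolutely convergent one. *)
Lemma wstieltjes_sub n z w : 0 < Im z -> 0 < Im w ->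
  wstieltjes n z - wstieltjes n w =
  (z - w) * \sum_(v <- s n) (q v)%:C * ((v%:C - z)^-1 * (v%:C - w)^-1).
Proof.
move=> z0 w0; rewrite /wstieltjes opprD addrACA subrr addr0 -sumrB mulr_sumr.
by apply: eq_bigr => v _; rewrite -mulrBr inv_sub_sub// mulrCA.
Qed.

Lemma normc_wsum n (g : R -> R[i]) (h : R -> R) :
  (forall v, normc (g v) <= h v) ->
  normc (\sum_(v <- s n) (q v)%:C * g v) <= wsum h n.
Proof.
move=> gh; apply: le_trans (normc_sum _ _ _) _; apply: ler_sum => v _.
by rewrite Normc.normcM normc_real ger0_norm// ler_wpM2l.
Qed.

Lemma schwarz_pick_wstieltjes n : schwarz_pick (wstieltjes n).
Proof.
move=> z w z0 w0; rewrite wstieltjes_sub// Normc.normcM.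
rewrite ler_wpM2l ?normc_ge0//.
apply: le_trans (normc_wsum n (fun v => normc_inv_mul v z0 w0)) _.
apply: (@le_trans _ _ (wsum (sqker z) n + wsum (sqker w) n)).
  by rewrite /wsum -big_split/= ler_sum// => v _; rewrite mulrDr.
by apply: lerD; exact: wsum_sqker_le.
Qed.

(** A second use of the resolvent identity. The remainder is bounded by the value at [z] alone, with
    a constant that passes to the limit in [n]; complex differentiability of the limit follows
    without exchanging limit and derivative. *)
Lemma wstieltjes_taylor n z w : 0 < Im z -> 0 < Im w ->
  normc (wstieltjes n w - wstieltjes n z -
    (w - z) * \sum_(v <- s n) (q v)%:C * (v%:C - z) ^- 2) <=
  (Im (wstieltjes n z) / Im z) / Im w * normc (w - z) ^+ 2.
Proof.
move=> z0 w0.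
rewrite wstieltjes_sub// -mulrBr -sumrB.
under eq_bigr => v _.
  rewrite -mulrBr.
  have -> : (v%:C - w)^-1 * (v%:C - z)^-1 - (v%:C - z) ^- 2 =
      (w - z) * ((v%:C - z) ^- 2 * (v%:C - w)^-1).
    have := sub_real_neq0 v z0; have := sub_real_neq0 v w0.
    by move=> h1 h2; field; rewrite h1 h2.
  rewrite mulrCA; over.
rewrite -mulr_sumr mulrA -expr2 Normc.normcM expr2 Normc.normcM -expr2 mulrC.
rewrite ler_wpM2r ?exprn_ge0 ?normc_ge0//.
apply: (@le_trans _ _ (wsum (fun v => sqker z v / Im w) n)).
  apply: normc_wsum => v; rewrite Normc.normcM 2!Normc.normcV expr2 Normc.normcM -expr2.
  rewrite ler_wpM2l ?sqker_ge0// lef_pV2 ?posrE ?normc_sub_gt0//.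
  exact: ler_normc_Im.
rewrite /wsum; under eq_bigr do rewrite mulrA.
by rewrite -mulr_suml ler_wpM2r ?invr_ge0 ?(ltW w0)//; exact: wsum_sqker_le.
Qed.

Variable z0 : R[i].
Hypothesis z0_gt0 : 0 < Im z0.
Hypothesis cvg_z0 : cvgn (fun n => wstieltjes n z0).

(** Convergence at [z0] bounds the imaginary parts there, hence the sums of [sqker z0]; [sqker_le]
    carries the bound over to [z]. *)
Lemma wsum_sqker_bounded z : 0 < Im z -> exists B, forall n, wsum (sqker z) n <= B.
Proof.
move=> zp; have /cvg_ex[l /cvg_complexP[_ hI]] := cvg_z0.
have [B hB] : exists B, forall n, Im (wstieltjes n z0) <= B.
  have /cvg_seq_bounded[B [_ hB]] : cvgn (fun n => Im (wstieltjes n z0)).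
    by apply/cvg_ex; exists (Im l).
  exists (B + 1) => n; apply: le_trans (ler_norm _) _.
  by apply: hB => //; rewrite ltrDl.
exists ((1 + normc (z - z0) / Im z) ^+ 2 * (B / Im z0)) => n.
apply: (@le_trans _ _ ((1 + normc (z - z0) / Im z) ^+ 2 * wsum (sqker z0) n)).
  rewrite /wsum mulr_sumr ler_sum// => v _; rewrite mulrCA ler_wpM2l//.
  exact: sqker_le.
rewrite ler_wpM2l ?sqr_ge0//; apply: le_trans (wsum_sqker_le n z0_gt0) _.
by rewrite ler_wpM2r// invr_ge0 ltW.
Qed.

(** The difference with the value at [z0] is [z - z0] times a sum dominated by
    [sqker z + sqker z0]. *)
Lemma is_cvg_wstieltjes z : 0 < Im z -> cvgn (fun n => wstieltjes n z).
Proof.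
move=> zp.
have -> : (fun n => wstieltjes n z) = (fun n => wstieltjes n z0 +
  (z - z0) * \sum_(v <- s n) (q v)%:C * ((v%:C - z)^-1 * (v%:C - z0)^-1)).
  by apply/funext => n; rewrite -wstieltjes_sub// addrC subrK.
have [B hB] := wsum_sqker_bounded zp; have [B0 hB0] := wsum_sqker_bounded z0_gt0.
have [l hl] : exists l : R[i], \sum_(v <- s n) (q v)%:C *
    ((v%:C - z)^-1 * (v%:C - z0)^-1) @[n --> \oo] --> l; last first.
  have /cvg_ex[l0 hl0] := cvg_z0; apply/cvg_ex; exists (l0 - (z0 - z) * l).
  rewrite [X in X @ _ --> _](_ : _ = (fun n => wstieltjes n z0 -
      (z0 - z) * \sum_(v <- s n) (q v)%:C * ((v%:C - z)^-1 * (v%:C - z0)^-1))).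
    apply: cvg_complexB; first exact: hl0.
    by apply: cvg_complexM; [exact: cvg_cst|exact: hl].
  by apply/funext => n; rewrite -[z0 - z]opprB mulNr opprK.
apply/cvg_ex.
apply: (@is_cvg_complex_wsum _ (fun v => sqker z v + sqker z0 v) 1 (B + B0)) => //.
- by move=> v; rewrite mul1r; exact: normc_inv_mul.
- by move=> v; rewrite addr_ge0 ?sqker_ge0.
- move=> n; rewrite /wsum; under eq_bigr do rewrite mulrDr.
  by rewrite big_split/= lerD ?hB ?hB0.
Qed.

Let slim z : R[i] := limn (fun n => wstieltjes n z).

Let slimP z : 0 < Im z -> wstieltjes n z @[n --> \oo] --> slim z.
Proof. exact: is_cvg_wstieltjes. Qed.

Let slim_Im z : 0 < Im z -> Im (wstieltjes n z) @[n --> \oo] --> Im (slim z).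
Proof. by move=> zp; have /cvg_complexP[] := slimP zp. Qed.

Lemma schwarz_pick_limit : schwarz_pick slim.
Proof.
move=> z w zp wp.
have h1 : normc (wstieltjes n z - wstieltjes n w) @[n --> \oo] -->
    normc (slim z - slim w).
  by apply: cvg_normc; apply: cvg_complexB; exact: slimP.
have h2 : normc (z - w) * (Im (wstieltjes n z) / Im z + Im (wstieltjes n w) / Im w)
    @[n --> \oo] --> normc (z - w) * (Im (slim z) / Im z + Im (slim w) / Im w).
  by apply: cvgMr; apply: cvgD; apply: cvgMl; exact: slim_Im.
rewrite -(cvg_lim _ h1)// -(cvg_lim _ h2)//; apply: ler_lim.
- by apply/cvg_ex; eexists; exact: h1.
- by apply/cvg_ex; eexists; exact: h2.
- by apply: nearW => n; exact: schwarz_pick_wstieltjes.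
Qed.

(** Strict positivity needs a lower bound uniform in [n]: either [k], or the contribution of one
    point of positive weight, which monotonicity of the sums preserves. *)
Lemma Im_limit_gt0 z : 0 < Im z ->
  (exists n v, [/\ v \in s n & 0 < q v]) \/ 0 < k -> 0 < Im (slim z).
Proof.
move=> zp pos.
have [e e0 [n0 en]] : exists2 e, 0 < e & exists n0, forall n, (n0 <= n)%N ->
    e <= Im (wstieltjes n z).
  case: pos => [[n0 [v0 [vs qv]]]|k0]; last first.
    exists k => //; exists 0%N => n _; rewrite Im_wstieltjes lerDr.
    by rewrite mulr_ge0 ?(ltW zp) ?wsum_ge0// => v; exact: sqker_ge0.
  exists (Im z * (q v0 * sqker z v0)).
    by rewrite mulr_gt0// mulr_gt0// sqker_gt0.
  exists n0 => n n0n; rewrite Im_wstieltjes.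
  apply: (@le_trans _ _ (Im z * wsum (sqker z) n)); last by rewrite lerDl.
  rewrite (ler_wpM2l (ltW zp))//.
  apply: (@le_trans _ _ (wsum (sqker z) n0)); last first.
    by apply: s_mono => // v; exact: sqker_ge0.
  rewrite /wsum (big_rem v0)//= lerDl sumr_ge0// => v _.
  by rewrite mulr_ge0// sqker_ge0.
apply: lt_le_trans e0 _; rewrite -(cvg_lim _ (slim_Im zp))//.
apply: limr_ge; first by apply/cvg_ex; eexists; exact: slim_Im.
by exists n0 => //.
Qed.

Lemma derivable_limit z : 0 < Im z ->
  derivable (fun w => if 0 < Im w then slim w else 0) z 1.
Proof.
move=> zp; pose L n := \sum_(v <- s n) (q v)%:C * (v%:C - z) ^- 2.
have [B hB] := wsum_sqker_bounded zp.
have LP : cvgn L.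
  apply: (@is_cvg_complex_wsum _ (sqker z) 1 B) => //.
  - by move=> v; rewrite mul1r Normc.normcV expr2 Normc.normcM -expr2.
  - by move=> v; exact: sqker_ge0.
(* On the disc of radius [Im z / 2] one has [Im w > Im z / 2], so the factor [1 / Im w] of the
   remainder is at most [2 / Im z]. *)
apply: (@derivable_quadratic _ _ _ (limn L)
  ((Im (slim z) / Im z) * (2 / Im z)) (Im z / 2)); first by rewrite divr_gt0.
move=> w wz.
have wp : Im z / 2 < Im w.
  have := le_lt_trans (Im_le_normc _) wz; rewrite Im_addc Im_oppc ltr_norml => /andP[+ _].
  lra.
have wp0 : 0 < Im w by apply: lt_trans wp; rewrite divr_gt0.
rewrite zp wp0.
have h1 : normc (wstieltjes n w - wstieltjes n z - (w - z) * L n)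
    @[n --> \oo] --> normc (slim w - slim z - (w - z) * limn L).
  apply: cvg_normc; apply: cvg_complexB.
    by apply: cvg_complexB; exact: slimP.
  by apply: cvg_complexM; [exact: cvg_cst|exact: LP].
have h2 : (Im (wstieltjes n z) / Im z) / Im w * normc (w - z) ^+ 2
    @[n --> \oo] --> (Im (slim z) / Im z) / Im w * normc (w - z) ^+ 2.
  by do 3 apply: cvgMl; exact: slim_Im.
have : normc (slim w - slim z - (w - z) * limn L) <=
    (Im (slim z) / Im z) / Im w * normc (w - z) ^+ 2.
  rewrite -(cvg_lim _ h1)// -(cvg_lim _ h2)//; apply: ler_lim.
  - by apply/cvg_ex; eexists; exact: h1.
  - by apply/cvg_ex; eexists; exact: h2.
  - by apply: nearW => n; exact: wstieltjes_taylor.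
move=> /le_trans; apply; rewrite ler_wpM2r ?sqr_ge0//.
rewrite ler_wpM2l//; last first.
  by rewrite -[leRHS]invf_div lef_pV2 ?posrE ?divr_gt0// ltW.
rewrite (divr_ge0 _ (ltW zp))//.
rewrite -(cvg_lim _ (slim_Im zp))//; apply: limr_ge.
  by apply/cvg_ex; eexists; exact: slim_Im.
apply: nearW => n; rewrite Im_wstieltjes addr_ge0// mulr_ge0 ?(ltW zp)//.
by rewrite wsum_ge0// => v; exact: sqker_ge0.
Qed.

Lemma herglotz_pick_limit :
  (exists n v, [/\ v \in s n & 0 < q v]) \/ 0 < k ->
  exists h : herglotz_pick R,
    (forall z, 0 < Im z -> wstieltjes n z @[n --> \oo] --> h z) /\ schwarz_pick h.
Proof.
move=> pos; pose f w := if 0 < Im w then slim w else 0.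
have f1 z : 0 < Im z -> 0 < Im (f z).
  by move=> zp; rewrite /f zp; exact: Im_limit_gt0.
have f2 z : Im z <= 0 -> f z = 0 by move=> zn; rewrite /f ltNge zn.
exists (HerglotzPick derivable_limit f1 f2); split => /=.
  by move=> z zp; rewrite zp; exact: slimP.
by move=> z w zp wp; rewrite zp wp; exact: schwarz_pick_limit.
Qed.

End weighted_sums.

Lemma eq_bigl_seq (V : nmodType) (I : eqType) (s : seq I) (P Q : pred I) (f : I -> V) :
  {in s, P =1 Q} -> \sum_(i <- s | P i) f i = \sum_(i <- s | Q i) f i.
Proof.
move=> PQ; rewrite big_seq_cond [RHS]big_seq_cond; apply: eq_bigl => i.
by case: (boolP (i \in s)) => //= /PQ.
Qed.

(** * Configurations as finite lists of points *)

Section points.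
Variable R : realType.
Implicit Types (c : configuration R) (r v W : R) (B : set R).

Lemma configuration_finite c r : finite_set [set v | `|v| <= r /\ (0 < c v)%N].
Proof. by case: c. Qed.

(* A point [v] occurs [c v] times. *)
Definition points c r : seq R :=
  flatten [seq nseq (c v) v | v <- finmap.enum_fset (fset_set [set v | `|v| <= r /\ (0 < c v)%N])].

Lemma mem_points c r v : (v \in points c r) = (`|v| <= r) && (0 < c v)%N.
Proof.
apply/flattenP/idP => [[_ /mapP[u + ->]]|/andP[vr cv]].
  rewrite in_fset_set; last exact: configuration_finite.
  by rewrite inE => -[ur cu]; rewrite mem_nseq => /andP[_ /eqP ->]; rewrite ur.
exists (nseq (c v) v); last by rewrite mem_nseq cv eqxx.
apply/mapP; exists v => //; rewrite in_fset_set; last exact: configuration_finite.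
by rewrite inE.
Qed.

Lemma fsbig_points (V : nmodType) c r B (f : R -> V) :
  (forall v, B v -> `|v| <= r) ->
  \sum_(v \in B) f v *+ c v = \sum_(v <- points c r | v \in B) f v.
Proof.
move=> Br; pose A := [set v | `|v| <= r /\ (0 < c v)%N].
have finA : finite_set A := configuration_finite c r.
rewrite /points big_flatten big_map /=.
have -> : \sum_(v <- finmap.enum_fset (fset_set A)) \sum_(u <- nseq (c v) v | u \in B) f u =
    \sum_(v <- finmap.enum_fset (fset_set A) | v \in B) f v *+ c v.
  rewrite [RHS]big_mkcond; apply: eq_bigr => v _; rewrite big_nseq_cond.
  by case: ifP => _//; elim: (c v) => [|n IH]; rewrite ?mulr0n// mulrS -IH.
rewrite fsbig_mkcond (@fsbigE _ _ _ _ _ (finmap.enum_fset (fset_set A)))//; last first.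
  move=> v _; rewrite in_fset_set// notin_setE /patch => nAv.
  case: ifP => // /set_mem Bv; have [cv|cv] := posnP (c v); first by rewrite cv mulr0n.
  by case: nAv; split => //; exact: Br.
rewrite [RHS]big_mkcond [LHS]big_mkcond; apply: eq_bigr => v _.
by rewrite in_setT /patch.
Qed.

(** The lists for two radii are not compared with each other: both sums equal the same finitely
    supported sum over [R]. This is how windows of different radii are brought to a common list. *)
Lemma big_points (V : nmodType) c r r' (P : pred R) (f : R -> V) :
  r <= r' ->
  \sum_(v <- points c r | P v) f v = \sum_(v <- points c r' | (`|v| <= r) && P v) f v.
Proof.
move=> rr'; pose B := [set v | `|v| <= r /\ P v].
have h r1 : r <= r1 -> \sum_(v \in B) f v *+ c v =
    \sum_(v <- points c r1 | (`|v| <= r) && P v) f v.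
  move=> rr1; rewrite (@fsbig_points _ _ r1); last by move=> v [vr _]; exact: le_trans rr1.
  apply: eq_bigl => v; apply/idP/idP; first by rewrite inE => -[-> ->].
  by move=> /andP[h1 h2]; rewrite inE.
rewrite -(h r')// (h r)//; apply: eq_bigl_seq => v.
by rewrite mem_points => /andP[-> _].
Qed.

Lemma points_mono c (q g : R -> R) : (forall v, 0 <= q v) -> (forall v, 0 <= g v) ->
  {homo (fun n : nat => \sum_(v <- points c n%:R) q v * g v) : n m / (n <= m)%N >-> n <= m}.
Proof.
move=> q0 g0 n m nm; rewrite (@big_points _ _ n%:R m%:R) ?ler_nat//.
rewrite big_mkcond/= ler_sum// => v _; case: ifP => // _; exact: mulr_ge0.
Qed.

Lemma stieltjes_partial_sumE c (z : R[i]) n :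
  stieltjes_partial_sum c z n = \sum_(v <- points c n%:R) (v%:C - z)^-1.
Proof.
rewrite /stieltjes_partial_sum; under eq_fsbigr do rewrite mulr_natl.
rewrite (@fsbig_points _ _ n%:R)//; apply: (@eq_bigl_seq _ _ _ _ xpredT) => v.
by rewrite mem_points => /andP[vr _]; apply/idP; rewrite inE.
Qed.

Lemma tail_partial_sumE c W n :
  tail_partial_sum c W n = \sum_(v <- points c n%:R | W < `|v|) v^-1.
Proof.
rewrite /tail_partial_sum; under eq_fsbigr do rewrite mulr_natl.
rewrite (@fsbig_points _ _ n%:R); last by move=> v /= /andP[].
apply: eq_bigl_seq => v; rewrite mem_points => /andP[vn _].
by apply/idP/idP; rewrite inE /= vn andbT.
Qed.

Lemma count_pointsE c r B : (forall v, B v -> `|v| <= r) ->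
  (count_points B c)%:R = \sum_(v <- points c r | v \in B) (1 : R).
Proof.
move=> Br; have := @fsbig_points nat c r B (fun=> 1%N) Br.
have -> : \sum_(v \in B) 1%N *+ c v = count_points B c.
  rewrite /count_points; apply: eq_fsbigr => v _.
  by elim: (c v) => // n IH; rewrite mulrS IH.
by move=> ->; rewrite natr_sum.
Qed.

Lemma vague_evalE c r (f : test_function R) : (forall v, r < `|v| -> f v = 0) ->
  vague_eval c f = \sum_(v <- points c r) f v.
Proof.
move=> fr; under [LHS]eq_fsbigr do rewrite mulr_natl.
rewrite -(@fsbig_widen _ _ _ _ [set v | `|v| <= r])//; last first.
  by move=> v [_ /negP] /=; rewrite -ltNge => /fr ->; rewrite mul0rn.
rewrite (@fsbig_points _ _ r)//; apply: (@eq_bigl_seq _ _ _ _ xpredT) => v.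
by rewrite mem_points => /andP[vr _]; apply/idP; rewrite inE.
Qed.
End points.

(** * Pointwise topology of Herglotz-Pick functions *)

Section topologies.
Variable R : realType.
Implicit Types (h g : herglotz_pick R) (z w : R[i]).

Lemma continuous_vague_eval (f : test_function R) :
  continuous (fun c : configuration R => vague_eval c f).
Proof.
move=> c; have h : (@vague_eval R) @ c --> vague_eval c.
  exact: (@initial_continuous _ {ptws test_function R -> R} (@vague_eval R)).
have pc := @proj_continuous (test_function R) (fun=> R) f (vague_eval c).
exact: (cvg_comp (@vague_eval R) (@proj _ (fun=> R) f) h pc).
Qed.

(** The source of all vaguely continuous functionals below: the support of [f] lies in [[- r, r]],
    so [f] is a test function and the window of radius [r] loses nothing. *)
Lemma continuous_points_sum (r : R) (f : R -> R) :
  continuous f -> (forall v, r <= `|v| -> f v = 0) ->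
  continuous (fun c : configuration R => \sum_(v <- points c r) f v).
Proof.
move=> fc fr.
have cf : compact (closure [set x | f x != 0]).
  apply: (@subclosed_compact _ _ `[- r, r]%classic); first exact: closed_closure.
    exact: segment_compact.
  rewrite [X in _ `<=` X](_ : _ = closure `[- r, r]%classic); last first.
    by apply/closure_id; exact: interval_closed.
  apply: closure_subset => v /= /eqP fv; rewrite in_itv /= -ler_norml.
  by rewrite leNgt; apply/negP => /ltW /fr.
have -> : (fun c : configuration R => \sum_(v <- points c r) f v) =
    (fun c => vague_eval c (TestFunction fc cf)).
  by apply/funext => c; rewrite (@vague_evalE _ c r)// => v /ltW /fr.
exact: continuous_vague_eval.
Qed.

Lemma continuous_herglotz_at z : continuous (fun h : herglotz_pick R => h z).
Proof.
move=> h; have hc : (@herglotz_eval R) @ h --> herglotz_eval h.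
  exact: (@initial_continuous _ {ptws R[i] -> R[i]} (@herglotz_eval R)).
have pc := @proj_continuous R[i] (fun=> R[i]) z (herglotz_eval h).
exact: (cvg_comp (@herglotz_eval R) (@proj _ (fun=> R[i]) z) hc pc).
Qed.

Lemma herglotz_eq0 h z : Im z <= 0 -> h z = 0.
Proof. by case: h => f ? ? /= /[apply]. Qed.

Lemma herglotz_Im_gt0 h z : 0 < Im z -> 0 < Im (h z).
Proof. by case: h => f ? /= + ? => /[apply]. Qed.

Lemma herglotz_ext h g : (forall z, 0 < Im z -> h z = g z) -> h = g.
Proof.
move=> hg; have : herglotz_fun h = herglotz_fun g.
  apply/funext => z; have [z0|z0] := ltP 0 (Im z); first exact: hg.
  by rewrite !herglotz_eq0.
case: h {hg} => h h1 h2 h3; case: g => g g1 g2 g3 /= hg; subst g.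
by congr HerglotzPick; exact: Prop_irrelevance.
Qed.

Lemma cvg_herglotz (F : set_system (herglotz_pick R)) (FF : Filter F) h :
  (forall z, 0 < Im z -> (fun g : herglotz_pick R => g z) @ F --> h z) -> F --> h.
Proof.
move=> Fh A /= [_ [[B Bop <-] Bh] BA].
have Fe : {ptws, (@herglotz_eval R) @ F --> herglotz_eval h}.
  apply/cvg_sup => z A' /= [_ [[C Cop <-] Ch] CA]; apply: filterS CA _.
  have Fz : (fun g : herglotz_pick R => g z) @ F --> h z; last first.
    by apply: Fz; rewrite nbhsE; exists C.
  have [z0|z0] := ltP 0 (Im z); first exact: Fh.
  rewrite [X in X @ F --> _](_ : _ = cst (h z)); first exact: cvg_cst.
  by apply/funext => g /=; rewrite /herglotz_eval !herglotz_eq0.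
have : nbhs (herglotz_eval h : {ptws R[i] -> R[i]}) B by rewrite nbhsE; exists B.
move=> /Fe h1; apply: (@filterS _ F FF _ _ _ h1) => g Bg; exact: BA.
Qed.

Lemma continuous_herglotz (T : topologicalType) (f : T -> herglotz_pick R) :
  (forall z, 0 < Im z -> continuous (fun t => f t z)) -> continuous f.
Proof. by move=> fz t; apply: cvg_herglotz => z z0; exact: fz. Qed.

(* The value ['i] is a dummy, for the codes of no point of the upper half plane. *)
Definition rational_point (j : nat) : R[i] :=
  if unpickle j is Some (a, b) then
    if 0 < b :> rat then ratr a +i* ratr b else 'i
  else 'i.

Lemma rational_point_gt0 j : 0 < Im (rational_point j).
Proof.
rewrite /rational_point; case: unpickle => [[a b]|] /=; last exact: ltr01.
by case: ifP => [|_] /=; [rewrite ltr0q|exact: ltr01].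
Qed.

Lemma rational_point_dense z (e : R) : 0 < Im z -> 0 < e ->
  exists j, normc (z - rational_point j) < e.
Proof.
move=> z0 e0; have e2 : 0 < e / 2 by rewrite divr_gt0.
have [a /itvP ha] : exists a : rat, ratr a \in `]Re z, (Re z + e / 2)[.
  by apply: rat_in_itvoo; rewrite ltrDl.
have [b /itvP hb] : exists b : rat, ratr b \in `]Im z, (Im z + e / 2)[.
  by apply: rat_in_itvoo; rewrite ltrDl.
exists (pickle (a, b)); rewrite /rational_point pickleK.
have b0 : 0 < b by rewrite -(@ltr0q R); apply: lt_trans z0 _; rewrite hb.
rewrite b0; apply: le_lt_trans (normc_le_ReIm _) _.
rewrite Re_addc Im_addc Re_oppc Im_oppc /= [e]splitr; apply: ltrD.
  by rewrite distrC ger0_norm ?subr_ge0 ?ha// ltrBlDl ha.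
by rewrite distrC ger0_norm ?subr_ge0 ?hb// ltrBlDl hb.
Qed.

(** Write [D], [a], [b] for the distance of the values and their imaginary parts, and
    [rho = |z - w| / Im z <= 1 / 4]. As [Im w >= Im z / 2], Schwarz-Pick gives [D <= rho (a + 2 b)].
    Inserting [b <= a + D] or [a <= b + D] and absorbing [D] yields the constants
    [3 / (1 - 2 rho) <= 6] and [3 / (1 - rho) <= 4]. *)
Lemma schwarz_pick_osc h z w : schwarz_pick h -> 0 < Im z ->
  normc (z - w) <= Im z / 4 ->
  normc (h z - h w) <= 6 * (normc (z - w) / Im z) * Im (h z) /\
  normc (h z - h w) <= 4 * (normc (z - w) / Im z) * Im (h w).
Proof.
move=> hsp z0 zw.
have w0 : Im z / 2 <= Im w.
  have := le_trans (Im_le_normc _) zw; rewrite Im_addc Im_oppc ler_norml => /andP[_].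
  lra.
have wp : 0 < Im w by apply: lt_le_trans w0; rewrite divr_gt0.
set D := normc (h z - h w); set rho := normc (z - w) / Im z.
have D0 : 0 <= D by exact: normc_ge0.
have rho0 : 0 <= rho by rewrite divr_ge0 ?normc_ge0 1?ltW.
have rho4 : rho <= 1 / 4 by rewrite /rho ler_pdivrMr//; lra.
have a0 := herglotz_Im_gt0 h z0; have b0 := herglotz_Im_gt0 h wp.
have Dab : D <= rho * (Im (h z) + 2 * Im (h w)).
  apply: le_trans (hsp _ _ z0 wp) _; rewrite /rho -mulrA ler_wpM2l ?normc_ge0//.
  have -> : (Im z)^-1 * (Im (h z) + 2 * Im (h w)) =
      Im (h z) / Im z + Im (h w) * (2 / Im z) by ring.
  rewrite lerD2l ler_wpM2l ?(ltW b0)// -[leRHS]invf_div lef_pV2 ?posrE//.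
  by rewrite divr_gt0.
have := le_trans (Im_le_normc _) (lexx D); rewrite Im_addc Im_oppc ler_norml => /andP[h1 h2].
move: (Im (h z)) (Im (h w)) a0 b0 Dab h1 h2 => a b a0 b0 Dab h1 h2.
have rD : rho * D <= D / 4 by rewrite mulrC; nra.
split.
  have : rho * b <= rho * (a + D) by rewrite ler_wpM2l//; lra.
  nra.
have : rho * a <= rho * (b + D) by rewrite ler_wpM2l//; lra.
nra.
Qed.
End topologies.

(** * Lower approximation of a bounded continuous functional by Lipschitz ones *)

Section lipschitz_approximation.
Variable R : realType.
Implicit Types (h g : herglotz_pick R) (z w : R[i]) (k : nat).

Definition rational_close k h g := forall j, (j < k)%N ->
  normc (h (rational_point R j) - g (rational_point R j)) < k.+1%:R^-1.

Lemma rational_close_mono k l h g : (k <= l)%N ->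
  rational_close l h g -> rational_close k h g.
Proof.
move=> kl hg j jk; apply: lt_le_trans (hg j (leq_trans jk kl)) _.
by rewrite lef_pV2 ?posrE// ler_nat.
Qed.

(** Take a rational point [w] near [z]. By [schwarz_pick_osc] both [h] and [g] vary little between
    [z] and [w]; the bound for [g] involves [Im (g w)], which closeness at [w] controls by [h]. So
    closeness spreads from [w] to [z], uniformly in [g]. *)
Lemma schwarz_pick_nbhs h (U : set (herglotz_pick R)) : schwarz_pick h ->
  nbhs h U -> exists k, forall g : herglotz_pick R, schwarz_pick g -> rational_close k h g -> U g.
Proof.
move=> hsp hU.
pose F := filter_from [set: nat] (fun k => [set g : herglotz_pick R | schwarz_pick g /\ rational_close k h g]).
have FF : Filter F.
  apply: filter_from_filter; first by exists 0%N.
  move=> i j _ _; exists (maxn i j) => // g [gsp hg]; split; split => //.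
    by apply: rational_close_mono hg; exact: leq_maxl.
  by apply: rational_close_mono hg; exact: leq_maxr.
suff /(_ _ hU)[k _ kU] : F --> h by exists k => g gsp hg; exact: kU.
apply: cvg_herglotz => z z0; apply/cvgrPdist_lt => _ /gt0_complex[e e0 ->].
have A0 := herglotz_Im_gt0 h z0; set A := Im (h z) in A0.
(* With [rho = |z - w| / Im z], the oscillations cost [6 rho A] for [h] and [4 rho Im (g w)] for
   [g], where [Im (g w) <= 3 A + 1]: in all [rho (18 A + 4)], which this radius makes less than
   [e / 2]. *)
pose r := Num.min (Im z / 4) (e * Im z / (2 * (18 * A + 4))).
have r0 : 0 < r.
  rewrite lt_min divr_gt0// divr_gt0 ?mulr_gt0// addr_gt0// mulr_gt0//.
have [j zj] := rational_point_dense z0 r0; set w := rational_point R j in zj.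
have [rz re] : normc (z - w) <= Im z / 4 /\
    normc (z - w) < e * Im z / (2 * (18 * A + 4)).
  by move: zj; rewrite lt_min => /andP[/ltW].
have [k [jk k1 ke]] : exists k, [/\ (j < k)%N, k.+1%:R^-1 <= 1 :> R & k.+1%:R^-1 < e / 2].
  have [m me] : exists m : nat, (2 / e) < m%:R.
    exists (Num.truncn (2 / e)).+1; exact: truncnS_gt.
  exists (maxn j.+1 m); split; first exact: leq_maxl.
    by rewrite invf_le1// ler1n.
  rewrite -[ltRHS]invf_div ltf_pV2 ?posrE ?divr_gt0//.
  apply: lt_le_trans me _; rewrite ler_nat; exact/leqW/leq_maxr.
exists k => // g [gsp /(_ j jk)]; rewrite -/w /= => hgw.
rewrite normr_normc ltcR.
have [h1 _] := schwarz_pick_osc hsp z0 rz.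
have [_ h2] := schwarz_pick_osc gsp z0 rz.
move: h1 h2; rewrite -/A; set rho := normc (z - w) / Im z => h1 h2.
have rho0 : 0 <= rho by rewrite divr_ge0 ?normc_ge0 ?(ltW z0).
have rho4 : rho <= 1 / 4 by rewrite /rho ler_pdivrMr//; lra.
have rhoe : rho * (18 * A + 4) < e / 2.
  rewrite /rho mulrAC ltr_pdivrMr// -ltr_pdivlMr ?addr_gt0 ?mulr_gt0//.
  apply: lt_le_trans re _; rewrite le_eqVlt; apply/orP; left; apply/eqP.
  by rewrite invfM; ring.
move: (k.+1%:R^-1 : R) k1 ke hgw => t k1 ke hgw.
have hb : Im (g w) <= 3 * A + 1.
  have := le_trans (Im_le_normc _) h1; rewrite Im_addc Im_oppc ler_norml => /andP[h3 _].
  have := le_lt_trans (Im_le_normc _) hgw; rewrite Im_addc Im_oppc ltr_norml => /andP[h4 _].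
  have : rho * A <= 1 / 4 * A by rewrite ler_wpM2r ?(ltW A0).
  move: h3 h4; rewrite -/A; clearbody rho A; lra.
have -> : h z - g z = (h z - h w) + (h w - g w) - (g z - g w) by ring.
apply: le_lt_trans (normcD _ _) _; rewrite normcN.
have h5 := normcD (h z - h w) (h w - g w).
have h6 : rho * Im (g w) <= rho * (3 * A + 1) by rewrite ler_wpM2l.
clearbody rho A; lra.
Qed.

Definition rational_dist k h g : R :=
  \sum_(j < k) normc (h (rational_point R j) - g (rational_point R j)).

Lemma rational_dist_triangle k h1 h2 h3 :
  rational_dist k h1 h3 <= rational_dist k h1 h2 + rational_dist k h2 h3.
Proof.
rewrite /rational_dist -big_split; apply: ler_sum => j _ /=.
by apply: le_trans (normcD _ _); rewrite addrA subrK.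
Qed.

Lemma rational_dist_sym k h1 h2 : rational_dist k h1 h2 = rational_dist k h2 h1.
Proof. by apply: eq_bigr => j _; rewrite normcB. Qed.

Lemma rational_dist_ge0 k h1 h2 : 0 <= rational_dist k h1 h2.
Proof. by apply: sumr_ge0 => j _; exact: normc_ge0. Qed.

Variables (F : herglotz_pick R -> R) (K : R).
Hypothesis F_cont : continuous F.
Hypothesis F_bound : forall h, `|F h| <= K.

Let cost k h g := F g + Num.min (2 * K) (k%:R * rational_dist k h g).

Let costs k h := [set cost k h g | g in [set g : herglotz_pick R | schwarz_pick g]].

(* An infimal convolution: it only depends on the values at finitely many
   points, converges to [F] on the functions satisfying [schwarz_pick], and the
   truncation of the distance at [2 * K] keeps it bounded elsewhere. *)
Definition lipschitz_approx k h : R := inf (costs k h).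

Lemma schwarz_pick_i : schwarz_pick (herglotz_i R).
Proof.
move=> z w z0 w0 /=; rewrite z0 w0 subrr Normc.normc0 /=.
by rewrite mulr_ge0 ?normc_ge0// addr_ge0// divr_ge0// ltW.
Qed.

Let K_ge0 : 0 <= K.
Proof. exact: le_trans (normr_ge0 _) (F_bound (herglotz_i R)). Qed.

Let min_ge0 k h g : 0 <= Num.min (2 * K) (k%:R * rational_dist k h g).
Proof. by rewrite le_min !mulr_ge0 ?rational_dist_ge0. Qed.

Let cost_ge k h g : - K <= cost k h g.
Proof.
have := F_bound g; rewrite ler_norml => /andP[h1 _].
by have := min_ge0 k h g; rewrite /cost; lra.
Qed.

Let costs_lbound k h : has_lbound (costs k h).
Proof. by exists (- K) => _ [g _ <-]. Qed.

Let costs_neq0 k h : costs k h !=set0.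
Proof. by exists (cost k h (herglotz_i R)), (herglotz_i R) => //; exact: schwarz_pick_i. Qed.

Lemma lipschitz_approx_bounded k h : `|lipschitz_approx k h| <= 3 * K.
Proof.
rewrite ler_norml; apply/andP; split.
  apply: (@le_trans _ _ (- K)); first by have := K_ge0; lra.
  by apply: lb_le_inf => // _ [g _ <-].
apply: (@le_trans _ _ (cost k h (herglotz_i R))).
  by apply: ge_inf => //; exists (herglotz_i R) => //; exact: schwarz_pick_i.
have := F_bound (herglotz_i R); rewrite ler_norml => /andP[_ h1].
rewrite /cost; have : Num.min (2 * K) (k%:R * rational_dist k h (herglotz_i R)) <= 2 * K.
  by rewrite ge_min lexx.
lra.
Qed.

Lemma lipschitz_approx_le k h : schwarz_pick h -> lipschitz_approx k h <= F h.
Proof.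
move=> hsp; apply: (@le_trans _ _ (cost k h h)); first by apply: ge_inf => //; exists h.
rewrite /cost /rational_dist big1 ?mulr0; last by move=> j _; rewrite subrr Normc.normc0.
by rewrite min_r ?addr0// mulr_ge0.
Qed.

Lemma lipschitz_approx_lip k h g :
  `|lipschitz_approx k h - lipschitz_approx k g| <= k%:R * rational_dist k h g.
Proof.
have half h1 h2 : lipschitz_approx k h1 <= lipschitz_approx k h2 + k%:R * rational_dist k h1 h2.
  rewrite -lerBlDr; apply: lb_le_inf => // _ [u usp <-]; rewrite lerBlDr.
  apply: (@le_trans _ _ (cost k h1 u)); first by apply: ge_inf => //; exists u.
  rewrite /cost -addrA lerD2l.
  have := ler_wpM2l (ler0n R k) (rational_dist_triangle k h1 h2 u).
  rewrite mulrDr => tri.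
  have d0 : 0 <= k%:R * rational_dist k h1 h2 by rewrite mulr_ge0 ?rational_dist_ge0.
  (* Truncation at [2 * K] is nondecreasing and 1-Lipschitz, so it respects the triangle
     inequality. *)
  rewrite ge_min; case: (leP (2 * K) (k%:R * rational_dist k h2 u)) => h3.
    by rewrite lerDl d0.
  by apply/orP; right; lra.
have := half h g; have := half g h; rewrite (rational_dist_sym k g h) ler_norml.
by move=> h1 h2; apply/andP; split; lra.
Qed.

Lemma continuous_lipschitz_approx k : continuous (lipschitz_approx k).
Proof.
move=> h; have FF : Filter (nbhs h) := nbhs_filter h.
apply/cvgrPdist_lt => e e0.
have : rational_dist k h g @[g --> h] --> (0 : R).
  rewrite [X in _ --> X](_ : _ = \sum_(j < k) (0 : R)); last by rewrite big1.
  apply: cvg_big; first exact: add_continuous.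
  move=> j _.
  rewrite -[X in _ --> X](@Normc.normc0 R).
  rewrite -(subrr (h (rational_point R j))); apply: (@cvg_normc _ _ _ (nbhs_filter h)).
  apply: (@cvg_complexB _ _ _ (nbhs_filter h)); first exact: cvg_cst.
  exact: continuous_herglotz_at.
have e1 : 0 < e / (k%:R + 1) by rewrite divr_gt0// ltr_wpDl.
move=> /cvgrPdist_lt /(_ _ e1); apply: filterS => g; rewrite sub0r normrN => hg.
apply: le_lt_trans (lipschitz_approx_lip _ _ _) _.
move: hg; rewrite ger0_norm ?rational_dist_ge0// ltr_pdivlMr ?ltr_wpDl//.
have := rational_dist_ge0 k h g; lra.
Qed.

(** A competitor [g] close to [h] at the rational points has [F g >= F h - e] by continuity. Any
    other is at distance at least [1 / (k0 + 1)], so for large [k] its penalty is the full [2 K],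
    and its cost is at least [- K + 2 K >= F h]. *)
Lemma cvg_lipschitz_approx h : schwarz_pick h ->
  lipschitz_approx k h @[k --> \oo] --> F h.
Proof.
move=> hsp; apply/cvgrPdist_le => e e0.
have [k0 hk0] : exists k0, forall g : herglotz_pick R, schwarz_pick g -> rational_close k0 h g ->
    F h - e <= F g.
  apply: (@schwarz_pick_nbhs h [set g | F h - e <= F g]) => //.
  have FF : Filter (nbhs h) := nbhs_filter h.
  have Fh : F g @[g --> h] --> F h by exact: F_cont.
  move: Fh => /cvgrPdist_le /(_ e e0); apply: filterS => g.
  by rewrite ler_norml => /andP[_]; rewrite /=; lra.
have [m mK] : exists m : nat, 2 * K * k0.+1%:R < m%:R.
  by exists (Num.truncn (2 * K * k0.+1%:R)).+1; exact: truncnS_gt.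
exists (maxn k0 m) => // k /=; rewrite geq_max => /andP[k0k mk].
have ub := lipschitz_approx_le k hsp.
rewrite ger0_norm ?subr_ge0// lerBlDr -lerBlDl.
apply: lb_le_inf => // _ [g gsp <-]; rewrite /cost.
have [close|/existsNP[j /not_implyP[jk /negP]]] := pselect (rational_close k0 h g).
  have := hk0 g gsp close; have := min_ge0 k h g; lra.
rewrite -leNgt => far.
have : 2 * K <= k%:R * rational_dist k h g.
  apply: (@le_trans _ _ (m%:R * k0.+1%:R^-1)).
    by rewrite ler_pdivlMr// ltW.
  apply: ler_pM => //; first by rewrite ler_nat.
  apply: le_trans far _; rewrite /rational_dist.
  rewrite (bigD1 (Ordinal (leq_trans jk k0k)))//= lerDl.
  by apply: sumr_ge0 => i _; exact: normc_ge0.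
move=> /min_idPl ->.
have := F_bound g; have := F_bound h; rewrite !ler_norml => /andP[_ h1] /andP[h2 _].
lra.
Qed.
End lipschitz_approximation.

(** * Measurability *)

Section min_max.
Context (R : realType) (T : Type) (F : set_system T) {FF : Filter F}.
Variables (f g : T -> R) (a b : R).
Hypotheses (fa : f @ F --> a) (gb : g @ F --> b).

Lemma cvg_maxr : Num.max (f t) (g t) @[t --> F] --> Num.max a b.
Proof.
rewrite maxr_absE; under eq_fun do rewrite maxr_absE.
by apply: cvgMl; apply: cvgD; [exact: cvgD|apply: cvg_norm; exact: cvgB].
Qed.

Lemma cvg_minr : Num.min (f t) (g t) @[t --> F] --> Num.min a b.
Proof.
rewrite minr_absE; under eq_fun do rewrite minr_absE.
by apply: cvgMl; apply: cvgB; [exact: cvgD|apply: cvg_norm; exact: cvgB].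
Qed.
End min_max.

Section trapezoid.
Variable R : realType.
Implicit Types (a e v : R).

Definition trapezoid a e v : R := Num.max 0 (Num.min 1 ((a + e - `|v|) / e)).

Lemma trapezoid_ge0 a e v : 0 <= trapezoid a e v.
Proof. by rewrite le_max lexx. Qed.

Lemma trapezoid_le1 a e v : trapezoid a e v <= 1.
Proof. by rewrite ge_max ler01 ge_min lexx. Qed.

Lemma trapezoid_in a e v : 0 < e -> `|v| <= a -> trapezoid a e v = 1.
Proof.
move=> e0 va; rewrite /trapezoid min_l; first by rewrite max_r.
by rewrite ler_pdivlMr// mul1r; lra.
Qed.

Lemma trapezoid_out a e v : 0 < e -> a + e <= `|v| -> trapezoid a e v = 0.
Proof.
move=> e0 va; rewrite /trapezoid max_l// ge_min; apply/orP; right.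
by rewrite ler_pdivrMr// mul0r subr_le0.
Qed.

Lemma continuous_trapezoid a e : continuous (trapezoid a e).
Proof.
move=> v; apply: cvg_maxr; first exact: cvg_cst.
apply: cvg_minr; first exact: cvg_cst.
apply: cvgMl; apply: cvgB; first exact: cvg_cst.
exact: cvg_norm.
Qed.

Lemma cvg_trapezoid a v :
  trapezoid a n.+1%:R^-1 v @[n --> \oo] --> ((`|v| <= a)%R%:R : R).
Proof.
have [va|va] := leP `|v| a; apply: cvg_near_cst.
  by apply: nearW => n; rewrite trapezoid_in.
have : n.+1%:R^-1 @[n --> \oo] --> (0 : R) by exact: cvg_harmonic.
move=> /cvgrPdist_lt /(_ (`|v| - a)); rewrite subr_gt0 => /(_ va).
apply: filterS => n; rewrite sub0r normrN ger0_norm// => nv.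
by rewrite trapezoid_out// -lerBrDl ltW.
Qed.
End trapezoid.

Section measurable_limits.
Context d (T : measurableType d) (R : realType).

(** By completeness, convergence is the Cauchy property, a countable combination of measurable
    events. *)
Lemma measurable_cvgn (u : nat -> T -> R) : (forall n, measurable_fun setT (u n)) ->
  measurable [set t | cvgn (u ^~ t)].
Proof.
move=> mu.
rewrite (_ : [set t | _] = \bigcap_(k in [set: nat]) \bigcup_(N in [set: nat])
    \bigcap_(n in [set: nat]) [set t | `|u (N + n)%N t - u N t| < k.+1%:R^-1]).
  apply: bigcapT_measurable => k; apply: bigcupT_measurable => N.
  apply: bigcapT_measurable => n.
  rewrite -[X in measurable X]setTI.
  rewrite (_ : [set t | _] = (fun t => `|u (N + n)%N t - u N t|) @^-1` `]-oo, k.+1%:R^-1[).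
    have : measurable_fun setT (fun t => `|u (N + n)%N t - u N t|).
      apply: measurableT_comp; first exact: normr_measurable.
      exact: measurable_funB.
    by apply.
  by apply/seteqP; split => t /=; rewrite in_itv.
apply/seteqP; split=> t /=.
  move=> /cvg_ex[l /cvgrPdist_lt ul] k _.
  have k2 : 0 < k.+1%:R^-1 / 2 :> R by rewrite divr_gt0.
  have [N _ uN] := ul _ k2; exists N => // n _ /=.
  have h1 := uN N (leqnn N); have h2 := uN (N + n)%N (leq_addr n N).
  have -> : u (N + n)%N t - u N t = (l - u N t) - (l - u (N + n)%N t) by ring.
  apply: le_lt_trans (ler_normB _ _) _; rewrite [ltRHS]splitr.
  by rewrite ltrD.
move=> h; apply/cauchy_cvgP; apply: cauchy_exP => _/posnumP[e].
have [k ke] : exists k : nat, k.+1%:R^-1 < e%:num.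
  have : n.+1%:R^-1 @[n --> \oo] --> (0 : R) by exact: cvg_harmonic.
  move=> /cvgrPdist_lt /(_ e%:num) /(_ _)[//|k _ /(_ k (leqnn k))].
  by rewrite sub0r normrN ger0_norm// => ?; exists k.
have [N _ hN] := h k I; exists (u N t).
exists N => // n /= Nn; rewrite /ball /= distrC.
by have := hN (n - N)%N I; rewrite /= subnKC// => /lt_trans; apply.
Qed.

Lemma measurable_if_lim (u : nat -> T -> R) (D : set T) (f : T -> R) (a : R) :
  (forall n, measurable_fun setT (u n)) -> measurable D ->
  (forall t, D t -> u n t @[n --> \oo] --> f t) -> (forall t, ~ D t -> f t = a) ->
  measurable_fun setT f.
Proof.
move=> mu mD uf fa.
have mD' : measurable_fun setT (fun t => t \in D).
  by apply: (measurable_fun_bool true); rewrite setTI (_ : _ @^-1` _ = D)//;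
    apply/seteqP; split=> t /=; [move/set_mem|move/mem_set].
apply: (@measurable_fun_cvg _ _ _ setT
  (fun n t => if t \in D then u n t else a)).
  move=> n; apply: measurable_fun_ifT => //.
move=> t _ /=; have [Dt|nDt] := pselect (D t); first by rewrite mem_set//; exact: uf.
by rewrite memNset// fa//; exact: cvg_cst.
Qed.
End measurable_limits.

Section measurable_functionals.
Context d (T : measurableType d) (R : realType).
Variable omega : T -> configuration R.
Hypothesis momega : random_element omega.

Lemma measurable_random_element (E : ptopologicalType) (X : T -> E) (F : E -> R) :
  random_element X -> continuous F -> measurable_fun setT (F \o X).
Proof.
move=> mX /continuousP Fc.
apply: (measurability _ (RGenOInfty.measurableE R)) => _ [_ [a ->] <-].
rewrite comp_preimage; apply: mX => //; apply: sub_sigma_algebra.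
by apply: Fc; exact: interval_open.
Qed.

Definition measurable_points (f : R -> R) := forall r,
  measurable_fun setT (fun t => \sum_(v <- points (omega t) r) f v).

Lemma measurable_points_lim (f_ : nat -> R -> R) (f : R -> R) :
  (forall n, measurable_points (f_ n)) ->
  (forall v, f_ n v @[n --> \oo] --> f v) -> measurable_points f.
Proof.
move=> mf ff r; apply: (@measurable_fun_cvg _ _ _ setT
  (fun n t => \sum_(v <- points (omega t) r) f_ n v)); first by move=> n; exact: mf.
move=> t _; apply: cvg_big; first exact: add_continuous.
by move=> v _; exact: ff.
Qed.

(** The sharp window is not vaguely continuous; trapezoids supported in the window of radius [r + 1]
    converge pointwise to its indicator, and for each configuration the sums involved are finite. *)
Lemma measurable_points_continuous (f : R -> R) : continuous f -> measurable_points f.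
Proof.
move=> fc r.
apply: (@measurable_fun_cvg _ _ _ setT
  (fun n t => \sum_(v <- points (omega t) (r + 1)) f v * trapezoid r n.+1%:R^-1 v)).
  move=> n; have := @continuous_points_sum R (r + 1)
    (fun v => f v * trapezoid r n.+1%:R^-1 v).
  move=> /(_ _ _)/(measurable_random_element momega); apply.
    by move=> v; apply: cvgM; [exact: fc|exact: continuous_trapezoid].
  move=> v rv; rewrite trapezoid_out ?mulr0//; apply: le_trans rv.
  by rewrite lerD2l invf_le1// ler1n.
move=> t _; rewrite (@big_points _ _ _ r (r + 1)) ?lerDl// big_mkcond /=.
apply: cvg_big; first exact: add_continuous.
move=> v _; rewrite andbT.
rewrite (_ : (if `|v| <= r then _ else _) = f v * (`|v| <= r)%R%:R); last first.
  by case: ifP; rewrite ?mulr1 ?mulr0.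
by apply: cvgMr; exact: cvg_trapezoid.
Qed.

Lemma measurable_points_tail (f : R -> R) (W : R) : continuous f ->
  measurable_points (fun v => f v * (W < `|v|)%R%:R).
Proof.
move=> fc; apply: (@measurable_points_lim
  (fun n v => f v * (1 - trapezoid W n.+1%:R^-1 v))).
  move=> n; apply: measurable_points_continuous => v; apply: cvgM; first exact: fc.
  by apply: cvgB; [exact: cvg_cst|exact: continuous_trapezoid].
move=> v; apply: cvgMr.
rewrite (_ : (W < `|v|)%R%:R = 1 - (`|v| <= W)%R%:R); last first.
  by rewrite ltNge; case: leP; rewrite ?subrr ?subr0.
by apply: cvgB; [exact: cvg_cst|exact: cvg_trapezoid].
Qed.

Lemma measurable_points_pos (g : R -> R) : continuous g ->
  measurable_points (fun v => (0 < g v)%R%:R).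
Proof.
move=> gc.
(* The indicator of [g > 0] is the limit of the continuous functions [min (1, n g)], cut at 0. *)
apply: (@measurable_points_lim (fun n v => Num.max 0 (Num.min 1 (n%:R * g v)))).
  move=> n; apply: measurable_points_continuous => v.
  apply: cvg_maxr; first exact: cvg_cst.
  apply: cvg_minr; first exact: cvg_cst.
  by apply: cvgMr; exact: gc.
move=> v; apply: cvg_near_cst; have [av|va] := ltP 0 (g v).
  exists (Num.truncn (g v)^-1).+1 => // n /= hn.
  rewrite min_l ?max_r// -ler_pdivrMr// div1r.
  by apply: ltW; apply: lt_le_trans (truncnS_gt _) _; rewrite ler_nat.
by apply: nearW => n; rewrite max_l// ge_min mulr_ge0_le0// orbT.
Qed.

End measurable_functionals.

Section herglotz_random_element.
Context d (T : measurableType d) (R : realType).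

Lemma rational_approx (x e : R) : 0 < e -> exists a : rat, `|x - ratr a| < e.
Proof.
move=> e0; have [a /itvP ha] : exists a : rat, ratr a \in `]x - e, x + e[.
  by apply: rat_in_itvoo; lra.
exists a; rewrite ltr_norml; apply/andP.
have h1 : x - e < ratr a by rewrite ha.
have h2 : ratr a < x + e by rewrite ha.
by split; lra.
Qed.

Lemma measurable_itv_preimage (f : T -> R) (x e : R) : measurable_fun setT f ->
  measurable [set t | `|f t - x| < e].
Proof.
move=> mf; rewrite -[X in measurable X]setTI.
rewrite (_ : [set t | _] = (fun t => `|f t - x|) @^-1` `]-oo, e[); last first.
  by apply/seteqP; split => t /=; rewrite in_itv.
have : measurable_fun setT (fun t => `|f t - x|).
  apply: measurableT_comp; first exact: normr_measurable.
  by apply: measurable_funB.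
by apply.
Qed.

(** An open set of an uncountable product need not be a countable union of cylinders. Along
    functions satisfying [schwarz_pick] it acts as one, by [schwarz_pick_nbhs]: cylinders over
    finitely many rational points, with rational centres, suffice. *)
Lemma herglotz_random_element (X : T -> herglotz_pick R) :
  (forall t, schwarz_pick (X t)) ->
  (forall z, 0 < Im z -> measurable_fun setT (fun t => Re (X t z)) /\
                         measurable_fun setT (fun t => Im (X t z))) ->
  random_element X.
Proof.
move=> Xsp mX; apply: (@measurability _ _ T (g_sigma_algebraType (@open (herglotz_pick R)))
  setT X (@open (herglotz_pick R))) => //.
move=> _ [U oU <-]; rewrite setTI.
(* The real and imaginary parts of two functions close to the same centre each differ by less than
   [2 e k], in all [4 e k = 1 / (k + 1)]. *)
pose e k : R := k.+1%:R^-1 / 4.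
pose close k (s : seq (rat * rat)) (h : herglotz_pick R) := forall j, (j < k)%N ->
  `|Re (h (rational_point R j)) - ratr (nth (0, 0) s j).1| < e k /\
  `|Im (h (rational_point R j)) - ratr (nth (0, 0) s j).2| < e k.
pose V (i : nat * seq (rat * rat)) :=
  [set t | (forall h : herglotz_pick R, schwarz_pick h -> close i.1 i.2 h -> U h) /\
           close i.1 i.2 (X t)].
rewrite (_ : X @^-1` U = \bigcup_i V i).
  apply: countable_bigcupT_measurable => // -[k s].
  (* The first condition in [V] does not involve [t]: either it fails and [V] is empty, or [V] is a
     finite intersection of events. *)
  have [all|nall] := pselect
      (forall h : herglotz_pick R, schwarz_pick h -> close k s h -> U h); last first.
    rewrite (_ : V _ = set0); first exact: measurable0.
    by apply/seteqP; split => t // [].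
  rewrite (_ : V _ = \bigcap_(j in [set j | (j < k)%N])
    ([set t | `|Re (X t (rational_point R j)) - ratr (nth (0, 0) s j).1| < e k] `&`
     [set t | `|Im (X t (rational_point R j)) - ratr (nth (0, 0) s j).2| < e k])).
    apply: bigcap_measurableType => j _.
    have [mR mI] := mX _ (rational_point_gt0 R j).
    by apply: measurableI; exact: measurable_itv_preimage.
  apply/seteqP; split => t /=; first by move=> [_ c] j /= /c [].
  by move=> c; split => // j jk; have [] := c j jk.
apply/seteqP; split => t /=; last by move=> [[k s] _ [all c]]; exact: all.
move=> Ut; have [|k hk] := @schwarz_pick_nbhs R (X t) U (Xsp t).
  by apply: open_nbhs_nbhs; split.
have e0 : 0 < e k by rewrite divr_gt0.
pose a j := xget 0 [set a : rat | `|Re (X t (rational_point R j)) - ratr a| < e k].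
pose b j := xget 0 [set b : rat | `|Im (X t (rational_point R j)) - ratr b| < e k].
have aP j : `|Re (X t (rational_point R j)) - ratr (a j)| < e k.
  have [q hq] := rational_approx (Re (X t (rational_point R j))) e0.
  exact: (@xgetPex _ 0 [set a : rat | _ < e k] (ex_intro _ q hq)).
have bP j : `|Im (X t (rational_point R j)) - ratr (b j)| < e k.
  have [q hq] := rational_approx (Im (X t (rational_point R j))) e0.
  exact: (@xgetPex _ 0 [set b : rat | _ < e k] (ex_intro _ q hq)).
exists (k, mkseq (fun j => (a j, b j)) k) => //; split => /=; last first.
  by move=> j jk; rewrite nth_mkseq.
move=> h hsp hc; apply: hk => // j jk.
have := hc j jk; rewrite nth_mkseq//= => -[h1 h2].
apply: le_lt_trans (normc_le_ReIm _) _; rewrite Re_addc Im_addc Re_oppc Im_oppc.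
set x := Re (X t _); set y := Im (X t _); set x' := Re (h _); set y' := Im (h _).
have -> : x - x' = (x - ratr (a j)) - (x' - ratr (a j)) by ring.
have -> : y - y' = (y - ratr (b j)) - (y' - ratr (b j)) by ring.
have h3 := ler_normB (x - ratr (a j)) (x' - ratr (a j)).
have h4 := ler_normB (y - ratr (b j)) (y' - ratr (b j)).
have h5 := aP j; have h6 := bP j.
have h7 : k.+1%:R^-1 = 4 * e k by rewrite /e; field.
rewrite h7; rewrite -/x -/y -/x' -/y' in h1 h2 h5 h6.
move: (e k) h1 h2 h5 h6 h3 h4 => e'; lra.
Qed.
End herglotz_random_element.

Section stieltjes_transform.
Variable R : realType.
Implicit Types (c : configuration R) (z : R[i]).

(** Convergence at the single point [i] already gives it on the whole half plane, and real and
    imaginary parts make it visibly a measurable event. *)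
Definition stieltjes_summable c :=
  cvgn (fun n => Re (stieltjes_partial_sum c 'i n)) /\
  cvgn (fun n => Im (stieltjes_partial_sum c 'i n)).

Definition has_point c := exists v, (0 < c v)%N.

Let one_ge0 (v : R) : 0 <= (1 : R). Proof. exact: ler01. Qed.

Lemma stieltjes_summableP c :
  stieltjes_summable c <-> cvgn (stieltjes_partial_sum c 'i).
Proof.
split=> [[/cvg_ex[a ha] /cvg_ex[b hb]]|/cvg_ex[l /cvg_complexP[h1 h2]]].
  by apply/cvg_ex; exists (a +i* b); apply/cvg_complexP.
by split; apply/cvg_ex; eexists; [exact: h1|exact: h2].
Qed.

Lemma stieltjes_wsum c z n : stieltjes_partial_sum c z n =
  wstieltjes (fun n => points c n%:R) (fun=> 1) 0 n z.
Proof.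
rewrite stieltjes_partial_sumE /wstieltjes.
under [in RHS]eq_bigr do rewrite mul1r.
by rewrite [0 *i](_ : _ = 0) ?addr0.
Qed.

Lemma stieltjes_spec c : stieltjes_summable c -> has_point c ->
  (forall z, 0 < Im z -> stieltjes_partial_sum c z n @[n --> \oo] --> stieltjes c z) /\
  schwarz_pick (stieltjes c).
Proof.
move=> /stieltjes_summableP cs [v cv].
have [h [hl hsp]] : exists h : herglotz_pick R,
    (forall z, 0 < Im z -> stieltjes_partial_sum c z n @[n --> \oo] --> h z) /\
    schwarz_pick h.
  have [||||h [h1 h2]] := @herglotz_pick_limit R (fun n => points c n%:R) (fun=> 1) one_ge0 _ 0 (lexx 0) 'i.
  - by move=> g; apply: points_mono.
  - exact: ltr01.
  - by under eq_fun do rewrite -stieltjes_wsum.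
  - left; have [n vn] : exists n : nat, `|v| <= n%:R.
      by exists (Num.truncn `|v|).+1; apply/ltW/truncnS_gt.
    by exists n, v; split => //; rewrite mem_points vn.
  exists h; split; last exact: h2.
  move=> z zp; rewrite (_ : stieltjes_partial_sum c z =
    (fun n => wstieltjes (fun n => points c n%:R) (fun=> 1) 0 n z)).
    exact: h1.
  by apply/funext => n; exact: stieltjes_wsum.
(* [stieltjes c] was selected by its limits alone; uniqueness of limits identifies it with [h],
   which carries the Schwarz-Pick inequality. *)
have hS : forall z, 0 < Im z -> stieltjes_partial_sum c z n @[n --> \oo] --> stieltjes c z.
  rewrite /stieltjes; case: xgetP => [h' _ hh|none]; first exact: hh.
  by case: (none h hl).
split; first exact: hS.
suff -> : stieltjes c = h by [].
apply: herglotz_ext => z zp.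
exact: (cvg_unique _ (hS z zp) (hl z zp)).
Qed.

(** If the sums did converge to some [h], then [c] would be summable, hence without points; its sums
    would vanish, against [Im (h i) > 0]. *)
Lemma stieltjes_default c : ~ (stieltjes_summable c /\ has_point c) ->
  stieltjes c = herglotz_i R.
Proof.
move=> nc; rewrite /stieltjes; case: xgetP => // h _ hl.
have i0 : 0 < Im ('i : R[i]) by exact: ltr01.
case: nc; split; first by apply/stieltjes_summableP/cvg_ex; eexists; exact: hl.
apply: contrapT => /forallNP c0.
have : stieltjes_partial_sum c 'i n @[n --> \oo] --> (0 : R[i]).
  rewrite (_ : stieltjes_partial_sum c 'i = cst 0); first exact: cvg_cst.
  apply/funext => n; rewrite stieltjes_partial_sumE big_seq big1// => v.
  by rewrite mem_points => /andP[_ /c0].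
move=> /(cvg_unique _ (hl _ i0)) h0.
have e : Im (h 'i) = 0 by rewrite h0.
by have := herglotz_Im_gt0 h i0; rewrite e ltxx.
Qed.

Lemma schwarz_pick_stieltjes c : schwarz_pick (stieltjes c).
Proof.
have [[cs ne]|nc] := pselect (stieltjes_summable c /\ has_point c).
  by have [] := stieltjes_spec cs ne.
by rewrite stieltjes_default//; exact: schwarz_pick_i.
Qed.

Lemma continuous_sqker z : 0 < Im z -> continuous (sqker z).
Proof.
move=> zp v; rewrite (_ : sqker z = fun v => ((v - Re z) ^+ 2 + Im z ^+ 2)^-1).
  apply: cvgV; first by rewrite gt_eqF// ltr_wpDl ?sqr_ge0// exprn_gt0.
  apply: cvgD; last exact: cvg_cst.
  by rewrite expr2; under eq_fun do rewrite expr2; apply: cvgM;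
    apply: cvgB; [exact: cvg_id|exact: cvg_cst|exact: cvg_id|exact: cvg_cst].
by apply/funext => u; rewrite sqkerE.
Qed.

Lemma continuous_Re_inv_sub z : 0 < Im z -> continuous (fun v : R => Re ((v%:C - z)^-1)).
Proof.
move=> zp; rewrite (_ : (fun v => _) = (fun v => (v - Re z) * sqker z v)); last first.
  by apply/funext => v; exact: Re_inv_sub.
move=> v; apply: cvgM; last exact: continuous_sqker.
by apply: cvgB; [exact: cvg_id|exact: cvg_cst].
Qed.

Lemma continuous_Im_inv_sub z : 0 < Im z -> continuous (fun v : R => Im ((v%:C - z)^-1)).
Proof.
move=> zp; rewrite (_ : (fun v => _) = (fun v => Im z * sqker z v)); last first.
  by apply/funext => v; exact: Im_inv_sub.
by move=> v; apply: cvgMr; exact: continuous_sqker.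
Qed.

Context d (T : measurableType d) (omega : T -> configuration R).
Hypothesis momega : random_element omega.

Lemma measurable_stieltjes_partial_sum z n : 0 < Im z ->
  measurable_fun setT (fun t => Re (stieltjes_partial_sum (omega t) z n)) /\
  measurable_fun setT (fun t => Im (stieltjes_partial_sum (omega t) z n)).
Proof.
move=> zp; split.
  under eq_fun do rewrite stieltjes_partial_sumE Re_sum.
  by apply: measurable_points_continuous => //; exact: continuous_Re_inv_sub.
under eq_fun do rewrite stieltjes_partial_sumE Im_sum.
by apply: measurable_points_continuous => //; exact: continuous_Im_inv_sub.
Qed.

Lemma measurable_has_point : measurable [set t | has_point (omega t)].
Proof.
rewrite (_ : [set t | _] = \bigcup_(n in [set: nat])
    [set t | 0 < \sum_(v <- points (omega t) n%:R) (1 : R)]).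
  apply: bigcupT_measurable => n; rewrite -[X in measurable X]setTI.
  rewrite (_ : [set t | _] = (fun t => \sum_(v <- points (omega t) n%:R) (1 : R))
      @^-1` `]0, +oo[).
    by apply: measurable_points_continuous => // v; exact: cvg_cst.
  by apply/seteqP; split => t /=; rewrite in_itv/= andbT.
apply/seteqP; split => t.
  move=> [v cv]; exists (Num.truncn `|v|).+1 => //=.
  rewrite (big_rem v) /=; last by rewrite mem_points cv andbT; apply/ltW/truncnS_gt.
  by rewrite ltr_wpDr// sumr_ge0.
move=> [n _] /=; case E: (points (omega t) n%:R) => [|v s]; first by rewrite big_nil ltxx.
by move=> _; exists v; have := mem_head v s; rewrite -E mem_points => /andP[].
Qed.

Lemma measurable_stieltjes_summable : measurable [set t | stieltjes_summable (omega t)].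
Proof.
have i0 : 0 < Im ('i : R[i]) by exact: ltr01.
rewrite (_ : [set t | _] =
  [set t | cvgn (fun n => Re (stieltjes_partial_sum (omega t) 'i n))] `&`
  [set t | cvgn (fun n => Im (stieltjes_partial_sum (omega t) 'i n))])//.
apply: measurableI.
  apply: (@measurable_cvgn _ _ _ (fun n t => Re (stieltjes_partial_sum (omega t) 'i n))) => n.
  by have [] := measurable_stieltjes_partial_sum n i0.
apply: (@measurable_cvgn _ _ _ (fun n t => Im (stieltjes_partial_sum (omega t) 'i n))) => n.
by have [] := measurable_stieltjes_partial_sum n i0.
Qed.

Lemma stieltjes_random_element : random_element (fun t => stieltjes (omega t)).
Proof.
apply: herglotz_random_element => [t|z zp]; first exact: schwarz_pick_stieltjes.
pose D := [set t | stieltjes_summable (omega t)] `&` [set t | has_point (omega t)].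
have mD : measurable D.
  exact: measurableI measurable_stieltjes_summable measurable_has_point.
split.
  apply: (@measurable_if_lim _ _ _ (fun n t => Re (stieltjes_partial_sum (omega t) z n))
     D _ (Re (herglotz_i R z))) => //.
  - by move=> n; have [] := measurable_stieltjes_partial_sum n zp.
  - by move=> t [cs ne]; have [/(_ _ zp)/cvg_complexP[]] := stieltjes_spec cs ne.
  - by move=> t nD; rewrite stieltjes_default.
apply: (@measurable_if_lim _ _ _ (fun n t => Im (stieltjes_partial_sum (omega t) z n))
   D _ (Im (herglotz_i R z))) => //.
- by move=> n; have [] := measurable_stieltjes_partial_sum n zp.
- by move=> t [cs ne]; have [/(_ _ zp)/cvg_complexP[]] := stieltjes_spec cs ne.
- by move=> t nD; rewrite stieltjes_default.
Qed.
End stieltjes_transform.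

(** * Measurability of the tail sums *)

Section tails.
Variable R : realType.
Implicit Types (c : configuration R) (W : R) (z : R[i]).

Definition partial_square_tail c W n : R :=
  \sum_(v <- points c n%:R | W < `|v|) v ^- 2.

Lemma partial_square_tail_mono c W :
  {homo partial_square_tail c W : n m / (n <= m)%N >-> n <= m}.
Proof.
move=> n m nm; rewrite /partial_square_tail (@big_points _ _ _ n%:R m%:R) ?ler_nat//.
rewrite big_mkcond [leRHS]big_mkcond; apply: ler_sum => v _.
by case: (W < `|v|); rewrite ?andbF ?andbT//; case: ifP; rewrite // invr_ge0 sqr_ge0.
Qed.

(** Every finite set of points lies in some window, so the supremum over finite sets is one over a
    sequence; this gives measurability and finite bounds. *)
Lemma square_tail_sumE c W :
  square_tail_sum c W = ereal_sup (range (fun n => (partial_square_tail c W n)%:E)).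
Proof.
have fsE (A : set R) r : (forall v, A v -> `|v| <= r) -> finite_set A ->
    (\sum_(v \in A) ((c v)%:R / v ^+ 2)%:E = (\sum_(v <- points c r | v \in A) v ^- 2)%:E)%E.
  move=> Ar finA; rewrite fsumEFin//; congr EFin.
  by under eq_fsbigr do rewrite mulr_natl; exact: fsbig_points.
apply/eqP; rewrite eq_le; apply/andP; split.
  apply: ge_ereal_sup => _ [A [finA AW] <-].
  have [m Am] : exists m : nat, forall v, A v -> `|v| <= m%:R.
    move: finA => /finite_seqP[s As].
    exists (\sum_(v <- s) (Num.truncn `|v|).+1)%N => v; rewrite As /= => vs.
    rewrite (big_rem v)//= natrD -[leLHS]addr0; apply: lerD => //.
    by apply: ltW; exact: truncnS_gt.
  rewrite (fsE _ m%:R)//; apply: (@le_trans _ _ (partial_square_tail c W m)%:E).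
    rewrite lee_fin /partial_square_tail big_mkcond [leRHS]big_mkcond.
    apply: ler_sum => v _; case: ifPn => [/set_mem /AW /= ->//|_].
    by case: ifP; rewrite // invr_ge0 sqr_ge0.
  by apply: ereal_sup_ubound; exists m.
apply: ge_ereal_sup => _ [m _ <-].
pose A := [set v | W < `|v|] `&` [set v | `|v| <= m%:R /\ (0 < c v)%N].
have finA : finite_set A.
  by apply: (sub_finite_set _ (configuration_finite c m%:R)) => v [].
apply: ereal_sup_ubound; exists A; first by split => // v [].
rewrite (fsE _ m%:R)//; last by move=> v [_ []].
congr EFin; apply: eq_bigl_seq => v; rewrite mem_points => /andP[h1 h2].
by apply/idP/idP => [/set_mem[]//|h]; rewrite inE.
Qed.

Lemma partial_square_tail_le c W n e :
  (square_tail_sum c W <= e%:E)%E -> partial_square_tail c W n <= e.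
Proof.
move=> he; rewrite -lee_fin; apply: le_trans he; rewrite square_tail_sumE.
by apply: ereal_sup_ubound; exists n.
Qed.

Context d (T : measurableType d) (omega : T -> configuration R).
Hypothesis momega : random_element omega.

(** A continuous substitute for [v ^- 2], which is singular at 0; the two agree for [|v| > W]. *)
Lemma continuous_sq_max W : 0 < W ->
  continuous (fun v : R => (Num.max (v ^+ 2) (W ^+ 2))^-1).
Proof.
move=> W0 v; apply: cvgV.
  by rewrite gt_eqF// lt_max; apply/orP; right; rewrite exprn_gt0.
apply: cvg_maxr; last exact: cvg_cst.
rewrite expr2; under eq_fun do rewrite expr2.
by apply: cvgM; exact: cvg_id.
Qed.

Let max_sq W v : 0 < W -> W < `|v| -> Num.max (v ^+ 2) (W ^+ 2) = v ^+ 2.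
Proof.
move=> W0 Wv; apply/max_idPl; rewrite -(real_normK (num_real v)).
by rewrite lerXn2r ?nnegrE ?(ltW W0) ?(ltW Wv).
Qed.

Lemma measurable_tail_partial_sum W n : 0 < W ->
  measurable_fun setT (fun t => tail_partial_sum (omega t) W n).
Proof.
move=> W0.
rewrite (_ : (fun t => _) = (fun t => \sum_(v <- points (omega t) n%:R)
    (v * (Num.max (v ^+ 2) (W ^+ 2))^-1) * (W < `|v|)%R%:R)).
  apply: measurable_points_tail => // v.
  by apply: cvgM; [exact: cvg_id|exact: continuous_sq_max].
apply/funext => t; rewrite tail_partial_sumE big_mkcond; apply: eq_bigr => v _.
case: ifPn => Wv; last by rewrite mulr0.
rewrite mulr1 max_sq// expr2 invfM mulVKf//.
by apply: contraTneq Wv => ->; rewrite normr0 -leNgt ltW.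
Qed.

Lemma measurable_partial_square_tail W n : 0 < W ->
  measurable_fun setT (fun t => partial_square_tail (omega t) W n).
Proof.
move=> W0.
rewrite (_ : (fun t => _) = (fun t => \sum_(v <- points (omega t) n%:R)
    ((Num.max (v ^+ 2) (W ^+ 2))^-1) * (W < `|v|)%R%:R)).
  by apply: measurable_points_tail => //; exact: continuous_sq_max.
apply/funext => t; rewrite /partial_square_tail big_mkcond; apply: eq_bigr => v _.
by case: ifPn => Wv; rewrite ?mulr0// mulr1 max_sq.
Qed.

Lemma measurable_tail_sum W : 0 < W ->
  measurable_fun setT (fun t => tail_sum (omega t) W).
Proof.
(* Where the partial sums diverge, [limn] takes the default value [point]. *)
move=> W0; apply: (@measurable_if_lim _ _ _ (fun n t => tail_partial_sum (omega t) W n)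
   [set t | cvgn (tail_partial_sum (omega t) W)] _ point).
- by move=> n; exact: measurable_tail_partial_sum.
- apply: (@measurable_cvgn _ _ _ (fun n t => tail_partial_sum (omega t) W n)) => n.
  exact: measurable_tail_partial_sum.
- by move=> t; exact.
- by move=> t /= /dvgP.
Qed.

Lemma measurable_square_tail_sum W : 0 < W ->
  measurable_fun setT (fun t => square_tail_sum (omega t) W).
Proof.
move=> W0; apply: (@emeasurable_fun_cvg _ _ _ setT
  (fun n t => (partial_square_tail (omega t) W n)%:E)).
  by move=> n; apply/measurable_EFinP; exact: measurable_partial_square_tail.
move=> t _; rewrite square_tail_sumE; apply: ereal_nondecreasing_cvgn => n m nm.
by rewrite lee_fin partial_square_tail_mono.
Qed.

Lemma measurable_tail_event W e : 0 < W ->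
  measurable [set t | e <= `|tail_sum (omega t) W|].
Proof.
move=> W0; rewrite -[X in measurable X]setTI.
rewrite (_ : [set t | _] = (fun t => `|tail_sum (omega t) W|) @^-1` `[e, +oo[).
  have : measurable_fun setT (fun t => `|tail_sum (omega t) W|).
    apply: measurableT_comp; first exact: normr_measurable.
    exact: measurable_tail_sum.
  by apply.
by apply/seteqP; split => t /=; rewrite in_itv/= andbT.
Qed.

Lemma measurable_square_tail_event W (e : R) : 0 < W ->
  measurable [set t | (e%:E <= square_tail_sum (omega t) W)%E].
Proof.
move=> W0; rewrite -[X in measurable X]setTI.
by apply: emeasurable_fun_c_infty => //; exact: measurable_square_tail_sum.
Qed.
End tails.

(** * Truncation *)

Section truncation.
Variable R : realType.
Implicit Types (c : configuration R) (n : nat) (z : R[i]).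

Let rad n : R := n.+1%:R.

(** Any summable order would do in principle; with the inverse square, the mean number of Poisson
    points in the transition zone is at most a multiple of [1 / (n + 1) ^ 2]. *)
Definition width n : R := rad n ^- 2.

Lemma width_gt0 n : 0 < width n.
Proof. by rewrite invr_gt0 exprn_gt0. Qed.

Lemma width_le1 n : width n <= 1.
Proof. by rewrite invf_le1 ?exprn_gt0// exprn_ege1// ler1n. Qed.

Definition cutoff n : R -> R := trapezoid (rad n) (width n).

(** A continuous bump equal to 1 on the transition zone [rad n <= |v| <= rad n + width n] of the
    cutoff and vanishing beyond [width n] on either side of it. *)
Definition annulus n v : R :=
  trapezoid (rad n + width n) (width n) v - trapezoid (rad n - width n) (width n) v.

Lemma cutoff_out n v : rad n + 1 <= `|v| -> cutoff n v = 0.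
Proof.
move=> nv; apply: trapezoid_out; first exact: width_gt0.
by apply: le_trans nv; rewrite lerD2l width_le1.
Qed.

Lemma annulus_out n v : rad n + 2 * width n <= `|v| -> annulus n v = 0.
Proof.
have := width_gt0 n => w0 nv.
by rewrite /annulus !trapezoid_out ?subrr//; lra.
Qed.

Lemma annulus_in n v : `|v| <= rad n - width n -> annulus n v = 0.
Proof.
have := width_gt0 n => w0 nv.
by rewrite /annulus !trapezoid_in ?subrr//; lra.
Qed.

Lemma annulus_mid n v : rad n <= `|v| <= rad n + width n -> annulus n v = 1.
Proof.
have := width_gt0 n => w0 /andP[nv1 nv2].
by rewrite /annulus trapezoid_in// trapezoid_out ?subr0//; lra.
Qed.

Lemma annulus_ge0 n v : 0 <= annulus n v.
Proof.
have := width_gt0 n => w0; rewrite subr_ge0.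
have [h|h] := leP (rad n) `|v|.
  by rewrite [leLHS]trapezoid_out ?trapezoid_ge0//; lra.
by rewrite [leRHS]trapezoid_in ?trapezoid_le1//; lra.
Qed.

(* Dominates the indicator of the configurations that are empty or have points
   where the cutoff is neither [0] nor [1]. *)
Definition bad n c : R :=
  Num.min 1 (\sum_(v <- points c (rad n + 2)) annulus n v) +
  Num.max 0 (1 - \sum_(v <- points c (rad n + 1)) cutoff n v).

Lemma continuous_bad n : continuous (bad n).
Proof.
move=> c; have FF : Filter (nbhs c) := nbhs_filter c.
apply: cvgD.
  apply: cvg_minr; first exact: cvg_cst.
  apply: continuous_points_sum => [v|v nv].
    by apply: cvgB; exact: continuous_trapezoid.
  apply: annulus_out; apply: le_trans nv; rewrite lerD2l.
  by rewrite -[leRHS]mulr1 ler_wpM2l// width_le1.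
apply: cvg_maxr; first exact: cvg_cst.
apply: cvgB; first exact: cvg_cst.
apply: continuous_points_sum => [|v nv]; first exact: continuous_trapezoid.
exact: cutoff_out.
Qed.

Let annulus_sum_ge0 n c : 0 <= \sum_(v <- points c (rad n + 2)) annulus n v.
Proof. by apply: sumr_ge0 => v _; exact: annulus_ge0. Qed.

Let cutoff_sum_ge0 n c : 0 <= \sum_(v <- points c (rad n + 1)) cutoff n v.
Proof. by apply: sumr_ge0 => v _; exact: trapezoid_ge0. Qed.

Lemma bad_ge0 n c : 0 <= bad n c.
Proof. by rewrite addr_ge0// ?le_min ?le_max ?lexx ?annulus_sum_ge0 ?ler01. Qed.

Lemma bad_le2 n c : bad n c <= 2.
Proof.
rewrite (_ : 2 = 1 + 1)// lerD// ?ge_min ?lexx//.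
by rewrite ge_max ler01 gerBl cutoff_sum_ge0.
Qed.

Lemma bad_ge1 n c :
  ~ has_point c \/ (exists2 v, (0 < c v)%N & rad n < `|v| < rad n + width n) ->
  1 <= bad n c.
Proof.
have max0 : 0 <= Num.max 0 (1 - \sum_(v <- points c (rad n + 1)) cutoff n v).
  by rewrite le_max lexx.
have min0 : 0 <= Num.min 1 (\sum_(v <- points c (rad n + 2)) annulus n v).
  by rewrite le_min ler01 annulus_sum_ge0.
move=> [/forallNP c0|[v cv /andP[h1 h2]]].
  apply: (@le_trans _ _ (Num.max 0 (1 - \sum_(v <- points c (rad n + 1)) cutoff n v))).
    rewrite big_seq big1 ?subr0 ?le_max ?lexx ?orbT// => v.
    by rewrite mem_points => /andP[_ /c0].
  by rewrite /bad lerDr.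
apply: (@le_trans _ _ (Num.min 1 (\sum_(v <- points c (rad n + 2)) annulus n v))).
  rewrite le_min lexx /= (big_rem v) /=; last first.
    rewrite mem_points cv andbT; apply: ltW; apply: lt_le_trans h2 _.
    by rewrite lerD2l; apply: le_trans (width_le1 n) _; rewrite ler1n.
  rewrite annulus_mid ?(ltW h1) ?(ltW h2)// lerDl.
  by apply: sumr_ge0 => u _; exact: annulus_ge0.
by rewrite /bad lerDl.
Qed.

Let truncated_sum n c z : R[i] :=
  wstieltjes (fun=> points c (rad n + 1)) (cutoff n) (rad n)^-1 0 z.

Definition truncated_stieltjes n c : herglotz_pick R :=
  xget (herglotz_i R) [set h : herglotz_pick R |
    (forall z, 0 < Im z -> h z = truncated_sum n c z) /\ schwarz_pick h].

Lemma truncated_stieltjes_spec n c :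
  (forall z, 0 < Im z -> truncated_stieltjes n c z = truncated_sum n c z) /\
  schwarz_pick (truncated_stieltjes n c).
Proof.
rewrite /truncated_stieltjes; case: xgetP => [_ -> [h1 h2]//|none].
(* The sequence is constant in [n], so its limit is the truncated sum itself; positivity of the
   imaginary part comes from [(rad n)^-1], even without points. *)
have [|||||h [h1 h2]] := @herglotz_pick_limit R (fun=> points c (rad n + 1)) (cutoff n)
  (fun v => trapezoid_ge0 _ _ v) _ (rad n)^-1 _ 'i.
- by move=> g g0 i j _.
- by rewrite invr_ge0.
- exact: ltr01.
- exact: is_cvg_cst.
- by right; rewrite invr_gt0.
case: (none h); split => // z z0.
have := h1 z z0; rewrite [X in X @ _ --> _](_ : _ = cst (truncated_sum n c z))//.
by move=> /(cvg_unique _ (@cvg_cst _ _ _ _ _)) <-.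
Qed.

Lemma continuous_truncated_stieltjes n : continuous (truncated_stieltjes n).
Proof.
apply: continuous_herglotz => z z0.
rewrite [X in continuous X](_ : _ = (fun c => truncated_sum n c z)); last first.
  by apply/funext => c; have [-> //] := truncated_stieltjes_spec n c.
apply/continuous_complexP; split.
  rewrite (_ : Re \o _ = (fun c => \sum_(v <- points c (rad n + 1))
      cutoff n v * Re ((v%:C - z)^-1))).
    apply: continuous_points_sum => [v|v nv]; last by rewrite cutoff_out ?mul0r.
    by apply: cvgM; [exact: continuous_trapezoid|exact: continuous_Re_inv_sub].
  apply/funext => c /=; rewrite Re_addc /= addr0 Re_sum.
  by apply: eq_bigr => v _; rewrite Re_mulc /= mul0r subr0.
rewrite (_ : Im \o _ = (fun c => \sum_(v <- points c (rad n + 1))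
    cutoff n v * Im ((v%:C - z)^-1) + (rad n)^-1)).
  move=> c; have FF : Filter (nbhs c) := nbhs_filter c.
  apply: cvgD; last exact: cvg_cst.
  apply: continuous_points_sum => [v|v nv]; last by rewrite cutoff_out ?mul0r.
  by apply: cvgM; [exact: continuous_trapezoid|exact: continuous_Im_inv_sub].
apply/funext => c /=; rewrite Im_addc /= Im_sum; congr (_ + _).
by apply: eq_bigr => v _; rewrite Im_mulc /= mul0r addr0.
Qed.

(** By [bad_ge1] no point lies in the transition zone, so each point has cutoff 1 or 0 according to
    whether it lies in the window. *)
Lemma truncated_stieltjesE n c z : 0 < Im z -> bad n c < 1 ->
  truncated_stieltjes n c z = stieltjes_partial_sum c z n.+1 + (rad n)^-1 *i.
Proof.
move=> z0 nb; have [-> // _] := truncated_stieltjes_spec n c.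
rewrite stieltjes_partial_sumE /truncated_sum /wstieltjes; congr (_ + _).
rewrite (@big_points _ _ _ n.+1%:R (rad n + 1)) ?lerDl// [RHS]big_mkcond.
rewrite big_seq [RHS]big_seq; apply: eq_bigr => v; rewrite mem_points => /andP[_ cv].
rewrite andbT; case: ifPn => [vn|]; first by rewrite /cutoff trapezoid_in ?width_gt0// mul1r.
rewrite -ltNge => vn; rewrite /cutoff trapezoid_out ?width_gt0 ?mul0r//.
rewrite leNgt; apply/negP => vw; have : 1 <= bad n c.
  by apply: bad_ge1; right; exists v => //; rewrite vn.
by rewrite leNgt nb.
Qed.

(* [1 / (v - z) = 1 / v + z / (v (v - z))], and [|v - z| >= |v| / 2] for [|v| >= 2 |z|]. *)
Lemma inv_sub_approx (v : R) z : 0 < Im z -> 2 * normc z <= `|v| -> 0 < `|v| ->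
  normc ((v%:C - z)^-1 - v^-1%:C) <= 2 * normc z * v ^- 2.
Proof.
move=> z0 zv v0; have vn0 : v%:C != 0 by rewrite -[0]/((0 : R)%:C) (inj_eq (@complexI R)) -normr_gt0.
have -> : (v%:C - z)^-1 - v^-1%:C = z * ((v%:C)^-1 * (v%:C - z)^-1).
  rewrite (rmorphV (real_complex R)) ?unitfE -?normr_gt0//=; have := sub_real_neq0 v z0 => h.
  by field; rewrite vn0 h.
have h : `|v| / 2 <= normc (v%:C - z).
  have := normcD (v%:C - z) z; rewrite subrK normc_real; lra.
have h2 : (normc (v%:C - z))^-1 <= 2 * `|v|^-1.
  rewrite -[leRHS]invrK lef_pV2 ?posrE ?invr_gt0 ?mulr_gt0 ?invr_gt0//.
    by rewrite invfM invrK mulrC.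
  exact: normc_sub_gt0.
rewrite !Normc.normcM !Normc.normcV normc_real -(real_normK (num_real v)).
rewrite expr2 invfM.
have -> : 2 * normc z * (`|v|^-1 * `|v|^-1) = normc z * (`|v|^-1 * (2 * `|v|^-1)) by ring.
by rewrite ler_wpM2l ?normc_ge0// ler_wpM2l// invr_ge0.
Qed.

Lemma stieltjes_truncation_error n c z e : 0 < Im z -> 2 * normc z <= rad n ->
  stieltjes_summable c -> bad n c < 1 ->
  cvgn (tail_partial_sum c (rad n)) -> `|tail_sum c (rad n)| <= e ->
  (square_tail_sum c (rad n) <= e%:E)%E ->
  normc (stieltjes c z - truncated_stieltjes n c z) <= e + 2 * normc z * e + (rad n)^-1.
Proof.
move=> z0 zn cs nb ct te se.
have ne : has_point c.
  apply: contrapT => h; have : 1 <= bad n c by apply: bad_ge1; left.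
  by rewrite leNgt nb.
have [/(_ z z0) hl _] := stieltjes_spec cs ne.
rewrite truncated_stieltjesE//.
(* The tail of [1 / v] converges only conditionally, so [1 / (v - z)] and [1 / v] are compared
   inside the window of radius [m], where the error is at most [2 |z|] times the tail of
   [1 / v ^ 2]; the limit in [m] comes afterwards. *)
pose D m := stieltjes_partial_sum c z m - stieltjes_partial_sum c z n.+1 -
   (tail_partial_sum c (rad n) m)%:C.
have hD m : (n.+1 <= m)%N -> normc (D m) <= 2 * normc z * e.
  move=> nm; have eqS : stieltjes_partial_sum c z m = stieltjes_partial_sum c z n.+1 +
      \sum_(v <- points c m%:R | rad n < `|v|) (v%:C - z)^-1.
    rewrite !stieltjes_partial_sumE (@big_points _ _ _ n.+1%:R m%:R) ?ler_nat//.
    rewrite [LHS](bigID (fun v => `|v| <= n.+1%:R)) /=; congr (_ + _).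
      by apply: eq_bigl => v; rewrite andbT.
    by apply: eq_bigl => v; rewrite ltNge.
  have E (x y w : R[i]) : x + y - x - w = y - w by ring.
  rewrite /D eqS E tail_partial_sumE.
  rewrite (rmorph_sum (real_complex R)) /= -sumrB.
  apply: le_trans (normc_sum _ _ _) _.
  apply: (@le_trans _ _ (\sum_(v <- points c m%:R | rad n < `|v|) 2 * normc z * v ^- 2)).
    apply: ler_sum => v nv; apply: inv_sub_approx => //.
      exact: le_trans zn (ltW nv).
    exact: le_lt_trans (ler0n _ _) nv.
  rewrite -mulr_sumr ler_wpM2l ?mulr_ge0 ?normc_ge0//.
  exact: (partial_square_tail_le m se).
have cD : normc (D m) @[m --> \oo] --> normc (stieltjes c z -
    stieltjes_partial_sum c z n.+1 - (tail_sum c (rad n))%:C).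
  apply: cvg_normc; apply: cvg_complexB.
    by apply: cvg_complexB; [exact: hl|exact: cvg_cst].
  by apply/cvg_complexP; split; [exact: ct|exact: cvg_cst].
have hlim : normc (stieltjes c z - stieltjes_partial_sum c z n.+1 -
    (tail_sum c (rad n))%:C) <= 2 * normc z * e.
  rewrite -(cvg_lim _ cD)//; apply: limr_le.
    by apply/cvg_ex; eexists; exact: cD.
  by exists n.+1 => // m /= ?; exact: hD.
have -> : stieltjes c z - (stieltjes_partial_sum c z n.+1 + (rad n)^-1 *i) =
    (stieltjes c z - stieltjes_partial_sum c z n.+1 - (tail_sum c (rad n))%:C) +
    (tail_sum c (rad n))%:C - (rad n)^-1 *i by ring.
apply: le_trans (normcD _ _) _; rewrite normcN lerD//; last first.
  by rewrite /= expr0n /= add0r sqrtr_sqr ger0_norm// invr_ge0.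
apply: le_trans (normcD _ _) _; rewrite addrC normc_real.
exact: lerD.
Qed.
End truncation.

(** * The Poisson process *)

Section almost_sure_series.
Variable R : realType.

(** Telescoping: [1 / (k + 1) ^ 2 <= 2 (1 / (k + 1) - 1 / (k + 2))], because
    [k + 2 <= 2 (k + 1)]. *)
Lemma sum_inv_sq_le (n : nat) :
  \sum_(0 <= k < n) (k.+1%:R ^- 2 : R) <= 2 * (1 - n.+1%:R^-1).
Proof.
elim: n => [|n IH]; first by rewrite big_geq// invr1 subrr mulr0.
rewrite big_nat_recr//=; apply: le_trans (lerD IH (lexx _)) _.
have n1 : (0 : R) < n.+1%:R by [].
have n2 : (0 : R) < n.+2%:R by [].
rewrite -lerBrDl -mulrBr.
have -> : 1 - n.+2%:R^-1 - (1 - n.+1%:R^-1) = n.+1%:R^-1 - n.+2%:R^-1 :> R by ring.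
have -> : n.+1%:R^-1 - n.+2%:R^-1 = n.+1%:R^-1 * n.+2%:R^-1 :> R.
  have e : n.+2%:R = n.+1%:R + 1 :> R by rewrite -natr1.
  rewrite e; rewrite e in n2; field; rewrite !gt_eqF//.
rewrite expr2 invfM mulrCA ler_wpM2l ?invr_ge0//.
rewrite -[leRHS]invf_div lef_pV2 ?posrE ?divr_gt0//.
by rewrite ler_pdivrMr// -natrM ler_nat muln2 -addnn addSn addnS !ltnS leq_addr.
Qed.

Context d (T : measurableType d) (P : probability T R).

(** The sum of the means is finite, so the sum is integrable and almost surely finite. This takes
    the place of the Borel-Cantelli lemma below. *)
Lemma ae_cvg_series (X : nat -> T -> R) (C : R) : 0 <= C ->
  (forall n t, 0 <= X n t) -> (forall n, measurable_fun setT (X n)) ->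
  (forall n, (\int[P]_t (X n t)%:E <= (C / n.+1%:R ^+ 2)%:E)%E) ->
  {ae P, forall t, cvgn (series (X ^~ t))}.
Proof.
move=> C0 X0 mX XC; pose S t := (\sum_(0 <= n <oo) (X n t)%:E)%E.
have mXE n : measurable_fun setT (fun t => (X n t)%:E) by apply/measurable_EFinP.
have mS : measurable_fun setT S.
  by apply: ge0_emeasurable_sum => // n t _ _; rewrite lee_fin.
have S0 t : (0 <= S t)%E by apply: nneseries_ge0 => n _ _; rewrite lee_fin.
have iS : (\int[P]_t S t <= (2 * C)%:E)%E.
  rewrite integral_nneseries//; last by move=> n t _; rewrite lee_fin.
  apply: lime_le.
    by apply: is_cvg_nneseries => n _ _; apply: integral_ge0 => t _; rewrite lee_fin.
  apply: nearW => n; apply: (@le_trans _ _ (\sum_(0 <= k < n) (C / k.+1%:R ^+ 2)%:E)%E).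
    by apply: lee_sum => k _; exact: XC.
  rewrite sumEFin lee_fin -mulr_sumr mulrC ler_wpM2r//.
  apply: le_trans (sum_inv_sq_le n) _.
  by rewrite ler_piMr// gerBl invr_ge0.
have intS : P.-integrable setT S.
  apply/integrableP; split => //; under eq_integral do rewrite gee0_abs//.
  by apply: le_lt_trans iS _; rewrite ltry.
apply: filterS (integrable_ae measurableT intS) => t /(_ I) St.
apply: nondecreasing_is_cvgn.
  by apply: nondecreasing_series => n _ _; exact: X0.
exists (fine (S t)) => _ [n _ <-]; rewrite -lee_fin fineK// /series /= -sumEFin.
by apply: nneseries_lim_ge => k _ _; rewrite lee_fin.
Qed.
End almost_sure_series.

(** * First two moments of the Poisson law *)

Section poisson_moments.
Context d (T : measurableType d) (R : realType) (P : probability T R).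
Variables (N : T -> nat) (lambda : R).
Hypothesis lambda_ge0 : 0 <= lambda.
Hypothesis N_poisson : forall k, P [set t | N t = k] = poisson_prob lambda 0%N [set k].
Hypothesis mN : measurable_fun setT (fun t => (N t)%:R : R).

Local Open Scope ereal_scope.

Let mNk k : measurable [set t | N t = k].
Proof.
rewrite -[X in measurable X]setTI.
rewrite (_ : [set t | _] = (fun t => (N t)%:R : R) @^-1` [set k%:R]); first exact: mN.
by apply/seteqP; split => t /= => [->//|/eqP]; rewrite eqr_nat => /eqP.
Qed.

Lemma integral_nat_valued (g : nat -> R) : (forall k, 0 <= g k)%R ->
  measurable_fun setT (g \o N) ->
  \int[P]_t (g (N t))%:E = \sum_(0 <= k <oo) (g k)%:E * P [set t | N t = k].
Proof.
move=> g0 mg; rewrite (_ : [set: T] = \bigcup_k [set t | N t = k]); last first.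
  by apply/seteqP; split => t // _; exists (N t).
rewrite ge0_integral_bigcup//.
- apply: eq_eseriesr => k _; rewrite -integral_cst//.
  by apply: eq_integral => t /set_mem /= ->.
- rewrite (_ : \bigcup_k _ = setT); last by apply/seteqP; split => t // _; exists (N t).
  exact/measurable_EFinP.
- by move=> t _; rewrite lee_fin.
- by apply/trivIsetP => i j _ _ ij; apply/seteqP; split => t //= [-> /eqP]; rewrite (negbTE ij).
Qed.

(** Shifting the index once turns [sum k p_k] into [lambda sum p_k], and [sum k ^ 2 p_k] into
    [lambda sum (k + 1) p_k]; both moments follow. *)
Let pmf_shift k : (0 < lambda)%R ->
  (k.+1%:R * poisson_pmf lambda k.+1 = lambda * poisson_pmf lambda k)%R.
Proof.
move=> l0; rewrite /poisson_pmf l0 factS natrM exprS.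
have k0 : (k.+1%:R : R) != 0%R by [].
have f0 : (k`!%:R : R) != 0%R by rewrite pnatr_eq0 -lt0n fact_gt0.
move: (k.+1%:R : R) (k`!%:R : R) (lambda ^+ k)%R k0 f0 => a b c a0 b0.
by field; rewrite ?a0 ?b0.
Qed.

Let prob_pmf k : (0 < lambda)%R -> P [set t | N t = k] = (poisson_pmf lambda k)%:E.
Proof. by move=> l0; rewrite N_poisson /poisson_prob l0 esum_set1// lee_fin poisson_pmf_ge0. Qed.

Let sum_shift (f : nat -> R) : (forall k, 0 <= f k)%R -> f 0%N = 0%R ->
  \sum_(0 <= k <oo) (f k)%:E = \sum_(0 <= k <oo) (f k.+1)%:E.
Proof.
move=> f0 f00; rewrite nneseries_recl//; last by move=> k _; rewrite lee_fin.
rewrite f00 add0e -(nneseries_addn 1); last by move=> k; rewrite lee_fin.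
by apply: eq_eseriesr => k _; rewrite addn1.
Qed.

(** The events [N t = k] partition the space, so this is the total mass of [P]; no exponential
    series is summed. *)
Let sum_pmf : \sum_(0 <= k <oo) P [set t | N t = k] = 1.
Proof.
have mc : measurable_fun setT ((fun=> 1%R : R) \o N) by exact: measurable_cst.
have h := integral_nat_valued (fun=> ler01) mc.
have <- : \int[P]_t cst 1%E t = 1.
  by rewrite integral_cst// mul1e; exact: probability_setT.
by rewrite [RHS]h; apply: eq_eseriesr => k _; rewrite mul1e.
Qed.

Lemma poisson_mean : \int[P]_t ((N t)%:R)%:E = lambda%:E.
Proof.
rewrite (@integral_nat_valued (fun k => k%:R))//.
have [l0|l0] := ltP 0%R lambda; last first.
  have -> : lambda = 0%R by apply/eqP; rewrite eq_le l0 lambda_ge0.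
  apply: eseries0 => k _ _; rewrite N_poisson /poisson_prob ltNge l0 /=.
  by case: k => [|k]; rewrite ?mul0e// diracE memNset ?mule0//.
under eq_eseriesr do rewrite prob_pmf// -EFinM.
rewrite (@sum_shift (fun k => k%:R * poisson_pmf lambda k)%R) ?mul0r//; last first.
  by move=> k; rewrite mulr_ge0 ?poisson_pmf_ge0.
under eq_eseriesr do rewrite pmf_shift// EFinM -prob_pmf//.
by rewrite nneseriesZl ?sum_pmf ?mule1// => k _.
Qed.

Lemma poisson_second_moment : (0 < lambda)%R ->
  \int[P]_t ((N t)%:R ^+ 2)%:E = (lambda + lambda ^+ 2)%:E.
Proof.
move=> l0; have := poisson_mean.
rewrite (@integral_nat_valued (fun k => k%:R))// => mean.
rewrite (@integral_nat_valued (fun k => k%:R ^+ 2)%R); first last.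
- exact: measurable_funX.
- by move=> k; rewrite sqr_ge0.
under eq_eseriesr do rewrite prob_pmf// -EFinM.
rewrite (@sum_shift (fun k => k%:R ^+ 2 * poisson_pmf lambda k)%R) ?expr0n ?mul0r//; last first.
  by move=> k; rewrite mulr_ge0 ?poisson_pmf_ge0 ?sqr_ge0.
transitivity (\sum_(0 <= k <oo)
    lambda%:E * (k%:R%:E * P [set t | N t = k] + P [set t | N t = k])).
  apply: eq_eseriesr => k _.
  rewrite expr2 -mulrA pmf_shift// prob_pmf//.
  set p := poisson_pmf lambda k.
  transitivity (lambda * (k%:R * p + p))%:E; last by rewrite !(EFinM, EFinD).
  by congr EFin; rewrite -natr1; ring.
rewrite nneseriesZl; last by move=> k _; rewrite adde_ge0// mule_ge0// lee_fin.
rewrite nneseriesD//; last by move=> k _ _; rewrite mule_ge0// lee_fin.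
by rewrite mean sum_pmf -EFinD -EFinM; congr EFin; ring.
Qed.

End poisson_moments.

Lemma cube_block (n : nat) : exists k, (k ^ 3 <= n < k.+1 ^ 3)%N.
Proof.
elim: n => [|n [k /andP[kn nk]]]; first by exists 0%N.
have [h|h] := ltnP n.+1 (k.+1 ^ 3); first by exists k; rewrite h (leq_trans kn).
by exists k.+1; rewrite h (leq_ltn_trans nk)// ltn_exp2r.
Qed.

Lemma cube_gap (k : nat) : (k.+1 ^ 3 - k ^ 3 <= 3 * k.+1 ^ 2)%N.
Proof. by rewrite leq_subLR !expnS !expn0; nia. Qed.

(** Equality holds at [k = 1]. On the block starting at [k ^ 3] it bounds [1 / (j + 1)] by
    [4 / (k + 1) ^ 3]. *)
Lemma cube_ge (k : nat) : (k.+1 ^ 3 <= 4 * (k ^ 3).+1)%N.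
Proof. by rewrite !expnS !expn0; case: k => [|k]; nia. Qed.

Lemma cvg_blocks (R : realType) (s y : nat -> R) :
  cvgn (fun k => s (k ^ 3)%N) -> y k @[k --> \oo] --> (0 : R) ->
  (forall k n, (k ^ 3 <= n < k.+1 ^ 3)%N -> `|s n - s (k ^ 3)%N| <= y k) ->
  cvgn s.
Proof.
move=> /cvg_ex[l /cvgrPdist_lt sl] /cvgrPdist_lt y0 sy.
apply/cvg_ex; exists l; apply/cvgrPdist_lt => e e0.
have e2 : 0 < e / 2 by rewrite divr_gt0.
have [K _ hK] := filterI (sl _ e2) (y0 _ e2).
exists (K ^ 3)%N => // n /= Kn; have [k /andP[kn nk]] := cube_block n.
have Kk : (K <= k)%N.
  by rewrite -ltnS -(@ltn_exp2r _ _ 3)//; exact: leq_ltn_trans nk.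
have [/= h1 h2] := hK k Kk.
have h3 : `|s n - s (k ^ 3)%N| <= y k by apply: sy; rewrite kn.
have -> : l - s n = (l - s (k ^ 3)%N) - (s n - s (k ^ 3)%N) by ring.
apply: le_lt_trans (ler_normB _ _) _; rewrite [ltRHS]splitr ltrD//.
by apply: le_lt_trans h3 _; move: h2; rewrite sub0r normrN; apply: le_lt_trans; exact: ler_norm.
Qed.

Lemma integral_probability_cst d (T : measurableType d) (R : realType)
  (P : probability T R) (r : \bar R) : (\int[P]_t r = r)%E.
Proof.
rewrite (integral_cst P measurableT r) -[RHS]mule1; congr (_ * _)%E.
exact: probability_setT.
Qed.

(** From [(1 / x - x y) ^ 2 >= 0]. With [x = k + 1] it turns a second moment of order [k ^- 4] into
    a first moment of order [k ^- 2]. *)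
Lemma le_inv_sq_add (R : realType) (x y : R) : 0 < x -> 0 <= y ->
  y <= x ^- 2 + x ^+ 2 * y ^+ 2.
Proof.
move=> x0 y0; have xi : x^-1 * x = 1 by rewrite mulVf ?gt_eqF.
rewrite -exprVn; move: (x^-1) xi => i xi.
have := sqr_ge0 (i - x * y).
have -> : (i - x * y) ^+ 2 = i ^+ 2 - 2 * (i * x) * y + x ^+ 2 * y ^+ 2 by ring.
by rewrite xi; lra.
Qed.

(* [N (j, true)] and [N (j, false)] stand for the numbers of points of the Poisson
   process in [`]j, j + 1]] and [`[- (j + 1), - j[]; only second moments are used,
   and summing over the blocks [`[k^3, (k+1)^3[] makes them summable. *)
Section unit_correlations.
Context d (T : measurableType d) (R : realType) (P : probability T R).
Variable N : nat * bool -> T -> R.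
Hypothesis mN : forall i, measurable_fun setT (N i).
Hypothesis N_ge0 : forall i t, 0 <= N i t.
Hypothesis N_mean : forall i, (\int[P]_t (N i t)%:E = 1)%E.
Hypothesis N_corr : forall i j,
  (\int[P]_t (N i t * N j t)%:E = (1 + (i == j)%:R)%:E)%E.

Let intNN i j : P.-integrable setT (fun t => (N i t * N j t)%:E).
Proof.
apply/integrableP; split; first by apply/measurable_EFinP; exact: measurable_funM.
under eq_integral => t _ do rewrite gee0_abs ?lee_fin ?mulr_ge0//.
by rewrite N_corr ltry.
Qed.

(** The [N i] have mean 1 and identity covariance; the right side is the squared mean plus the
    variance. *)
Lemma integral_sq_sum (r : seq (nat * bool)) (b : nat * bool -> R) : uniq r ->
  (\int[P]_t ((\sum_(i <- r) b i * N i t) ^+ 2)%:E =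
   ((\sum_(i <- r) b i) ^+ 2 + \sum_(i <- r) b i ^+ 2)%:E)%E.
Proof.
move=> ur; pose s := [seq (i, j) | i <- r, j <- r].
under eq_integral => t _.
  rewrite expr2 big_distrlr /=.
  rewrite (_ : \sum_(i <- r) _ = \sum_(p <- s) (b p.1 * b p.2) * (N p.1 t * N p.2 t)).
    rewrite -sumEFin; over.
  rewrite big_allpairs_dep /=; apply: eq_bigr => i _; apply: eq_bigr => j _; ring.
rewrite integral_sum//; last first.
  move=> p; under eq_fun do rewrite EFinM.
  by apply: integrableZl.
transitivity (\sum_(p <- s) ((b p.1 * b p.2) * (1 + (p.1 == p.2)%:R))%:E)%E.
  apply: eq_bigr => p _; under eq_integral do rewrite EFinM.
  by rewrite integralZl// N_corr -EFinM.
rewrite sumEFin big_allpairs_dep /=; congr EFin.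
rewrite expr2 big_distrlr /= -big_split /=; rewrite big_seq [RHS]big_seq.
apply: eq_bigr => i ir.
under eq_bigr do rewrite mulrDr mulr1.
rewrite big_split /=; congr (_ + _).
rewrite (bigD1_seq i)//= eqxx mulr1 big1 ?addr0 ?expr2// => j ji.
by rewrite eq_sym (negbTE ji) mulr0.
Qed.

Let blk (J : seq nat) : seq (nat * bool) := [seq (j, s) | j <- J, s <- [:: true; false]].

Let blk_sum (V : nmodType) J (f : nat * bool -> V) :
  \sum_(i <- blk J) f i = \sum_(j <- J) (f (j, true) + f (j, false)).
Proof.
rewrite big_allpairs_dep; apply: eq_bigr => j _.
by rewrite big_cons big_seq1.
Qed.

Let blk_uniq J : uniq J -> uniq (blk J).
Proof. by move=> uJ; apply: allpairs_uniq => // -[i1 i2] [j1 j2] _ _ /= [-> ->]. Qed.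

(** Opposite coefficients on the two half lines cancel the squared mean and leave the variance; the
    symmetry of the windows enters here. *)
Lemma integral_sq_diff (J : seq nat) (a : nat -> R) : uniq J ->
  (\int[P]_t ((\sum_(j <- J) a j * (N (j, true) t - N (j, false) t)) ^+ 2)%:E =
   (2 * \sum_(j <- J) a j ^+ 2)%:E)%E.
Proof.
move=> uJ.
have := integral_sq_sum (fun i => if i.2 then a i.1 else - a i.1) (blk_uniq uJ).
rewrite !blk_sum /= (eq_bigr (fun=> 0)); last by move=> j _; rewrite subrr.
rewrite big1_eq expr0n /= add0r mulr_sumr.
under [in RHS]eq_bigr do rewrite sqrrN -mulr2n -mulr_natl.
move=> <-; apply: eq_integral => t _; rewrite blk_sum /=; congr (_ ^+ 2)%:E.
by apply: eq_bigr => j _; rewrite mulrBr mulNr.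
Qed.

Lemma integral_sq_total (J : seq nat) (a : nat -> R) : uniq J ->
  (\int[P]_t ((\sum_(j <- J) a j * (N (j, true) t + N (j, false) t)) ^+ 2)%:E =
   ((2 * \sum_(j <- J) a j) ^+ 2 + 2 * \sum_(j <- J) a j ^+ 2)%:E)%E.
Proof.
move=> uJ; have := integral_sq_sum (fun i => a i.1) (blk_uniq uJ).
rewrite !blk_sum /= !mulr_sumr.
under [in RHS]eq_bigr do rewrite -mulr2n -mulr_natl.
under [X in _ + X]eq_bigr do rewrite -mulr2n -mulr_natl.
move=> <-; apply: eq_integral => t _; rewrite blk_sum /=; congr (_ ^+ 2)%:E.
by apply: eq_bigr => j _; rewrite mulrDr.
Qed.

Variable a : nat -> R.
Hypothesis a_bound : forall j, `|a j| <= 2 / j.+1%:R.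

Let X j t := N (j, true) t - N (j, false) t.
Let M j t := N (j, true) t + N (j, false) t.

Lemma ae_cvg_total_sq : {ae P, forall t, cvgn (series (fun j => M j t / j.+1%:R ^+ 2))}.
Proof.
apply: (@ae_cvg_series R _ _ P (fun j t => M j t / j.+1%:R ^+ 2) 2) => //.
- by move=> n t; rewrite divr_ge0// addr_ge0.
- by move=> n; apply: measurable_funM => //; exact: measurable_funD.
move=> n; under eq_integral do rewrite EFinM EFinD muleC.
rewrite ge0_integralZl_EFin ?invr_ge0//; last first.
- by apply: emeasurable_funD; exact/measurable_EFinP.
- by move=> t _; rewrite adde_ge0// lee_fin.
rewrite ge0_integralD//; first last.
- exact/measurable_EFinP.
- by move=> t _; rewrite lee_fin.
- exact/measurable_EFinP.
- by move=> t _; rewrite lee_fin.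
by rewrite !N_mean -EFinD -EFinM mulrC.
Qed.

(** A block has at most [3 (k + 1) ^ 2] indices, with coefficients at most [8 / (k + 1) ^ 3]. So
    [D k] has variance of order [k ^- 4], and the absolute coefficients add up to order [1 / k].
    [Y k] dominates every partial sum inside the block. *)
Let J k := index_iota (k ^ 3) (k.+1 ^ 3).
Let D k t := \sum_(j <- J k) a j * X j t.
Let Y k t := \sum_(j <- J k) `|a j| * M j t.

Let a_block k j : j \in J k -> `|a j| <= 8 / k.+1%:R ^+ 3.
Proof.
rewrite mem_index_iota => /andP[kj _]; apply: le_trans (a_bound j) _.
rewrite ler_pdivrMr// mulrAC ler_pdivlMr ?exprn_gt0//.
rewrite -natrX -!natrM ler_nat; apply: (@leq_trans (2 * (4 * (k ^ 3).+1))%N).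
  by rewrite leq_pmul2l// cube_ge.
by rewrite mulnA leq_pmul2l.
Qed.

Let sum_block_le k (f : nat -> R) (C : R) : 0 <= C ->
  (forall j, j \in J k -> f j <= C) -> \sum_(j <- J k) f j <= 3 * k.+1%:R ^+ 2 * C.
Proof.
move=> C0 fC; apply: (@le_trans _ _ (\sum_(j <- J k) C)).
  by rewrite big_seq [leRHS]big_seq ler_sum.
rewrite big_const_seq count_predT size_iota iter_addr_0 -[leLHS]mulr_natl.
by rewrite ler_wpM2r// -natrX -natrM ler_nat cube_gap.
Qed.

Let sum_sq_block k : \sum_(j <- J k) a j ^+ 2 <= 192 / k.+1%:R ^+ 4.
Proof.
apply: le_trans (sum_block_le (C := (8 / k.+1%:R ^+ 3) ^+ 2) _ _) _.
- by rewrite sqr_ge0.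
- move=> j jk; rewrite -(real_normK (num_real (a j))) lerXn2r ?nnegrE ?divr_ge0//.
  exact: a_block.
rewrite le_eqVlt; apply/orP; left; apply/eqP.
by have : (k.+1%:R : R) != 0 by []; move: (k.+1%:R : R) => x x0; field.
Qed.

Let mX j : measurable_fun setT (X j). Proof. exact: measurable_funB. Qed.
Let mM j : measurable_fun setT (M j). Proof. exact: measurable_funD. Qed.

Let mD k : measurable_fun setT (D k).
Proof. by apply: measurable_sum => j; exact: measurable_funM. Qed.

Let mY k : measurable_fun setT (Y k).
Proof. by apply: measurable_sum => j; exact: measurable_funM. Qed.

Let ae_cvg_D : {ae P, forall t, cvgn (series (fun k => `|D k t|))}.
Proof.
(* [385 = 1 + 2 * 192], where [192 = 3 * 8 ^ 2] comes from [sum_sq_block]. *)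
apply: (@ae_cvg_series R _ _ P (fun k t => `|D k t|) 385).
- exact: ler0n.
- by move=> k t; exact: normr_ge0.
- by move=> k; apply: measurableT_comp; [exact: normr_measurable|exact: mD].
move=> k; pose x : R := k.+1%:R.
have x0 : 0 < x by [].
apply: (@le_trans _ _ (\int[P]_t ((x ^- 2)%:E + (x ^+ 2)%:E * (D k t ^+ 2)%:E))%E).
  apply: ge0_le_integral => //.
  - by apply/measurable_EFinP; apply: measurableT_comp => //; exact: normr_measurable.
  - apply: emeasurable_funD => //; apply: measurable_funeM.
    by apply/measurable_EFinP; exact: measurable_funX.
  move=> t _; rewrite -EFinM -EFinD lee_fin -(real_normK (num_real (D k t))).
  exact: le_inv_sq_add.
rewrite ge0_integralD//; first last.
- apply: measurable_funeM; apply/measurable_EFinP; exact: measurable_funX.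
- by move=> t _; rewrite -EFinM lee_fin mulr_ge0 ?sqr_ge0.
- by move=> t _; rewrite lee_fin invr_ge0 sqr_ge0.
rewrite integral_probability_cst ge0_integralZl_EFin ?sqr_ge0//; first last.
- apply/measurable_EFinP; exact: measurable_funX.
- by move=> t _; rewrite lee_fin sqr_ge0.
rewrite integral_sq_diff ?iota_uniq// -EFinM -EFinD lee_fin.
apply: (@le_trans _ _ (x ^- 2 + x ^+ 2 * (2 * (192 / x ^+ 4)))).
  by rewrite lerD2l ler_wpM2l ?sqr_ge0// ler_wpM2l.
rewrite le_eqVlt; apply/orP; left; apply/eqP.
have xn0 : x != 0 by exact: lt0r_neq0.
by rewrite -/x; move: x {x0} xn0 => x xn0; field.
Qed.

Let ae_cvg_Y : {ae P, forall t, cvgn (series (fun k => Y k t ^+ 2))}.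
Proof.
(* [2688 = (2 * 24) ^ 2 + 2 * 192]: squared mean plus variance. *)
apply: (@ae_cvg_series R _ _ P (fun k t => Y k t ^+ 2) 2688).
- exact: ler0n.
- by move=> k t; rewrite sqr_ge0.
- by move=> k; exact: measurable_funX.
move=> k; rewrite integral_sq_total ?iota_uniq// lee_fin.
pose x : R := k.+1%:R; rewrite -/x.
have x1 : 1 <= x by rewrite ler1n.
have x0 : 0 < x by [].
have h1 : \sum_(j <- J k) `|a j| <= 24 / x.
  apply: le_trans (sum_block_le (C := 8 / k.+1%:R ^+ 3) _ _) _.
  - by rewrite divr_ge0.
  - by move=> j jk; exact: a_block.
  rewrite le_eqVlt; apply/orP; left; apply/eqP.
  have xn0 : x != 0 by exact: lt0r_neq0.
  by rewrite -/x; move: x {x0 x1} xn0 => x xn0; field.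
have h2 : \sum_(j <- J k) `|a j| ^+ 2 <= 192 / x ^+ 4.
  by under eq_bigr do rewrite real_normK ?num_real//; exact: sum_sq_block.
have h3 : 0 <= \sum_(j <- J k) `|a j| by exact: sumr_ge0.
apply: (@le_trans _ _ ((2 * (24 / x)) ^+ 2 + 2 * (192 / x ^+ 2))).
  apply: lerD.
    by rewrite lerXn2r ?nnegrE ?mulr_ge0 ?ler_wpM2l// invr_ge0 ltW.
  rewrite ler_wpM2l//; apply: le_trans h2 _; rewrite ler_wpM2l//.
  by rewrite lef_pV2 ?posrE ?exprn_gt0//; apply: ler_weXn2l.
rewrite le_eqVlt; apply/orP; left; apply/eqP.
have xn0 : x != 0 by exact: lt0r_neq0.
by rewrite -/x; move: x {x0 x1 h1 h2} xn0 => x xn0; field.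
Qed.

Lemma ae_cvg_diff_series : {ae P, forall t, cvgn (series (fun j => a j * X j t))}.
Proof.
apply: filterS2 ae_cvg_D ae_cvg_Y => t cD cY.
have Y0 k : 0 <= Y k t by apply: sumr_ge0 => j _; rewrite mulr_ge0// addr_ge0.
apply: (@cvg_blocks R _ (fun k => Y k t)).
- rewrite (_ : (fun k => _) = series (fun k => D k t)).
    exact: normed_cvg.
  apply/funext; elim=> [|k IH]; first by rewrite /series /= !big_geq.
  rewrite [RHS]seriesSr -IH /series /= /D /J.
  by rewrite (@big_cat_nat _ _ _ (k ^ 3)%N)//= leq_exp2r.
(* The summable squares tend to 0, hence so do the [Y k], as nonnegative square roots. *)
- have h := cvg_series_cvg_0 cY.
  rewrite -(@sqrtr0 R) (_ : (fun k => _) = (fun k => Num.sqrt (Y k t ^+ 2))).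
    by apply: (cvg_comp _ _ h); exact: sqrt_continuous.
  by apply/funext => k; rewrite sqrtr_sqr ger0_norm.
move=> k n /andP[kn nk]; rewrite /series /= (@big_cat_nat _ _ _ (k ^ 3)%N 0 n)//=.
rewrite addrAC subrr add0r.
apply: (@le_trans _ _ (\sum_(k ^ 3 <= j < n) `|a j| * M j t)).
  apply: le_trans (ler_norm_sum _ _ _) _; apply: ler_sum => j _.
  rewrite normrM ler_wpM2l//; apply: le_trans (ler_normB _ _) _.
  by rewrite !ger0_norm.
rewrite /Y /J (@big_cat_nat _ _ _ n (k ^ 3)%N (k.+1 ^ 3)%N)//= ?(ltnW nk)// lerDl.
by apply: sumr_ge0 => j _; rewrite mulr_ge0// addr_ge0.
Qed.
End unit_correlations.

(** * Reduction of summability to series of counts in unit intervals *)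

Section summability_criterion.
Variable R : realType.
Implicit Types (c : configuration R) (j n : nat).

(** Closed at the end away from 0, so that the two intervals of index [j] make up [j < |v| <= j + 1]
    and all of them partition [R] minus the origin. *)
Definition unit_interval (i : nat * bool) : set R :=
  if i.2 then `]i.1%:R, i.1.+1%:R]%classic else `[(- i.1.+1%:R)%R, (- i.1%:R)%R[%classic.

Definition unit_count c i : R := (count_points (unit_interval i) c)%:R.

Lemma unit_interval_bound i v : unit_interval i v -> `|v| <= i.1.+1%:R.
Proof.
have i0 : 0 <= i.1%:R :> R by [].
have i1 : i.1.+1%:R = i.1%:R + 1 :> R by rewrite -natr1.
case: i i0 i1 => j [] /= j0 j1; rewrite /unit_interval /= in_itv /= j1 => /andP[h1 h2];
  rewrite ler_norml; apply/andP; split; lra.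
Qed.

Lemma unit_intervalE i v : `|v| <= i.1.+1%:R ->
  (v \in unit_interval i) = (i.1%:R < `|v|) && (if i.2 then 0 < v else v < 0).
Proof.
have i0 : 0 <= i.1%:R :> R by [].
have i1 : i.1.+1%:R = i.1%:R + 1 :> R by rewrite -natr1.
case: i i0 i1 => j [] /= j0 j1; rewrite j1 => vj.
  apply/idP/andP => [/set_mem|[h1 h2]]; rewrite /unit_interval ?inE/= in_itv /= j1.
    move=> /andP[h1 h2]; have v0 : 0 < v by lra.
    by rewrite gtr0_norm.
  by move: h1 vj; rewrite gtr0_norm// => -> ->.
apply/idP/andP => [/set_mem|[h1 h2]]; rewrite /unit_interval ?inE/= in_itv /= j1.
  move=> /andP[h1 h2]; have v0 : v < 0 by lra.
  by rewrite ltr0_norm//; split => //; lra.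
by move: h1 vj; rewrite ltr0_norm// => h1 h3; apply/andP; split; lra.
Qed.

Lemma unit_count_sum c i : unit_count c i =
  \sum_(v <- points c i.1.+1%:R | i.1%:R < `|v|) (if i.2 then 0 < v else v < 0)%R%:R.
Proof.
rewrite /unit_count (@count_pointsE _ _ i.1.+1%:R); last exact: unit_interval_bound.
rewrite big_mkcond [RHS]big_mkcond big_seq [RHS]big_seq.
apply: eq_bigr => v; rewrite mem_points => /andP[vi _].
rewrite unit_intervalE//; case: (i.1%:R < `|v|) => //=.
by case: (if i.2 then _ else _).
Qed.

Let total c j : R := unit_count c (j, true) + unit_count c (j, false).
Let diff c j : R := unit_count c (j, true) - unit_count c (j, false).

Let total_sum c j : total c j = \sum_(v <- points c j.+1%:R | j%:R < `|v|) 1.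
Proof.
rewrite /total !unit_count_sum /= -big_split /=; apply: eq_bigr => v jv.
have : v != 0 by apply: contraTneq jv => ->; rewrite normr0 -leNgt.
by case: ltgtP => //= _ _; rewrite ?addr0 ?add0r.
Qed.

Let diff_sum c j : diff c j = \sum_(v <- points c j.+1%:R | j%:R < `|v|) Num.sg v.
Proof.
rewrite /diff !unit_count_sum /= -sumrB; apply: eq_bigr => v jv.
have : v != 0 by apply: contraTneq jv => ->; rewrite normr0 -leNgt.
by case: sgrP => //= v0 _; rewrite ?subr0 ?sub0r.
Qed.

(** Shell by shell; [points c 0] holds the copies of the origin, which no shell contains. *)
Lemma points_series c (f : R -> R) n : \sum_(v <- points c n%:R) f v =
  \sum_(v <- points c 0) f v +
  series (fun j => \sum_(v <- points c j.+1%:R | j%:R < `|v|) f v) n.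
Proof.
elim: n => [|n IH]; first by rewrite /series /= big_geq// addr0.
rewrite seriesSr addrA -IH.
rewrite (@big_points _ _ _ n%:R n.+1%:R) ?ler_nat//.
rewrite [LHS](bigID (fun v => `|v| <= n%:R)) /=; congr (_ + _).
  by apply: eq_bigl => v; rewrite andbT.
by apply: eq_bigl => v; rewrite ltNge.
Qed.

(** On the shell [j] the function is replaced by the odd step [a j * sg v], whose sum is [a j] times
    the difference of the counts; the errors are absolutely summable. *)
Lemma is_cvg_points_sum c (f : R -> R) (a : nat -> R) (C : R) : 0 <= C ->
  (forall j v, j%:R < `|v| -> `|v| <= j.+1%:R ->
    `|f v - a j * Num.sg v| <= C / j.+1%:R ^+ 2) ->
  cvgn (series (fun j => total c j / j.+1%:R ^+ 2)) ->
  cvgn (series (fun j => a j * diff c j)) ->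
  cvgn (fun n => \sum_(v <- points c n%:R) f v).
Proof.
move=> C0 fa ct cd; under eq_fun do rewrite points_series.
apply: is_cvgD; first exact: is_cvg_cst.
pose err j := \sum_(v <- points c j.+1%:R | j%:R < `|v|) (f v - a j * Num.sg v).
rewrite (_ : series _ = series (fun j => a j * diff c j) + series err); last first.
  apply/funext => n; rewrite /series /= -[RHS]/(_ + _) -big_split /=.
  apply: eq_bigr => j _; rewrite diff_sum mulr_sumr -big_split /=.
  by apply: eq_bigr => v _; rewrite addrC subrK.
apply: is_cvgD => //; apply: normed_cvg.
apply: (@series_le_cvg _ _ (fun j => C * (total c j / j.+1%:R ^+ 2))).
- by move=> j; exact: normr_ge0.
- by move=> j /=; rewrite mulr_ge0// divr_ge0// total_sum sumr_ge0.
- move=> j /=; apply: le_trans (ler_norm_sum _ _ _) _.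
  rewrite total_sum mulrC -mulrA [_^-1 * _]mulrC mulr_suml.
  rewrite big_seq_cond [leRHS]big_seq_cond; apply: ler_sum => v.
  by rewrite mem_points mul1r => /andP[/andP[vj _] jv]; exact: fa.
rewrite (_ : series _ = (fun n => C * series (fun j => total c j / j.+1%:R ^+ 2) n)).
  by apply: is_cvgM => //; exact: is_cvg_cst.
by apply/funext => n; rewrite /series /= mulr_sumr.
Qed.

(* The value at [j] of [v / (v ^ 2 + 1) = Re (1 / (v - i))]. *)
Definition slope j : R := j%:R / (j%:R ^+ 2 + 1).

Lemma slope_bound j : `|slope j| <= 2 / j.+1%:R.
Proof.
have d0 : 0 < j%:R ^+ 2 + 1 :> R by rewrite ltr_wpDl ?sqr_ge0.
rewrite ger0_norm ?divr_ge0 ?(ltW d0)// ler_pdivrMr// mulrAC ler_pdivlMr//.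
have j0 : 0 <= j%:R :> R by [].
rewrite -natr1; move: (j%:R) j0 => x x0; nra.
Qed.

Let inv_sq_le (v : R) j : j%:R <= `|v| -> (v ^+ 2 + 1)^-1 <= 2 / j.+1%:R ^+ 2.
Proof.
move=> jv; rewrite -[leRHS]invf_div lef_pV2 ?posrE ?divr_gt0 ?exprn_gt0 ?ltr_wpDl ?sqr_ge0//.
rewrite ler_pdivrMr// -(real_normK (num_real v)) -natr1.
have j0 : 0 <= j%:R :> R by [].
move: (j%:R) (`|v|) j0 jv => x y x0 xy.
have : x ^+ 2 <= y ^+ 2 by rewrite lerXn2r ?nnegrE// (le_trans x0).
have := sqr_ge0 (x - 1); rewrite sqrrB sqrrD !expr1n mulr1; lra.
Qed.

Lemma stieltjes_summable_criterion c :
  cvgn (series (fun j => total c j / j.+1%:R ^+ 2)) ->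
  cvgn (series (fun j => slope j * diff c j)) -> stieltjes_summable c.
Proof.
move=> ct cd; split.
  rewrite (_ : (fun n => _) = (fun n => \sum_(v <- points c n%:R) v * (v ^+ 2 + 1)^-1)).
    apply: (is_cvg_points_sum (ler0n _ 2) _ ct cd) => j v jv vj.
    have jj : j%:R <= `|j%:R : R| by rewrite ger0_norm.
    apply: le_trans (inv_sq_le jj).
    have d0 : 0 < j%:R ^+ 2 + 1 :> R by rewrite ltr_wpDl ?sqr_ge0.
    have d1 : 0 < v ^+ 2 + 1 :> R by rewrite ltr_wpDl ?sqr_ge0.
    have v0 : v != 0 by apply: contraTneq jv => ->; rewrite normr0 -leNgt.
    (* Both functions are odd, so only [|v|] matters. *)
    have -> : v * (v ^+ 2 + 1)^-1 - slope j * Num.sg v =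
        Num.sg v * (`|v| * (`|v| ^+ 2 + 1)^-1 - slope j).
      rewrite mulrBr mulrA -numEsg [slope j * _]mulrC real_normK ?num_real//.
    rewrite normrM normr_sg v0 mul1r.
    have w1 : 0 < `|v| ^+ 2 + 1 by rewrite ltr_wpDl ?sqr_ge0.
    move: vj; rewrite -natr1 /slope.
    have j0 : 0 <= j%:R :> R by [].
    move: (j%:R) (`|v|) j0 jv d0 w1 => x y x0 xy d0 w1 yx.
    (* For [x < y <= x + 1] the last factor is at most 1 in modulus, as [|1 - x y| <= y ^ 2 + 1];
       what remains is [1 / (x ^ 2 + 1)]. *)
    have -> : y * (y ^+ 2 + 1)^-1 - x / (x ^+ 2 + 1) =
        (x ^+ 2 + 1)^-1 * ((y - x) * (1 - x * y) / (y ^+ 2 + 1)).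
      by field; rewrite !gt_eqF.
    rewrite normrM ger0_norm ?invr_ge0 ?(ltW d0)//.
    rewrite ler_piMr ?invr_ge0 ?(ltW d0)//.
    rewrite normrM [`|(_ + 1)^-1|]ger0_norm ?invr_ge0 ?(ltW w1)// ler_pdivrMr// mul1r.
    rewrite normrM ger0_norm ?subr_ge0 ?(ltW xy)//.
    have y0 : 0 <= y by apply: le_trans x0 (ltW xy).
    apply: (@le_trans _ _ `|1 - x * y|); first by rewrite ler_piMl//; lra.
    have := mulr_ge0 x0 y0; have := ler_wpM2r y0 (ltW xy).
    rewrite -expr2 ler_norml => h1 h2; have := sqr_ge0 y.
    by move=> h3; apply/andP; split; lra.
  apply/funext => n; rewrite stieltjes_partial_sumE Re_sum; apply: eq_bigr => v _.
  by rewrite Re_inv_sub sqkerE /= subr0 expr1n.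
rewrite (_ : (fun n => _) = (fun n => \sum_(v <- points c n%:R) (v ^+ 2 + 1)^-1)).
  (* The imaginary part is itself of order [1 / j ^ 2] on the shell [j], so no step function is
     subtracted. *)
  apply: (is_cvg_points_sum (a := fun=> 0) (ler0n _ 2) _ ct).
    move=> j v jv _; rewrite mul0r subr0 ger0_norm; first exact: inv_sq_le (ltW jv).
    by rewrite invr_ge0 addr_ge0 ?sqr_ge0.
  rewrite (_ : series _ = cst 0); first exact: is_cvg_cst.
  by apply/funext => n; rewrite /series /= big1// => j _; rewrite mul0r.
apply/funext => n; rewrite stieltjes_partial_sumE Im_sum; apply: eq_bigr => v _.
by rewrite Im_inv_sub sqkerE /= subr0 expr1n mul1r.
Qed.
End summability_criterion.

(** * Almost sure properties of the Poisson process *)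

Section poisson_process.
Context d (T : measurableType d) (R : realType) (P : probability T R).
Variable omega : T -> configuration R.
Hypothesis omega_poisson : standard_poisson P omega.

Let momega : random_element omega. Proof. by case: omega_poisson. Qed.

Let count B t : R := (count_points B (omega t))%:R.

Lemma measurable_count_pos (g : R -> R) r : continuous g ->
  (forall v, 0 < g v -> `|v| <= r) -> measurable_fun setT (count [set v | 0 < g v]).
Proof.
move=> gc gr.
rewrite (_ : count _ = fun t => \sum_(v <- points (omega t) r) (0 < g v)%R%:R).
  exact: measurable_points_pos.
apply/funext => t; rewrite /count (@count_pointsE _ _ r)// big_mkcond.
by apply: eq_bigr => v _; rewrite (_ : (v \in _) = (0 < g v)) //;
  [case: ifP|apply/idP/idP; rewrite inE].
Qed.

Lemma countU (A B : set R) t : bounded_set A -> bounded_set B -> A `&` B = set0 ->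
  count (A `|` B) t = count A t + count B t.
Proof.
move=> [a [_ ha]] [b [_ hb]] AB.
pose r := Num.max (a + 1) (b + 1).
have Ar v : A v -> `|v| <= r.
  by move=> Av; rewrite le_max (ha (a + 1)) ?ltrDl.
have Br v : B v -> `|v| <= r.
  by move=> Bv; rewrite le_max (hb (b + 1)) ?ltrDl// orbT.
rewrite /count !(@count_pointsE _ _ r)//; last by move=> v [/Ar|/Br].
rewrite big_mkcond [X in _ = X + _]big_mkcond [X in _ = _ + X]big_mkcond -big_split /=.
apply: eq_bigr => v _; rewrite in_setU.
have : ~ ((v \in A) && (v \in B)).
  by move=> /andP[/set_mem h1 /set_mem h2]; suff : set0 v by []; rewrite -AB.
by case: (v \in A); case: (v \in B) => //= h; rewrite ?addr0 ?add0r//; case: h.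
Qed.

Let bounded_unit i : bounded_set (@unit_interval R i).
Proof.
exists i.1.+1%:R; split; first exact: num_real.
by move=> x ix v /unit_interval_bound /le_trans; apply; exact: ltW.
Qed.

Let measurable_unit i : measurable (@unit_interval R i).
Proof. by rewrite /unit_interval; case: ifP => _; exact: measurable_itv. Qed.

Let measure_unit i : (lebesgue_measure (@unit_interval R i) = 1)%E.
Proof.
have i1 : i.1.+1%:R = i.1%:R + 1 :> R by rewrite -natr1.
rewrite /unit_interval; case: ifP => _; rewrite lebesgue_measure_itv /= lte_fin i1.
  by rewrite ltrDl ltr01 -EFinB; congr EFin; ring.
by rewrite ltrN2 ltrDl ltr01 -EFinB; congr EFin; ring.
Qed.

Let disjoint_unit i j : i != j -> (@unit_interval R i) `&` (@unit_interval R j) = set0.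
Proof.
move=> ij; apply/seteqP; split => // v [vi vj].
have hi := unit_interval_bound vi; have hj := unit_interval_bound vj.
move: vi vj => /mem_set + /mem_set; rewrite !unit_intervalE// => /andP[h1 h2] /andP[h3 h4].
case: i j ij hi hj h1 h2 h3 h4 => [i a] [j b] /= ij hi hj h1 h2 h3 h4.
have eij : i = j.
  apply/eqP; rewrite eqn_leq; apply/andP; split; rewrite -ltnS -(ltr_nat R).
    exact: lt_le_trans h1 hj.
  exact: lt_le_trans h3 hi.
case/eqP: ij; congr (_, _) => //.
by case: a h2; case: b h4 => // h4 h2; move: (lt_trans h2 h4); rewrite ltxx.
Qed.

Let N i := count (@unit_interval R i).

Let mN i : measurable_fun setT (N i).
Proof.
(* The indicator of a half-open interval is the difference of those of two open half lines. *)
have E (f g : R -> R) : continuous f -> continuous g ->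
    (forall v, (v \in (@unit_interval R i))%:R = (0 < f v)%R%:R - (0 < g v)%R%:R :> R) ->
    measurable_fun setT (N i).
  move=> fc gc fg.
  rewrite (_ : N i = fun t => \sum_(v <- points (omega t) i.1.+1%:R) (0 < f v)%R%:R -
      \sum_(v <- points (omega t) i.1.+1%:R) (0 < g v)%R%:R).
    by apply: measurable_funB; exact: measurable_points_pos.
  apply/funext => t; rewrite /N /count (@count_pointsE _ _ i.1.+1%:R); last exact: unit_interval_bound.
  rewrite big_mkcond -sumrB; apply: eq_bigr => v _; rewrite -fg.
  by case: (v \in _).
have i1 : i.1.+1%:R = i.1%:R + 1 :> R by rewrite -natr1.
have [i2|i2] := boolP i.2.
  apply: (E (fun v => v - i.1%:R) (fun v => v - i.1.+1%:R)).
  - by move=> v; apply: cvgB; [exact: cvg_id|exact: cvg_cst].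
  - by move=> v; apply: cvgB; [exact: cvg_id|exact: cvg_cst].
  move=> v; rewrite /unit_interval i2 mem_setE in_itv /= !subr_gt0 i1.
  case: ltP => h1; case: leP => h2; rewrite /= ?subr0 ?subrr//; lra.
apply: (E (fun v => - i.1%:R - v) (fun v => - i.1.+1%:R - v)).
- by move=> v; apply: cvgB; [exact: cvg_cst|exact: cvg_id].
- by move=> v; apply: cvgB; [exact: cvg_cst|exact: cvg_id].
move=> v; rewrite /unit_interval (negbTE i2) mem_setE in_itv /= !subr_gt0 i1.
case: leP => h1; case: ltP => h2; rewrite /= ?subr0 ?subrr//; lra.
Qed.

Lemma count_poisson (B : set R) (l : R) : measurable B -> bounded_set B ->
  lebesgue_measure B = l%:E ->
  forall k, P [set t | count_points B (omega t) = k] = poisson_prob l 0%N [set k].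
Proof. by case: omega_poisson => _ h _ mB bB lB k; rewrite h// lB. Qed.

Let N_mean i : (\int[P]_t (N i t)%:E = 1)%E.
Proof.
apply: poisson_mean => //; last exact: mN.
by move=> k; apply: count_poisson => //; exact: measure_unit.
Qed.

Let N_sq i : (\int[P]_t (N i t ^+ 2)%:E = 2%:E)%E.
Proof.
rewrite (@poisson_second_moment _ _ _ P (fun t => count_points (@unit_interval R i) (omega t)) 1)//.
- by congr EFin; ring.
- by move=> k; apply: count_poisson => //; exact: measure_unit.
- exact: mN.
Qed.

Let N_ge0 i t : 0 <= N i t. Proof. exact: ler0n. Qed.

Let N_corr i j : (\int[P]_t (N i t * N j t)%:E = (1 + (i == j)%:R)%:E)%E.
Proof.
have [<-|ij] := eqVneq i j.
  by under eq_integral do rewrite -expr2; rewrite N_sq.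
pose U := (@unit_interval R i) `|` (@unit_interval R j).
have bU : bounded_set U.
  exists (Num.max i.1.+1%:R j.1.+1%:R); split; first exact: num_real.
  move=> x; rewrite gt_max => /andP[ix jx] v [] /unit_interval_bound /le_trans; apply;
    exact: ltW.
have mU : measurable U by apply: measurableU; exact: measurable_unit.
have lU : (lebesgue_measure U = 2%:E)%E.
  transitivity (lebesgue_measure (@unit_interval R i) +
      lebesgue_measure (@unit_interval R j))%E; last by rewrite !measure_unit -EFinD.
  apply: measureU; [exact: measurable_unit|exact: measurable_unit|].
  exact: disjoint_unit.
have NU t : count U t = N i t + N j t by apply: countU => //; exact: disjoint_unit.
have mUc : measurable_fun setT (count U).
  by rewrite (_ : count U = N i \+ N j); [exact: measurable_funD|exact/funext].
(* At rate 2 the second moment is [2 + 2 ^ 2 = 6]; then [6 = 2 + 2 x + 2] forces the correlation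
   [x = 1]. *)
have U2 : (\int[P]_t (count U t ^+ 2)%:E = 6%:E)%E.
  rewrite (@poisson_second_moment _ _ _ P (fun t => count_points U (omega t)) 2)//.
  - by congr EFin; ring.
  - by move=> k; apply: count_poisson.
have mNE k : measurable_fun setT (fun t => (N k t ^+ 2)%:E).
  by apply/measurable_EFinP; exact: measurable_funX.
have mNN : measurable_fun setT (fun t => (N i t * N j t)%:E).
  by apply/measurable_EFinP; exact: measurable_funM.
(* The number of points in the union of two disjoint unit intervals is Poisson of
   rate 2, so that its second moment determines the correlation. *)
have : (\int[P]_t (count U t ^+ 2)%:E = \int[P]_t (N i t ^+ 2)%:E +
    (2%:E * \int[P]_t (N i t * N j t)%:E + \int[P]_t (N j t ^+ 2)%:E))%E.
  rewrite -ge0_integralZl_EFin//; last by move=> t _; rewrite lee_fin mulr_ge0.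
  rewrite -ge0_integralD//; first last.
  - by move=> t _; rewrite lee_fin sqr_ge0.
  - exact: measurable_funeM.
  - by move=> t _; rewrite -EFinM lee_fin !mulr_ge0.
  rewrite -ge0_integralD//; first last.
  - by apply: emeasurable_funD => //; exact: measurable_funeM.
  - by move=> t _; rewrite -EFinM -EFinD lee_fin addr_ge0 ?sqr_ge0// !mulr_ge0.
  - by move=> t _; rewrite lee_fin sqr_ge0.
  apply: eq_integral => t _; rewrite NU -EFinM -!EFinD; congr EFin; ring.
rewrite U2 !N_sq.
have x0 : (0 <= \int[P]_t (N i t * N j t)%:E)%E.
  by apply: integral_ge0 => t _; rewrite lee_fin mulr_ge0.
case: (\int[P]_t (N i t * N j t)%:E)%E x0 => [x| |] //= _.
  by move=> [e]; congr EFin; lra.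
by rewrite mulry gtr0_sg// mul1e.
Qed.

Lemma poisson_summable : {ae P, forall t, stieltjes_summable (omega t)}.
Proof.
have h1 := @ae_cvg_total_sq _ _ _ P N mN N_ge0 N_mean.
have h2 := @ae_cvg_diff_series _ _ _ P N mN N_ge0 N_corr (@slope R) (@slope_bound R).
apply: filterS2 h1 h2 => t; exact: stieltjes_summable_criterion.
Qed.

(** The window of radius [n + 1] is empty with probability [exp (- 2 (n + 1))], which is below
    [1 / (n + 1)] for every [n]. *)
Lemma poisson_has_point : {ae P, forall t, has_point (omega t)}.
Proof.
pose E := ~` [set t | has_point (omega t)].
have mE : measurable E by apply: measurableC; exact: measurable_has_point.
exists E; split => //; apply/eqP; rewrite eq_le measure_ge0 andbT.
have PE (n : nat) : (P E <= (n.+1%:R^-1)%:E)%E.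
  pose B : set R := `](- n.+1%:R)%R, n.+1%:R[%classic.
  have bB : bounded_set B.
    exists n.+1%:R; split; first exact: num_real.
    move=> x nx v; rewrite /B /= in_itv /= => h; apply: ltW; apply: lt_trans nx.
    by rewrite ltr_norml.
  have lB : (lebesgue_measure B = (2 * n.+1%:R)%:E)%E.
    rewrite lebesgue_measure_itv /= lte_fin ifT; last by rewrite gtrN.
    by rewrite -EFinB; congr EFin; ring.
  have mB : measurable B by exact: measurable_itv.
  have mC : measurable_fun setT (count B).
    rewrite (_ : B = [set v | 0 < n.+1%:R - `|v|]); last first.
      by apply/seteqP; split => v; rewrite /B /= in_itv /= subr_gt0 ltr_norml.
    apply: (@measurable_count_pos _ n.+1%:R).
      by move=> v; apply: cvgB; [exact: cvg_cst|exact: cvg_norm].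
    by move=> v; rewrite subr_gt0 => /ltW.
  apply: (@le_trans _ _ (P [set t | count_points B (omega t) = 0%N])).
    apply: le_measure; rewrite ?inE//.
      rewrite -[X in measurable X]setTI.
      rewrite (_ : [set t | _] = count B @^-1` [set 0]); first exact: mC.
      apply/seteqP; split => t /=; rewrite /count; first by move=> ->.
      by move=> /eqP; rewrite pnatr_eq0 => /eqP.
    move=> t /forallNP c0 /=; apply/eqP; rewrite -(pnatr_eq0 R).
    rewrite (@count_pointsE _ _ n.+1%:R); last first.
      by move=> v; rewrite /B /= in_itv /= => h; apply: ltW; rewrite ltr_norml.
    by rewrite big_seq_cond big1// => v; rewrite mem_points => /andP[/andP[_ /c0]].
  rewrite (count_poisson mB bB lB) /poisson_prob mulr_gt0// esum_set1; last first.
    by rewrite lee_fin poisson_pmf_ge0.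
  rewrite lee_fin /poisson_pmf mulr_gt0// expr0 fact0 invr1 !mul1r expRN.
  rewrite lef_pV2 ?posrE ?expR_gt0//.
  have := @expR_ge1Dx R (2 * n.+1%:R); have : 0 <= n.+1%:R :> R by [].
  lra.
apply/lee_addgt0Pr => e e0; rewrite add0e.
have : n.+1%:R^-1 @[n --> \oo] --> (0 : R) by exact: cvg_harmonic.
move=> /cvgrPdist_lt /(_ e e0)[n _ /(_ n (leqnn n))].
rewrite sub0r normrN ger0_norm// => ne.
by apply: le_trans (PE n) _; rewrite lee_fin ltW.
Qed.

Let annulus_sum n t : R :=
  \sum_(v <- points (omega t) (n.+1%:R + 2)) annulus n v.

Let annulus_sum_mean n : (\int[P]_t (annulus_sum n t)%:E <= (10 / n.+1%:R ^+ 2)%:E)%E.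
Proof.
set r : R := n.+1%:R; set w := @width R n.
have w0 : 0 < w by exact: width_gt0.
have w1 : w <= 1 by exact: width_le1.
have r0 : 0 < r by [].
(* The set [g > 0] contains the support of the bump and has thickness [5 w] on each side; as [g] is
   continuous, the number of points in it is measurable. *)
pose g (v : R) : R := Num.min (`|v| - (r - 2 * w)) (r + 3 * w - `|v|).
pose A := [set v | 0 < g v].
have gc : continuous g.
  move=> v; apply: cvg_minr; apply: cvgB; try exact: cvg_cst; exact: cvg_norm.
have Ar v : 0 < g v -> `|v| <= r + 3 by rewrite lt_min => /andP[_]; lra.
(* For [n = 0] the two intervals overlap, so the measure is only bounded by [10 w]. *)
pose I1 : set R := `](r - 2 * w), (r + 3 * w)[%classic.
pose I2 : set R := `](- (r + 3 * w))%R, (- (r - 2 * w))%R[%classic.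
have AE : A = I1 `|` I2.
  apply/seteqP; split => v; rewrite /A /I1 /I2 /g /= !in_itv /= lt_min !subr_gt0.
    move=> /andP[h1 h2]; have [v0|v0] := leP 0 v.
      by left; move: h1 h2; rewrite ger0_norm// => -> ->.
    by right; move: h1 h2; rewrite ltr0_norm// => h1 h2; apply/andP; split; lra.
  move=> [] /andP[h1 h2]; apply/andP; split.
  - by apply: lt_le_trans h1 _; exact: ler_norm.
  - by rewrite ltr_norml h2 andbT; lra.
  - by rewrite ltrNr in h2; apply: lt_le_trans h2 _; rewrite -normrN ler_norm.
  - by rewrite ltr_norml h1 /=; lra.
have mA : measurable A by rewrite AE; apply: measurableU; exact: measurable_itv.
have bA : bounded_set A.
  by exists (r + 3); split; [exact: num_real|move=> x rx v /Ar /le_trans; apply; exact: ltW].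
have lA : (lebesgue_measure A <= (10 * w)%:E)%E.
  apply: (@le_trans _ _ (lebesgue_measure I1 + lebesgue_measure I2)%E).
    by rewrite AE; apply: measureU2; exact: measurable_itv.
  have l1 : lebesgue_measure I1 = (5 * w)%:E.
    rewrite lebesgue_measure_itv /= lte_fin ifT; last by lra.
    by rewrite -EFinB; congr EFin; ring.
  have l2 : lebesgue_measure I2 = (5 * w)%:E.
    rewrite lebesgue_measure_itv /= lte_fin ifT; last by lra.
    by rewrite -EFinB; congr EFin; ring.
  by rewrite l1 l2 -EFinD lee_fin; lra.
have [l l0 lE] : exists2 l, 0 <= l & (lebesgue_measure A = l%:E)%E.
  have A0 := measure_ge0 (@lebesgue_measure R) A.
  exists (fine (lebesgue_measure A)); first exact: fine_ge0.
  by rewrite fineK// ge0_fin_numE// (le_lt_trans lA)// ltry.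
have mC : measurable_fun setT (count A) by apply: measurable_count_pos Ar.
apply: (@le_trans _ _ (\int[P]_t (count A t)%:E)%E).
  apply: ge0_le_integral => //.
  - by move=> t _; rewrite lee_fin; apply: sumr_ge0 => v _; exact: annulus_ge0.
  - apply/measurable_EFinP; apply: measurable_points_continuous => // v.
    by apply: cvgB; exact: continuous_trapezoid.
  - exact/measurable_EFinP.
  move=> t _; rewrite lee_fin /count (@count_pointsE _ _ (r + 3))// /annulus_sum.
  rewrite (@big_points _ _ _ (n.+1%:R + 2) (r + 3)); last by rewrite lerD2l ler_nat.
  rewrite big_mkcond [leRHS]big_mkcond; apply: ler_sum => v _.
  have [vA|vA] := boolP (v \in A).
    case: ifP => // _; rewrite lerBlDr; apply: le_trans (trapezoid_le1 _ _ _) _.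
    by rewrite lerDl trapezoid_ge0.
  case: ifP => // _; move: vA; rewrite notin_setE /A /= => /negP.
  rewrite -leNgt /g ge_min => /orP[]h.
    by rewrite annulus_in// -/r -/w; lra.
  by rewrite annulus_out// -/r -/w; lra.
rewrite (@poisson_mean _ _ _ P (fun t => count_points A (omega t)) l)//.
  by rewrite -lE; apply: le_trans lA _.
by move=> k; apply: count_poisson.
Qed.

(** The means of the annulus sums are summable, so these sums tend to 0 almost surely; the second
    term of [bad] vanishes as soon as the window reaches some point. *)
Lemma poisson_bad : {ae P, forall t, bad n (omega t) @[n --> \oo] --> 0}.
Proof.
have hA : {ae P, forall t, cvgn (series (annulus_sum ^~ t))}.
  apply: (@ae_cvg_series R _ _ P annulus_sum 10).
  - exact: ler0n.
  - by move=> n t; apply: sumr_ge0 => v _; exact: annulus_ge0.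
  - move=> n; apply: measurable_points_continuous => // v.
    by apply: cvgB; exact: continuous_trapezoid.
  - exact: annulus_sum_mean.
apply: filterS2 hA poisson_has_point => t /cvg_series_cvg_0 tA [v cv].
rewrite -[X in _ --> X]addr0; apply: cvgD.
  rewrite -[X in _ --> X](@min_r _ _ 1)//; apply: cvg_minr; last exact: tA.
  exact: cvg_cst.
apply: cvg_near_cst; exists (Num.truncn `|v|) => // n /= vn.
have vn1 : `|v| <= n.+1%:R.
  by apply: ltW; apply: lt_le_trans (truncnS_gt _) _; rewrite ler_nat.
rewrite max_l// subr_le0 (big_rem v)/=; last first.
  by rewrite mem_points cv andbT; apply: le_trans vn1 _; rewrite lerDl.
rewrite {1}/cutoff trapezoid_in ?width_gt0// lerDl.
by apply: sumr_ge0 => u _; exact: trapezoid_ge0.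
Qed.

End poisson_process.

(** * Convergence in distribution *)

Section bounded_means.
Context d (T : measurableType d) (R : realType) (P : probability T R).

Definition mean (X : T -> R) : R := fine (\int[P]_t (X t)%:E).

Definition bounded_rv (X : T -> R) :=
  measurable_fun setT X /\ exists K, forall t, `|X t| <= K.

Lemma bounded_rv_integrable X : bounded_rv X -> P.-integrable setT (EFin \o X).
Proof.
move=> [mX [K XK]]; apply: measurable_bounded_integrable => //.
  exact: fin_num_fun_lty.
by exists K; split; [exact: num_real|move=> x Kx t _; exact: le_trans (XK t) (ltW Kx)].
Qed.

Lemma meanE X : bounded_rv X -> (\int[P]_t (X t)%:E = (mean X)%:E)%E.
Proof.
by move=> bX; rewrite /mean fineK//; exact: integrable_fin_num (bounded_rv_integrable bX).
Qed.

Lemma mean_le X Y : bounded_rv X -> bounded_rv Y -> (forall t, X t <= Y t) ->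
  mean X <= mean Y.
Proof.
move=> bX bY XY; rewrite -lee_fin -!meanE//; apply: le_integral => //.
- exact: bounded_rv_integrable.
- exact: bounded_rv_integrable.
- by move=> t _; rewrite lee_fin.
Qed.

Lemma meanN X : bounded_rv X -> mean (fun t => - X t) = - mean X.
Proof.
move=> bX; rewrite /mean -fineN; congr fine.
under eq_integral do rewrite EFinN.
by apply: integralN; apply: fin_num_adde_defl; rewrite fin_numN integrable_neg_fin_num//;
  exact: bounded_rv_integrable.
Qed.

(** To be used with [Z] the functional [bad] and [A], [B] the two tail events. The bound is only
    almost sure because the sums are only almost surely well defined. *)
Lemma mean_dist (X Y Z : T -> R) (A B : set T) (a b : R) : bounded_rv X -> bounded_rv Y -> bounded_rv Z ->
  (forall t, 0 <= Z t) -> measurable A -> measurable B -> 0 <= a -> 0 <= b ->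
  {ae P, forall t, `|X t - Y t| <= a + b * (Z t + \1_A t + \1_B t)} ->
  `|mean X - mean Y| <= a + b * (mean Z + fine (P A) + fine (P B)).
Proof.
move=> bX bY bZ Z0 mA mB a0 b0 XY.
have iX := bounded_rv_integrable bX; have iY := bounded_rv_integrable bY.
have [mX _] := bX; have [mY _] := bY; have [mZ _] := bZ.
have I0 (D : set T) t : 0 <= \1_D t :> R by rewrite indicE.
have mI (D : set T) : measurable D -> measurable_fun setT (\1_D : T -> R).
  by move=> mD; exact: measurable_indic.
have PD (D : set T) : measurable D -> (\int[P]_t (\1_D t)%:E = (fine (P D))%:E)%E.
  move=> mD; rewrite fineK; last exact: fin_num_measure.
  by rewrite integral_indic// setIT.
have mS : measurable_fun setT (fun t => Z t + \1_A t + \1_B t : R).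
  by apply: measurable_funD; [apply: measurable_funD => //; exact: mI|exact: mI].
have S0 t : 0 <= Z t + \1_A t + \1_B t by rewrite !addr_ge0.
have hW : (\int[P]_t (a + b * (Z t + \1_A t + \1_B t))%:E =
    (a + b * (mean Z + fine (P A) + fine (P B)))%:E)%E.
  under eq_integral do rewrite EFinD EFinM.
  rewrite ge0_integralD//; first last.
  - by apply: measurable_funeM; exact/measurable_EFinP.
  - by move=> t _; rewrite -EFinM lee_fin mulr_ge0.
  have mSE : measurable_fun setT (fun t => (Z t + \1_A t + \1_B t)%:E) by exact/measurable_EFinP.
  have SE0 t : setT t -> (0 <= (Z t + \1_A t + \1_B t)%:E)%E by rewrite lee_fin.
  rewrite integral_probability_cst (ge0_integralZl_EFin P measurableT SE0 mSE b0).
  rewrite !(EFinD, EFinM); congr (_ + _ * _)%E.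
  under eq_integral do rewrite EFinD.
  rewrite ge0_integralD//; first last.
  - by apply/measurable_EFinP; exact: mI.
  - by apply/measurable_EFinP; apply: measurable_funD => //; exact: mI.
  - by move=> t _; rewrite lee_fin addr_ge0.
  rewrite PD//; congr (_ + _)%E; under eq_integral do rewrite EFinD.
  rewrite ge0_integralD//; first last.
  - by apply/measurable_EFinP; exact: mI.
  - exact/measurable_EFinP.
  - by move=> t _; rewrite lee_fin.
  by rewrite PD// meanE.
rewrite -lee_fin -hW.
have -> : `|mean X - mean Y|%:E = (`|\int[P]_t ((X t)%:E - (Y t)%:E)|)%E.
  by rewrite integralB_EFin// !meanE.
apply: le_trans (le_abse_integral _ _ _) _ => //.
  by apply: emeasurable_funB; exact/measurable_EFinP.
apply: ae_ge0_le_integral => //.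
- apply: measurableT_comp => //; apply: emeasurable_funB; exact/measurable_EFinP.
- by move=> t _; rewrite lee_fin addr_ge0// mulr_ge0.
- apply/measurable_EFinP; apply: measurable_funD; first exact: measurable_cst.
  by apply: measurable_funM => //; exact: measurable_cst.
by apply: filterS XY => t; rewrite -EFinB /= lee_fin.
Qed.

Lemma mean_dct (X_ : nat -> T -> R) (X : T -> R) (K : R) : (forall n, measurable_fun setT (X_ n)) ->
  measurable_fun setT X -> (forall n t, `|X_ n t| <= K) -> (forall t, `|X t| <= K) ->
  {ae P, forall t, X_ n t @[n --> \oo] --> X t} ->
  mean (X_ n) @[n --> \oo] --> mean X.
Proof.
move=> mX_ mX X_K XK cX.
have bX : bounded_rv X by split; last exists K.
have [|||||_ _ h] := @dominated_convergence _ _ _ P setT measurableT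
  (fun n t => (X_ n t)%:E) (fun t => (X t)%:E) (fun=> K%:E).
- by move=> n; exact/measurable_EFinP.
- exact/measurable_EFinP.
- by apply: filterS cX => t ct _; apply: cvg_EFin => //; exact: nearW.
- apply: (@bounded_rv_integrable (fun=> K)); split; first exact: measurable_cst.
  by exists `|K|.
- by apply: nearW => t n _; rewrite lee_fin.
by apply: fine_cvg; rewrite -meanE.
Qed.

End bounded_means.

Section truncation_mean.
Context d (T : measurableType d) (R : realType) (P : probability T R).
Variable omega : T -> configuration R.
Hypothesis momega : random_element omega.
Variables (F : herglotz_pick R -> R) (K : R).
Hypothesis F_cont : continuous F.
Hypothesis F_bound : forall h, `|F h| <= K.

Lemma bounded_rv_stieltjes (H : herglotz_pick R -> R) C : continuous H ->
  (forall h, `|H h| <= C) -> bounded_rv (fun t => H (stieltjes (omega t))).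
Proof.
move=> Hc HC; split; last by exists C.
exact: (measurable_random_element (stieltjes_random_element momega) Hc).
Qed.

Lemma bounded_rv_configuration (H : configuration R -> R) C : continuous H ->
  (forall c, `|H c| <= C) -> bounded_rv (fun t => H (omega t)).
Proof.
by move=> Hc HC; split; [exact: (measurable_random_element momega Hc)|exists C].
Qed.

Lemma bounded_rv_truncated (H : herglotz_pick R -> R) C n : continuous H ->
  (forall h, `|H h| <= C) -> bounded_rv (fun t => H (truncated_stieltjes n (omega t))).
Proof.
move=> Hc HC; apply: (@bounded_rv_configuration (H \o truncated_stieltjes n) C) => [c|c].
  by apply: continuous_comp; [exact: continuous_truncated_stieltjes|exact: Hc].
exact: HC.
Qed.

Lemma normr_bad_le (n : nat) (c : configuration R) : `|bad n c| <= 2.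
Proof. by rewrite ger0_norm ?bad_ge0 ?bad_le2. Qed.

Lemma bounded_rv_bad n : bounded_rv (fun t => bad n (omega t)).
Proof. by apply: bounded_rv_configuration; [exact: continuous_bad|exact: normr_bad_le]. Qed.

(** On the right the law enters only through the mean of a continuous functional and two tail
    probabilities, precisely what the hypotheses control as [M] grows. *)
Lemma truncation_mean_dist k n (e : R) : 0 < e ->
  {ae P, forall t, sums_well_defined (omega t)} ->
  (forall j, (j < k)%N -> 2 * normc (rational_point R j) <= n.+1%:R) ->
  `|mean P (fun t => lipschitz_approx F K k (stieltjes (omega t))) -
    mean P (fun t => lipschitz_approx F K k (truncated_stieltjes n (omega t)))| <=
  k%:R * (e * \sum_(j < k) (1 + 2 * normc (rational_point R j)) + k%:R * n.+1%:R^-1) +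
  6 * K * (mean P (fun t => bad n (omega t)) +
    fine (P [set t | e <= `|tail_sum (omega t) n.+1%:R|]) +
    fine (P [set t | (e%:E <= square_tail_sum (omega t) n.+1%:R)%E])).
Proof.
move=> e0 wd zn.
have n0 : 0 < n.+1%:R :> R by [].
have K0 : 0 <= K := le_trans (normr_ge0 _) (F_bound (herglotz_i R)).
have Lc := @continuous_lipschitz_approx R F K F_bound k.
have Lb := @lipschitz_approx_bounded R F K F_bound k.
have s0 : 0 <= \sum_(j < k) (1 + 2 * normc (rational_point R j)).
  by apply: sumr_ge0 => j _; rewrite addr_ge0// mulr_ge0// normc_ge0.
have a0 : 0 <= k%:R * (e * \sum_(j < k) (1 + 2 * normc (rational_point R j)) +
    k%:R * n.+1%:R^-1).
  by rewrite mulr_ge0// addr_ge0// mulr_ge0// ltW.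
apply: mean_dist => //.
- exact: bounded_rv_stieltjes Lc Lb.
- exact: bounded_rv_truncated Lc Lb.
- exact: bounded_rv_bad.
- by move=> t; exact: bad_ge0.
- exact: measurable_tail_event.
- exact: measurable_square_tail_event.
- by rewrite mulr_ge0.
apply: filterS wd => t [ct cS].
have cs : stieltjes_summable (omega t).
  by apply/stieltjes_summableP; apply: cS; exact: ltr01.
rewrite !indicE.
set A := [set t | _]; set B := [set t | _].
have b0 := bad_ge0 n (omega t).
(* Either the exceptional terms add up to at least 1, and twice the bound [3 K] of
   [lipschitz_approx] suffices, or both tail events fail and [bad n < 1], so that
   [stieltjes_truncation_error] applies. *)
have [big|small] := pselect (1 <= bad n (omega t) + (t \in A)%:R + (t \in B)%:R).
  apply: (@le_trans _ _ (6 * K * 1)).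
    rewrite mulr1; apply: le_trans (ler_normB _ _) _.
    have := Lb (stieltjes (omega t)); have := Lb (truncated_stieltjes n (omega t)).
    lra.
  apply: (@le_trans _ _ (6 * K * (bad n (omega t) + (t \in A)%:R + (t \in B)%:R))).
    by rewrite ler_wpM2l// mulr_ge0.
  by rewrite lerDr.
have [tA|tA] := boolP (t \in A).
  by case: small; rewrite tA addrAC lerDr addr_ge0.
have [tB|tB] := boolP (t \in B).
  by case: small; rewrite tB lerDr addr_ge0.
rewrite (negbTE tA) (negbTE tB) !addr0 in small *.
move: tA tB; rewrite !notin_setE /A /B /= => /negP + /negP; rewrite -!ltNge => tA tB.
have bad1 : bad n (omega t) < 1 by rewrite ltNge; exact/negP.
apply: (@le_trans _ _ (k%:R * (e * \sum_(j < k) (1 + 2 * normc (rational_point R j)) +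
    k%:R * n.+1%:R^-1))); last first.
  by rewrite lerDl !mulr_ge0.
apply: le_trans (@lipschitz_approx_lip R F K F_bound k _ _) _.
rewrite ler_wpM2l// /rational_dist.
apply: (@le_trans _ _ (\sum_(j < k) (e * (1 + 2 * normc (rational_point R j)) + n.+1%:R^-1))).
  apply: ler_sum => j _.
  apply: le_trans (stieltjes_truncation_error (rational_point_gt0 R j) (zn j (ltn_ord j))
    cs bad1 (ct _ n0) (ltW tA) (ltW tB)) _.
  by rewrite lerD2r mulrDr mulr1 [e * _]mulrC.
rewrite big_split /= -mulr_sumr lerD2l sumr_const card_ord -[leLHS]mulr_natl.
exact: lexx.
Qed.
End truncation_mean.

(** The radius is specialized to [n + 1], and the limsup unfolded so that [M] is taken large after
    [n]. *)
Lemma limn_esup_tail (R : realType) (u : R -> nat -> \bar R) (eta : R) : 0 < eta ->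
  limn_esup (u W) @[W --> +oo] --> 0%E ->
  \forall n \near \oo, \forall M \near \oo, (u n.+1%:R M < eta%:E)%E.
Proof.
move=> eta0 u0.
have nb : nbhs (0%E : \bar R) [set x | (x < eta%:E)%E].
  by apply: open_nbhs_nbhs; split; [exact: open_ereal_lt_ereal|rewrite /= lte_fin].
have [A [_ hA]] := u0 _ nb.
exists (Num.truncn A) => // n /= An.
have An1 : A < n.+1%:R.
  by apply: lt_le_trans (truncnS_gt _) _; rewrite ler_nat.
have := hA _ An1; rewrite /= limn_esup_lim (cvg_lim _ (@cvg_esups_inf _ _))// => /ereal_inf_lt[_ [M _ <-] hM].
exists M => // m /= Mm; apply: le_lt_trans hM.
by apply: ereal_sup_ubound; exists m.
Qed.

Lemma cvg_truncated_stieltjes (R : realType) (c : configuration R) :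
  stieltjes_summable c -> has_point c -> bad n c @[n --> \oo] --> 0 ->
  truncated_stieltjes n c @[n --> \oo] --> stieltjes c.
Proof.
move=> cs ne b0; apply: cvg_herglotz => z z0.
have [/(_ z z0)/cvg_complexP[hR hI] _] := stieltjes_spec cs ne.
have near_eq : \forall n \near \oo, stieltjes_partial_sum c z n.+1 + (n.+1%:R^-1) *i =
    truncated_stieltjes n c z.
  move: b0 => /cvgrPdist_lt /(_ 1 ltr01); apply: filterS => n.
  rewrite sub0r normrN => /(le_lt_trans (ler_norm _)) bn.
  by rewrite truncated_stieltjesE.
apply: cvg_trans (near_eq_cvg near_eq) _; apply/cvg_complexP; split.
  rewrite (_ : _ \o _ = fun n => Re (stieltjes_partial_sum c z n.+1)).
    by have := hR; rewrite -(cvg_shiftS (Re \o stieltjes_partial_sum c z)).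
  by apply/funext => n /=; rewrite Re_addc /= addr0.
rewrite (_ : _ \o _ = fun n => Im (stieltjes_partial_sum c z n.+1) + n.+1%:R^-1).
  rewrite -[X in _ --> X]addr0; apply: cvgD; last exact: cvg_harmonic.
  by have := hI; rewrite -(cvg_shiftS (Im \o stieltjes_partial_sum c z)).
by apply/funext => n /=; rewrite Im_addc.
Qed.

(** Here [x0], [y0] are the means of the full transforms, limiting and at [M], and [x1], [y1] those
    of the truncated ones; [4 delta] bounds the mean of [bad] plus both tail probabilities. *)
Lemma three_step_error (R : realType) (K delta x0 x1 y1 y0 a b : R) : 0 < delta ->
  `|x0 - x1| < delta -> `|x1 - y1| < delta ->
  `|y0 - y1| <= a + b + 6 * K * (4 * delta) -> a <= delta -> b <= delta ->
  `|x0 - y0| < (5 + 24 * K) * delta.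
Proof.
move=> delta0; rewrite ler_norml !ltr_norml.
move=> /andP[h1 h2] /andP[h3 h4] /andP[h5 h6] h7 h8.
by apply/andP; split; lra.
Qed.

(** * Passage to the limit in the means *)

Section convergence.
Variables (R : realType) (d : nat -> measure_display)
  (T : forall M : nat, measurableType (d M)) (P : forall M : nat, probability (T M) R)
  (omegahat : forall M : nat, T M -> configuration R)
  (d0 : measure_display) (T0 : measurableType d0) (P0 : probability T0 R)
  (omega : T0 -> configuration R).
Arguments omegahat : clear implicits.
Hypothesis omega_poisson : standard_poisson P0 omega.
Hypothesis well_defined : forall M, {ae P M, forall t, sums_well_defined (omegahat M t)}.
Hypothesis cvg_omega : cvg_in_distribution P omegahat P0 omega.
Hypothesis tail0 : forall eps : R, 0 < eps ->
  limn_esup (fun M => P M [set t | eps <= `|tail_sum (omegahat M t) W|])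
    @[W --> +oo] --> 0%E.
Hypothesis square_tail0 : forall eps : R, 0 < eps ->
  limn_esup (fun M =>
      P M [set t | (eps%:E <= square_tail_sum (omegahat M t) W)%E])
    @[W --> +oo] --> 0%E.

Let momegahat M : random_element (omegahat M). Proof. by case: cvg_omega. Qed.
Let momega : random_element omega. Proof. by case: cvg_omega. Qed.

Let cvg_mean_configuration (H : configuration R -> R) C : continuous H ->
  (forall c, `|H c| <= C) ->
  mean (P M) (fun t => H (omegahat M t)) @[M --> \oo] --> mean P0 (fun t => H (omega t)).
Proof.
move=> Hc HC; have [_ _ /(_ H Hc (ex_intro _ C HC))] := cvg_omega.
rewrite unlock => h; apply: fine_cvg; rewrite -meanE//.
exact: bounded_rv_configuration Hc HC.
Qed.

Section lipschitz.
Variables (F : herglotz_pick R -> R) (K : R).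
Hypothesis F_cont : continuous F.
Hypothesis F_bound : forall h, `|F h| <= K.

Let K_ge0 : 0 <= K.
Proof. exact: le_trans (normr_ge0 _) (F_bound (herglotz_i R)). Qed.

Let FL k := lipschitz_approx F K k.
Let FL_cont k : continuous (FL k). Proof. exact: continuous_lipschitz_approx. Qed.
Let FL_bound k h : `|FL k h| <= 3 * K. Proof. exact: lipschitz_approx_bounded. Qed.

Let mean_bad0 : mean P0 (fun t => bad n (omega t)) @[n --> \oo] --> 0.
Proof.
have -> : 0 = mean P0 (fun=> 0) :> R by rewrite /mean integral0.
apply: (@mean_dct _ _ _ P0 (fun n t => bad n (omega t)) (fun=> 0) 2).
- by move=> n; have [] := bounded_rv_bad momega n.
- exact: measurable_cst.
- by move=> n t; exact: normr_bad_le.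
- by move=> t; rewrite normr0.
- exact: poisson_bad.
Qed.

Let mean_truncated k : mean P0 (fun t => FL k (truncated_stieltjes n (omega t)))
  @[n --> \oo] --> mean P0 (fun t => FL k (stieltjes (omega t))).
Proof.
apply: (@mean_dct _ _ _ P0 (fun n t => FL k (truncated_stieltjes n (omega t)))
  (fun t => FL k (stieltjes (omega t))) (3 * K)) => //.
- by move=> n; have [] := bounded_rv_truncated momega n (@FL_cont k) (@FL_bound k).
- by have [] := bounded_rv_stieltjes momega (@FL_cont k) (@FL_bound k).
have := poisson_bad omega_poisson.
apply: filterS3 (poisson_summable omega_poisson) (poisson_has_point omega_poisson).
move=> t cs ne b0; apply: continuous_cvg; first exact: FL_cont.
exact: cvg_truncated_stieltjes.
Qed.

Let cvg_mean_lipschitz k : mean (P M) (fun t => FL k (stieltjes (omegahat M t)))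
  @[M --> \oo] --> mean P0 (fun t => FL k (stieltjes (omega t))).
Proof.
apply/cvgrPdist_lt => eta eta0.
pose delta := eta / (5 + 24 * K).
have c0 : 0 < 5 + 24 * K by rewrite ltr_wpDr// mulr_ge0.
have delta0 : 0 < delta by rewrite divr_gt0.
pose C := \sum_(j < k) (1 + 2 * normc (rational_point R j)).
have C0 : 0 <= C by apply: sumr_ge0 => j _; rewrite addr_ge0// mulr_ge0// normc_ge0.
have kC0 : 0 < k%:R * C + 1 by rewrite ltr_wpDl// mulr_ge0.
(* The threshold depends only on the first [k] rational points, through [C], and is fixed before [n]
   and [M]. *)
pose e := delta / (k%:R * C + 1).
have e0 : 0 < e by rewrite divr_gt0.
have kCe : k%:R * (e * C) <= delta.
  rewrite mulrCA /e mulrAC ler_pdivrMr// ler_wpM2l// ?(ltW delta0)//.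
  by rewrite lerDl.
near (\oo : set_system nat) => n.
have nk : k%:R * (k%:R * n.+1%:R^-1) <= delta.
  rewrite mulrA ler_pdivrMr// -ler_pdivrMl//.
  apply: ltW; apply: lt_le_trans (truncnS_gt _) _; rewrite ler_nat ltnS.
  by near: n; exact: nbhs_infty_ge.
have zn j : (j < k)%N -> 2 * normc (rational_point R j) <= n.+1%:R.
  move=> jk; apply: (@le_trans _ _ C).
    rewrite /C (bigD1 (Ordinal jk))//=.
    have : 0 <= \sum_(i < k | i != Ordinal jk) (1 + 2 * normc (rational_point R i)).
      by apply: sumr_ge0 => i _; rewrite addr_ge0// mulr_ge0// normc_ge0.
    by set x := normc _; lra.
  apply: ltW; apply: lt_le_trans (truncnS_gt _) _; rewrite ler_nat ltnS.
  by near: n; exact: nbhs_infty_ge.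
have bn : mean P0 (fun t => bad n (omega t)) < delta.
  near: n; move: mean_bad0 => /cvgrPdist_lt /(_ _ delta0); apply: filterS => n.
  by rewrite sub0r normrN; apply: le_lt_trans; exact: ler_norm.
have tn : `|mean P0 (fun t => FL k (stieltjes (omega t))) -
    mean P0 (fun t => FL k (truncated_stieltjes n (omega t)))| < delta.
  by near: n; move: (@mean_truncated k) => /cvgrPdist_lt /(_ _ delta0).
have hA : \forall M \near \oo,
    (P M [set t | (e <= `|tail_sum (omegahat M t) n.+1%:R|)%R] < delta%:E)%E.
  near: n; exact: (@limn_esup_tail R
    (fun W M => P M [set t | e <= `|tail_sum (omegahat M t) W|])
    delta delta0 (tail0 e0)).
have hB : \forall M \near \oo,
    (P M [set t | (e%:E <= square_tail_sum (omegahat M t) n.+1%:R)%E] < delta%:E)%E.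
  near: n; exact: (@limn_esup_tail R
    (fun W M => P M [set t | (e%:E <= square_tail_sum (omegahat M t) W)%E])
    delta delta0 (square_tail0 e0)).
near=> M.
have h1 := truncation_mean_dist (@momegahat M) F_bound e0 (@well_defined M) zn.
have pA : fine (P M [set t | e <= `|tail_sum (omegahat M t) n.+1%:R|]) < delta.
  rewrite -lte_fin fineK; first by near: M.
  by apply: fin_num_measure; exact: measurable_tail_event.
have pB : fine (P M [set t | (e%:E <= square_tail_sum (omegahat M t) n.+1%:R)%E]) < delta.
  rewrite -lte_fin fineK; first by near: M.
  by apply: fin_num_measure; exact: measurable_square_tail_event.
have bM : mean (P M) (fun t => bad n (omegahat M t)) < 2 * delta.
  have : `|mean P0 (fun t => bad n (omega t)) -
      mean (P M) (fun t => bad n (omegahat M t))| < delta.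
    near: M; have := cvg_mean_configuration (@continuous_bad R n) (@normr_bad_le R n).
    by move=> /cvgrPdist_lt /(_ _ delta0).
  by rewrite ltr_norml => /andP[h2 h3]; lra.
have gM : `|mean P0 (fun t => FL k (truncated_stieltjes n (omega t))) -
    mean (P M) (fun t => FL k (truncated_stieltjes n (omegahat M t)))| < delta.
  near: M.
  have hc : continuous (FL k \o @truncated_stieltjes R n).
    move=> c; apply: continuous_comp; first exact: continuous_truncated_stieltjes.
    exact: FL_cont.
  have := cvg_mean_configuration hc (fun c => @FL_bound k _).
  by move=> /cvgrPdist_lt /(_ _ delta0).
have etaE : eta = (5 + 24 * K) * delta by rewrite /delta mulrC divfK ?gt_eqF.
have h2 : 6 * K * (mean (P M) (fun t => bad n (omegahat M t)) +
    fine (P M [set t | e <= `|tail_sum (omegahat M t) n.+1%:R|]) +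
    fine (P M [set t | (e%:E <= square_tail_sum (omegahat M t) n.+1%:R)%E])) <=
    6 * K * (4 * delta).
  by rewrite ler_wpM2l ?mulr_ge0//; lra.
have h3 := le_trans h1 (lerD (lexx _) h2).
rewrite mulrDr in h3.
rewrite etaE; exact: (three_step_error delta0 tn gM h3 kCe nk).
Unshelve. all: by end_near.
Qed.

(** The limit in [k] is taken only under [P0], by dominated convergence; at [M] the inequality
    [lipschitz_approx <= F] along transforms is enough, so no uniformity in [M] is asked of the
    approximation. *)
Lemma mean_lower_semicontinuous (eta : R) : 0 < eta ->
  \forall M \near \oo, mean P0 (fun t => F (stieltjes (omega t))) - eta <
    mean (P M) (fun t => F (stieltjes (omegahat M t))).
Proof.
move=> eta0; have eta2 : 0 < eta / 2 by rewrite divr_gt0.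
have : mean P0 (fun t => FL k (stieltjes (omega t))) @[k --> \oo] -->
    mean P0 (fun t => F (stieltjes (omega t))).
  apply: (@mean_dct _ _ _ P0 (fun k t => FL k (stieltjes (omega t)))
    (fun t => F (stieltjes (omega t))) (3 * K)) => //.
  - by move=> k; have [] := bounded_rv_stieltjes momega (@FL_cont k) (@FL_bound k).
  - by have [] := bounded_rv_stieltjes momega F_cont F_bound.
  - by move=> t; apply: le_trans (F_bound _) _; have := K_ge0; lra.
  - apply: nearW => t; apply: cvg_lipschitz_approx => //.
    exact: schwarz_pick_stieltjes.
move=> /cvgrPdist_lt /(_ _ eta2)[k _ /(_ k (leqnn k))] /= hk.
have := @cvg_mean_lipschitz k; move=> /cvgrPdist_lt /(_ _ eta2).
apply: filterS => M hM.
have : mean (P M) (fun t => FL k (stieltjes (omegahat M t))) <=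
    mean (P M) (fun t => F (stieltjes (omegahat M t))).
  apply: mean_le.
  - exact: bounded_rv_stieltjes (@momegahat M) _ _ (@FL_cont k) (@FL_bound k).
  - exact: bounded_rv_stieltjes (@momegahat M) _ _ F_cont F_bound.
  - move=> t; apply: lipschitz_approx_le => //; exact: schwarz_pick_stieltjes.
move: hk hM; rewrite !ltr_norml => /andP[_ h1] /andP[_ h2]; lra.
Qed.
End lipschitz.

Lemma cvg_stieltjes : cvg_in_distribution P (fun M t => stieltjes (omegahat M t))
  P0 (fun t => stieltjes (omega t)).
Proof.
split; [by move=> M; exact: stieltjes_random_element|exact: stieltjes_random_element|].
move=> F Fc [K FK].
have bM M : bounded_rv (fun t => F (stieltjes (omegahat M t))).
  exact: bounded_rv_stieltjes (@momegahat M) _ _ Fc FK.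
have b0 : bounded_rv (fun t => F (stieltjes (omega t))).
  exact: bounded_rv_stieltjes momega _ _ Fc FK.
rewrite unlock [X in _ --> X](meanE P0 b0).
rewrite [X in X @ _ --> _](_ : _ =
    (fun M => (mean (P M) (fun t => F (stieltjes (omegahat M t))))%:E)); last first.
  by apply/funext => M; exact: meanE.
apply: cvg_EFin; first exact: nearW.
apply/cvgrPdist_lt => eta eta0.
have NFc : continuous (fun h => - F h).
  move=> h; have Fh : F g @[g --> h] --> F h by exact: Fc.
  exact: (@cvgN _ R _ _ (nbhs_filter h) _ _ Fh).
have NFK h : `|- F h| <= K by rewrite normrN.
move: (mean_lower_semicontinuous Fc FK eta0) (mean_lower_semicontinuous NFc NFK eta0).
apply: filterS2 => M h1; rewrite (meanN P0 b0) (meanN (P M) (bM M)) => h2.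
by rewrite /= ltr_norml; apply/andP; split; lra.
Qed.
End convergence.

Theorem theorem4p1 (R : realType)
    (d : nat -> measure_display) (T : forall M : nat, measurableType (d M))
    (P : forall M : nat, probability (T M) R)
    (omegahat : forall M : nat, T M -> configuration R)
    (d0 : measure_display) (T0 : measurableType d0) (P0 : probability T0 R)
    (omega : T0 -> configuration R) :
  (forall M, random_element (omegahat M)) ->
  standard_poisson P0 omega ->
  (forall M, {ae P M, forall t, sums_well_defined (omegahat M t)}) ->
  cvg_in_distribution P omegahat P0 omega ->
  (forall eps : R, 0 < eps ->
    limn_esup (fun M => P M [set t | eps <= `|tail_sum (omegahat M t) W|])
      @[W --> +oo] --> 0%E) ->
  (forall eps : R, 0 < eps ->
    limn_esup (fun M =>
        P M [set t | (eps%:E <= square_tail_sum (omegahat M t) W)%E])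
      @[W --> +oo] --> 0%E) ->
  cvg_in_distribution P (fun M t => stieltjes (omegahat M t))
    P0 (fun t => stieltjes (omega t)).
Proof. by move=> _; exact: cvg_stieltjes. Qed.
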